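(* Let $V$ be a vector space of dimension $n\ge1$ over $\Bbbk$ and let $U\subset\mathrm{Sym}^2V^\vee$ be a subspace with $\dim U=n$ and $\bigcap_{u\in U}Q_u=\varnothing$ in $\mathbb P(V)$, so that $(\mathbb P(U),\mathcal C\ell_0(V))$ is a minimal Clifford space with coordinate algebra $\mathbf B_U$. Then $\mathbf B_U$ is a flat deformation of the polynomial algebra $\mathrm{Sym}^\bullet(V)$, and the quadratic dual algebra $\mathbf B_U^!$ is a flat deformation of the exterior algebra $\bigwedge^\bullet V^\vee$.
   Context: $\Bbbk$ is a field of characteristic zero. $\mathbb P(E)$ denotes the projective space of one-dimensional subspaces of $E$, so $H^0(\mathbb P(E),\mathcal O(1))=E^\vee$. For $u\in U$, $Q_u\subset\mathbb P(V)$ is the zero scheme of the quadratic form $u$; emptiness of the intersection is scheme-theoretic (no nonzero common zero over an algebraic closure). Let $\mathbf q_U\colon\mathrm{Sym}^2V\otimes\mathcal O\to U^\vee\otimes\mathcal O\to\mathcal O(1)$ on $\mathbb P(U)$ be the composition of the dual of $U\hookrightarrow\mathrm{Sym}^2V^\vee$ and the tautological epimorphism. For $i\in\mathbb Z$ set $\mathcal C\ell_i(V)=\bigoplus_{s\in\mathbb Z}\bigwedge^{i-2s}V\otimes\mathcal O(s)$ on $\mathbb P(U)$ (with $\bigwedge^jV=0$ unless $0\le j\le n$). Clifford multiplication is the associative $\mathcal O$-bilinear product $\mathcal C\ell_i(V)\otimes\mathcal C\ell_j(V)\to\mathcal C\ell_{i+j}(V)$ with unit $1\in\bigwedge^0V\otimes\mathcal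 O$ determined by $$v\cdot(w_1\wedge\dots\wedge w_m)=v\wedge w_1\wedge\dots\wedge w_m+\sum_{t=1}^m(-1)^{t-1}\mathbf q_U(v,w_t)\,w_1\wedge\dots\wedge\widehat{w_t}\wedge\dots\wedge w_m .$$ The coordinate algebra is $\mathbf B_U=\bigoplus_{i\ge0}\mathrm{Hom}_{\mathcal C\ell_0(V)}(\mathcal C\ell_0(V),\mathcal C\ell_i(V))=\bigoplus_{i\ge0}H^0(\mathbb P(U),\mathcal C\ell_i(V))$ with product induced by Clifford multiplication; its first component is $V$. The algebra $\mathbf B_U$ is Koszul (in particular quadratic): $\mathbf B_U=\mathbf T(V)/\langle R\rangle$ with $R\subset V\otimes V$; its quadratic dual is $\mathbf B_U^!=\mathbf T(V^\vee)/\langle R^\perp\rangle$, $R^\perp\subset V^\vee\otimes V^\vee$ the annihilator of $R$. A flat family of graded algebras over a base scheme $S$ is a sheaf of graded $\mathcal O_S$-algebras whose graded components are locally free of finite rank; its members are the fibers at $\Bbbk$-points of $S$. A graded algebra $A$ is a flat deformation of $A'$ if they can be connected by a finite chain of flat families of graded algebras over connected bases (consecutive members of the chain being isomorphic to fibers of the same family). *)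

(* Defs.v *)
From HB Require Import structures.
From Stdlib Require Import Relation_Operators.
From mathcomp Require Import boolp classical_sets topology_structure connected.
From mathcomp Require Import all_boot all_order all_algebra generic_quotient.
From mathcomp Require Import ring_quotient fraction.
From mathcomp Require Import -(notations) mpoly.
From mathcomp Require Import ring.

Set Implicit Arguments.
Unset Strict Implicit.
Unset Printing Implicit Defensive.

Import GRing.Theory.
Local Open Scope ring_scope.

(* Unital associative algebras graded by the natural numbers, given by their
   homogeneous components.  The product [A_i x A_j -> A_l] takes a proof of
   [i + j = l], so that associativity can be stated without casts. *)
Record galg (k : fieldType) := Galg {
  gcomp :> nat -> lmodType k;
  gone : gcomp 0;
  gmul : forall i j l, (i + j)%N = l -> gcomp i -> gcomp j -> gcomp l;
  gmulDl : forall i j l (e : (i + j)%N = l) c (x x' : gcomp i) (y : gcomp j),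
    gmul e (c *: x + x') y = c *: gmul e x y + gmul e x' y;
  gmulDr : forall i j l (e : (i + j)%N = l) c (x : gcomp i) (y y' : gcomp j),
    gmul e x (c *: y + y') = c *: gmul e x y + gmul e x y';
  gmul1l : forall i (e : (0 + i)%N = i) (x : gcomp i), gmul e gone x = x;
  gmul1r : forall i (e : (i + 0)%N = i) (x : gcomp i), gmul e x gone = x;
  gmulA : forall a b c ab bc d
      (e1 : (a + b)%N = ab) (e2 : (ab + c)%N = d)
      (e3 : (b + c)%N = bc) (e4 : (a + bc)%N = d)
      (x : gcomp a) (y : gcomp b) (z : gcomp c),
    gmul e2 (gmul e1 x y) z = gmul e4 x (gmul e3 y z);
}.
Arguments gone {k} _.

Record opens (X : topologicalType) := Opens {
  oset :> X -> Prop;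
  oset_open : open (oset : set X);
}.

Definition is_sheaf (X : topologicalType) (F : opens X -> Type)
    (res : forall W W' : opens X, (W' `<=` W)%classic -> F W -> F W') : Prop :=
  forall (I : Type) (W : opens X) (D : I -> opens X)
      (DW : forall i, (D i `<=` W)%classic),
    (forall x, W x -> exists i, D i x) ->
  forall s : forall i, F (D i),
    (forall i j (W' : opens X) (hi : (W' `<=` D i)%classic)
        (hj : (W' `<=` D j)%classic), res _ _ hi (s i) = res _ _ hj (s j)) ->
  exists! t : F W, forall i, res _ _ (DW i) t = s i.

(* A topological space with a sheaf of commutative k-algebras; the k-algebra
   structure is given by the ring morphisms [rs_str].  The zero ring has to be
   allowed: it is the ring of sections over the empty set. *)
Record ringed_space (k : fieldType) := RingedSpace {
  rs_space :> topologicalType;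
  rs_O : opens rs_space -> comPzRingType;
  rs_str : forall W, {rmorphism k -> rs_O W};
  rs_res : forall W W' : opens rs_space,
    (W' `<=` W)%classic -> {rmorphism rs_O W -> rs_O W'};
  rs_res_str : forall (W W' : opens rs_space) (h : (W' `<=` W)%classic) c,
    rs_res h (rs_str W c) = rs_str W' c;
  rs_res_id : forall (W : opens rs_space) (h : (W `<=` W)%classic) s,
    rs_res h s = s;
  rs_res_comp : forall (W W' W'' : opens rs_space) (h : (W' `<=` W)%classic)
      (h' : (W'' `<=` W')%classic) (h'' : (W'' `<=` W)%classic) s,
    rs_res h' (rs_res h s) = rs_res h'' s;
  rs_sheaf : is_sheaf
    (fun (W W' : opens rs_space) h => rs_res h : rs_O W -> rs_O W');
}.

Definition prime_ideal (A : comPzRingType) (P : set A) : Prop :=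
  [/\ P 0, forall a b, P a -> P b -> P (a + b),
      forall a b, P b -> P (a * b),
      ~ P 1 & forall a b, P (a * b) -> P a \/ P b].

(* [f] exhibits B as the localization A_a. *)
Definition is_localization (A B : comPzRingType) (a : A) (f : A -> B) : Prop :=
  [/\ exists b, f a * b = 1,
      forall s : B, exists N b, s * f a ^+ N = f b &
      forall b, f b = 0 -> exists N, a ^+ N * b = 0].

(* The restriction of the ringed space X to W is isomorphic to Spec A for some
   ring A: [phi] is a homeomorphism from W to the set of prime ideals of A with
   the Zariski topology, and [theta] induces, for all a in A, an isomorphism
   between A_a and the ring of sections over the preimage of the basic open set
   D(a).  As the D(a) are a basis of Spec A, this is an isomorphism of ringed
   spaces (it respects the local rings, being an isomorphism). *)
Definition affine (k : fieldType) (X : ringed_space k) (W : opens X) : Prop :=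
  exists (A : comPzRingType) (phi : X -> set A)
      (theta : {rmorphism A -> rs_O W}),
  [/\ forall x, W x -> prime_ideal (phi x),
      forall P, prime_ideal P -> exists! x, W x /\ phi x = P,
      forall W' : set X, (W' `<=` W)%classic ->
        (open W' <-> forall x, W' x -> exists a, ~ phi x a /\
           forall y, W y -> ~ phi y a -> W' y) &
      forall (a : A) (D : opens X) (h : (D `<=` W)%classic),
        (forall x, D x <-> W x /\ ~ phi x a) ->
        is_localization a (fun b => rs_res h (theta b))].

Record scheme (k : fieldType) := Scheme {
  sch_rs :> ringed_space k;
  sch_affine : forall x : sch_rs, exists2 W : opens sch_rs, W x & affine W;
}.

(* A k-point of S: a point x with a local morphism of k-algebras from the local
   ring at x to k, given by its values [kp_ev] on germs of functions. *)
Record kpoint (k : fieldType) (S : scheme k) := KPoint {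
  kp_pt :> S;
  kp_ev : forall W : opens S, W kp_pt -> {rmorphism rs_O W -> k};
  kp_ev_str : forall (W : opens S) (hx : W kp_pt) c, kp_ev hx (rs_str W c) = c;
  kp_ev_res : forall (W W' : opens S) (h : (W' `<=` W)%classic)
      (hx : W kp_pt) (hx' : W' kp_pt) s, kp_ev hx' (rs_res h s) = kp_ev hx s;
  kp_local : forall (W : opens S) (hx : W kp_pt) s, kp_ev hx s != 0 ->
    exists (W' : opens S) (h : (W' `<=` W)%classic),
      W' kp_pt /\ exists t, rs_res h s * t = 1;
}.

(* Sheaves of graded algebras with locally free components of finite rank. *)
Record flat_family (k : fieldType) (S : scheme k) := FlatFamily {
  ff_comp : nat -> forall W : opens S, lmodType (rs_O W);
  ff_res : forall d (W W' : opens S),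
    (W' `<=` W)%classic -> ff_comp d W -> ff_comp d W';
  ff_resD : forall d (W W' : opens S) (h : (W' `<=` W)%classic) f
      (s t : ff_comp d W),
    ff_res h (f *: s + t) = rs_res h f *: ff_res h s + ff_res h t;
  ff_res_id : forall d (W : opens S) (h : (W `<=` W)%classic) (s : ff_comp d W),
    ff_res h s = s;
  ff_res_comp : forall d (W W' W'' : opens S) (h : (W' `<=` W)%classic)
      (h' : (W'' `<=` W')%classic) (h'' : (W'' `<=` W)%classic)
      (s : ff_comp d W),
    ff_res h' (ff_res h s) = ff_res h'' s;
  ff_sheaf : forall d, is_sheaf (@ff_res d);
  ff_locally_free : forall d (x : S), exists (W : opens S) (r : nat)
      (b : 'I_r -> ff_comp d W),
    W x /\ forall (W' : opens S) (h : (W' `<=` W)%classic) (s : ff_comp d W'),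
      exists! c : 'I_r -> rs_O W', s = \sum_i c i *: ff_res h (b i);
  ff_one : forall W, ff_comp 0 W;
  ff_mul : forall W i j l, (i + j)%N = l ->
    ff_comp i W -> ff_comp j W -> ff_comp l W;
  ff_res_one : forall (W W' : opens S) (h : (W' `<=` W)%classic),
    ff_res h (ff_one W) = ff_one W';
  ff_res_mul : forall (W W' : opens S) (h : (W' `<=` W)%classic) i j l
      (e : (i + j)%N = l) (s : ff_comp i W) (t : ff_comp j W),
    ff_res h (ff_mul e s t) = ff_mul e (ff_res h s) (ff_res h t);
  ff_mulDl : forall W i j l (e : (i + j)%N = l) f
      (s s' : ff_comp i W) (t : ff_comp j W),
    ff_mul e (f *: s + s') t = f *: ff_mul e s t + ff_mul e s' t;
  ff_mulDr : forall W i j l (e : (i + j)%N = l) f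
      (s : ff_comp i W) (t t' : ff_comp j W),
    ff_mul e s (f *: t + t') = f *: ff_mul e s t + ff_mul e s t';
  ff_mul1l : forall W i (e : (0 + i)%N = i) (s : ff_comp i W),
    ff_mul e (ff_one W) s = s;
  ff_mul1r : forall W i (e : (i + 0)%N = i) (s : ff_comp i W),
    ff_mul e s (ff_one W) = s;
  ff_mulA : forall W a b c ab bc d
      (e1 : (a + b)%N = ab) (e2 : (ab + c)%N = d)
      (e3 : (b + c)%N = bc) (e4 : (a + bc)%N = d)
      (s : ff_comp a W) (t : ff_comp b W) (u : ff_comp c W),
    ff_mul e2 (ff_mul e1 s t) u = ff_mul e4 s (ff_mul e3 t u);
}.

(* A is isomorphic to the fiber F_x / m_x F_x of F at the k-point x: [pi] is a
   surjective morphism of graded algebras from the stalk F_x to A, linear over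
   the evaluation at x, whose kernel is m_x F_x. *)
Definition is_fiber (k : fieldType) (S : scheme k) (F : flat_family S)
    (x : kpoint S) (A : galg k) : Prop :=
  exists pi : forall d (W : opens S), W x -> ff_comp F d W -> A d,
  [/\ forall d (W : opens S) (hx : W x) f (s t : ff_comp F d W),
        pi d W hx (f *: s + t) = kp_ev hx f *: pi d W hx s + pi d W hx t,
      forall d (W W' : opens S) (h : (W' `<=` W)%classic) (hx : W x)
          (hx' : W' x) (s : ff_comp F d W),
        pi d W' hx' (ff_res h s) = pi d W hx s,
      (forall (W : opens S) (hx : W x), pi 0 W hx (ff_one F W) = gone A) /\
      (forall (W : opens S) (hx : W x) i j l (e : (i + j)%N = l)
          (s : ff_comp F i W) (t : ff_comp F j W),
        pi l W hx (ff_mul e s t) = gmul e (pi i W hx s) (pi j W hx t)),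
      forall d (a : A d), exists (W : opens S) (hx : W x) s, pi d W hx s = a &
      forall d (W : opens S) (hx : W x) (s : ff_comp F d W),
        pi d W hx s = 0 ->
        exists (W' : opens S) (h : (W' `<=` W)%classic) (hx' : W' x) (r : nat)
          (f : 'I_r -> rs_O W') (t : 'I_r -> ff_comp F d W'),
        (forall i, kp_ev hx' (f i) = 0) /\ ff_res h s = \sum_i f i *: t i].

Definition fibers_of_one_family (k : fieldType) (A A' : galg k) : Prop :=
  exists (S : scheme k) (F : flat_family S) (x x' : kpoint S),
    [/\ connected [set: S]%classic, is_fiber F x A & is_fiber F x' A'].

Definition flat_deformation (k : fieldType) : galg k -> galg k -> Prop :=
  clos_trans (galg k) (@fibers_of_one_family k).

Section QuotientModule.
Variables (k : fieldType) (V : lmodType k) (I : submodClosed V).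
Local Open Scope quotient_scope.

(* [submodClosed] does not inherit from [zmodClosed]. *)
Definition submod_pred : pred V := fun x => x \in I.

Lemma submod_pred_zmod_closed : zmod_closed submod_pred.
Proof.
split=> [|x y Ix Iy]; rewrite unfold_in ?rpred0 //.
by rewrite rpredD // -scaleN1r rpredZ.
Qed.
HB.instance Definition _ :=
  GRing.isZmodClosed.Build V submod_pred submod_pred_zmod_closed.

Definition lquot :=
  Quotient.quot (GRing.ZmodClosed.clone V submod_pred _).
HB.instance Definition _ := GRing.Zmodule.on lquot.
HB.instance Definition _ := EqQuotient.on lquot.

Definition lquot_pi (x : V) : lquot := \pi_lquot x.
Definition lquot_scale (c : k) (q : lquot) : lquot := lquot_pi (c *: repr q).

Lemma lquot_piP x y : lquot_pi x = lquot_pi y <-> x - y \in I.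
Proof.
have := Quotient.idealrBE (GRing.ZmodClosed.clone V submod_pred _) x y.
by rewrite unfold_in => ->; split=> /eqP.
Qed.

Lemma lquot_reprK q : lquot_pi (repr q) = q.
Proof. exact: reprK. Qed.

Lemma lquot_piD x y : lquot_pi (x + y) = lquot_pi x + lquot_pi y.
Proof. exact: (raddfD \pi_lquot). Qed.

Lemma lquot_scale_pi c x : lquot_scale c (lquot_pi x) = lquot_pi (c *: x).
Proof.
apply/lquot_piP; rewrite -scalerBr rpredZ //.
by apply/lquot_piP; rewrite lquot_reprK.
Qed.

Lemma lquot_scaleA a b q :
  lquot_scale a (lquot_scale b q) = lquot_scale (a * b) q.
Proof. by rewrite -[q]lquot_reprK !lquot_scale_pi scalerA. Qed.

Lemma lquot_scale1 : left_id 1 lquot_scale.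
Proof. by move=> q; rewrite -[q]lquot_reprK lquot_scale_pi scale1r. Qed.

Lemma lquot_scaleDr : right_distributive lquot_scale +%R.
Proof.
move=> c p q; rewrite -[p]lquot_reprK -[q]lquot_reprK -lquot_piD.
by rewrite !lquot_scale_pi scalerDr lquot_piD.
Qed.

Lemma lquot_scaleDl q : {morph lquot_scale^~ q : a b / a + b}.
Proof.
by move=> a b /=; rewrite -[q]lquot_reprK !lquot_scale_pi scalerDl lquot_piD.
Qed.

HB.instance Definition _ := GRing.Zmodule_isLmodule.Build k lquot
  lquot_scaleA lquot_scale1 lquot_scaleDr lquot_scaleDl.

Lemma lquot_pi_linear c x y :
  lquot_pi (c *: x + y) = c *: lquot_pi x + lquot_pi y.
Proof. by rewrite lquot_piD -lquot_scale_pi. Qed.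

End QuotientModule.

(* The two-sided ideal generated by a set of elements of degree 2. *)
Inductive gideal (k : fieldType) (A : galg k) (R : A 2 -> Prop) :
    forall d, A d -> Prop :=
  | gideal_gen i j l d (e : (i + 2)%N = j) (e' : (j + l)%N = d)
      (a : A i) (r : A 2) (b : A l) :
      R r -> gideal R (gmul e' (gmul e a r) b)
  | gideal0 d : gideal R (0 : A d)
  | gidealD d c (x y : A d) :
      gideal R x -> gideal R y -> gideal R (c *: x + y).

Section QuotientAlgebra.
Variables (k : fieldType) (A : galg k) (R : A 2 -> Prop).

Definition gideal_pred d : pred (A d) := fun x => `[< gideal R x >].

Lemma gideal_submod d : GRing.submod_closed (@gideal_pred d).
Proof.
split=> [|c x y]; first exact/asboolP/gideal0.
by move=> /asboolP Ix /asboolP Iy; apply/asboolP/gidealD.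
Qed.
HB.instance Definition _ d :=
  GRing.isSubmodClosed.Build k (A d) (@gideal_pred d) (gideal_submod d).
Definition gideal_submodClosed d : submodClosed (A d) :=
  GRing.SubmodClosed.clone k (A d) (@gideal_pred d) _.

Lemma gmul0l i j l (e : (i + j)%N = l) (y : A j) : gmul e (0 : A i) y = 0.
Proof.
by have := gmulDl e (-1) (0 : A i) 0 y; rewrite scaler0 addr0 scaleN1r addNr.
Qed.

Lemma gmul0r i j l (e : (i + j)%N = l) (x : A i) : gmul e x (0 : A j) = 0.
Proof.
by have := gmulDr e (-1) x (0 : A j) 0; rewrite scaler0 addr0 scaleN1r addNr.
Qed.

Lemma gideal_mull i j l (e : (i + j)%N = l) (x : A i) (y : A j) :
  gideal R y -> gideal R (gmul e x y).
Proof.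
move=> Iy; elim: Iy l e => {j y}.
- move=> a b c d eb ed u r v Rr l e.
  have e1 : (i + b)%N = (i + b)%N by [].
  have e2 : (i + b + c)%N = l by rewrite -addnA ed.
  have e3 : (i + a)%N = (i + a)%N by [].
  have e4 : (i + a + 2)%N = (i + b)%N by rewrite -addnA eb.
  rewrite -(gmulA e1 e2) -(gmulA e3 e4); exact: gideal_gen.
- by move=> d l e; rewrite gmul0r; exact: gideal0.
by move=> d c y z _ IHy _ IHz l e; rewrite gmulDr; apply: gidealD.
Qed.

Lemma gideal_mulr i j l (e : (i + j)%N = l) (x : A i) (y : A j) :
  gideal R x -> gideal R (gmul e x y).
Proof.
move=> Ix; elim: Ix l e => {i x}.
- move=> a b c d eb ed u r v Rr l e.
  have e1 : (c + j)%N = (c + j)%N by [].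
  have e2 : (b + (c + j))%N = l by rewrite addnA ed.
  by rewrite (gmulA _ _ e1 e2); exact: gideal_gen.
- by move=> d l e; rewrite gmul0l; exact: gideal0.
by move=> d c x z _ IHx _ IHz l e; rewrite gmulDl; apply: gidealD.
Qed.

Definition gquot_comp d : lmodType k := lquot (gideal_submodClosed d).

Definition gquot_pi d (x : A d) : gquot_comp d :=
  lquot_pi (gideal_submodClosed d) x.

Definition gquot_mul i j l (e : (i + j)%N = l)
    (x : gquot_comp i) (y : gquot_comp j) : gquot_comp l :=
  gquot_pi (gmul e (repr x) (repr y)).

Lemma gquot_piP d (x y : A d) :
  gquot_pi x = gquot_pi y <-> gideal R (x - y).
Proof. by split=> [/lquot_piP/asboolP|/asboolP ?]; last exact/lquot_piP. Qed.

Lemma gquot_reprK d (q : gquot_comp d) : gquot_pi (repr q) = q.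
Proof. exact: lquot_reprK. Qed.

Lemma gquot_pi_mul i j l (e : (i + j)%N = l) (x : A i) (y : A j) :
  gquot_mul e (gquot_pi x) (gquot_pi y) = gquot_pi (gmul e x y).
Proof.
have /gquot_piP Ix := gquot_reprK (gquot_pi x).
have /gquot_piP Iy := gquot_reprK (gquot_pi y).
apply/gquot_piP; set x' := repr _ in Ix *; set y' := repr _ in Iy *.
suff -> : gmul e x' y' - gmul e x y
        = 1 *: gmul e (x' - x) y' + gmul e x (y' - y).
  by apply: gidealD; [exact: gideal_mulr|exact: gideal_mull].
have Dl (z z' : A i) (t : A j) : gmul e (z + z') t = gmul e z t + gmul e z' t.
  by rewrite -{1}[z]scale1r gmulDl scale1r.
have Dr (z : A i) (t t' : A j) : gmul e z (t + t') = gmul e z t + gmul e z t'.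
  by rewrite -{1}[t]scale1r gmulDr scale1r.
have -> : gmul e x' y' = gmul e (x' - x) y' + gmul e x y'.
  by rewrite -Dl subrK.
have -> : gmul e x y' = gmul e x (y' - y) + gmul e x y.
  by rewrite -Dr subrK.
by rewrite scale1r addrA addrK.
Qed.

Definition gquot : galg k.
Proof.
refine (@Galg k gquot_comp (gquot_pi (gone A)) gquot_mul _ _ _ _ _).
- move=> i j l e c x x' y.
  rewrite -[x]gquot_reprK -[x']gquot_reprK -[y]gquot_reprK.
  by rewrite -lquot_pi_linear !gquot_pi_mul gmulDl /gquot_pi lquot_pi_linear.
- move=> i j l e c x y y'.
  rewrite -[x]gquot_reprK -[y]gquot_reprK -[y']gquot_reprK.
  by rewrite -lquot_pi_linear !gquot_pi_mul gmulDr /gquot_pi lquot_pi_linear.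
- by move=> i e x; rewrite -[x]gquot_reprK gquot_pi_mul gmul1l.
- by move=> i e x; rewrite -[x]gquot_reprK gquot_pi_mul gmul1r.
move=> a b c ab bc d e1 e2 e3 e4 x y z.
rewrite -[x]gquot_reprK -[y]gquot_reprK -[z]gquot_reprK.
by rewrite !gquot_pi_mul (gmulA e1 e2 e3 e4).
Defined.

End QuotientAlgebra.
Section TensorAlgebra.
Variables (k : fieldType) (W : vectType k).

Local Notation m := (\dim {:W}).

(* The basis of W used for coordinates. *)
Definition bvec (i : 'I_m) : W := (vbasis {:W})`_i.
Definition bcoord (i : 'I_m) (w : W) : k := coord (vbasis {:W}) i w.

(* The d-th tensor power of W, in coordinates: f stands for the sum over all t
   of f t times the tensor product of the [bvec (tnth t a)]. *)
Definition tpow (d : nat) : lmodType k := {ffun d.-tuple 'I_m -> k^o}.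

Definition word_l i j l (e : (i + j)%N = l) (t : l.-tuple 'I_m) :=
  [tuple tnth t (cast_ord e (lshift j a)) | a < i].
Definition word_r i j l (e : (i + j)%N = l) (t : l.-tuple 'I_m) :=
  [tuple tnth t (cast_ord e (rshift i a)) | a < j].

Definition tone : tpow 0 := [ffun=> 1].
Definition tmul i j l (e : (i + j)%N = l) (f : tpow i) (g : tpow j) : tpow l :=
  [ffun t => f (word_l e t) * g (word_r e t)].

Definition tensor_algebra : galg k.
Proof.
refine (@Galg k tpow tone tmul _ _ _ _ _).
- move=> i j l e c x x' y; apply/ffunP=> t; rewrite !ffunE.
  by rewrite mulrDl -scalerAl.
- move=> i j l e c x y y'; apply/ffunP=> t; rewrite !ffunE.
  by rewrite mulrDr -scalerAr.
- move=> i e x; apply/ffunP=> t; rewrite !ffunE mul1r; congr (x _).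
  by apply: eq_from_tnth => a; rewrite tnth_mktuple; congr tnth; apply: val_inj.
- move=> i e x; apply/ffunP=> t; rewrite !ffunE mulr1; congr (x _).
  by apply: eq_from_tnth => a; rewrite tnth_mktuple; congr tnth; apply: val_inj.
move=> a b c ab bc d e1 e2 e3 e4 x y z.
apply/ffunP=> t; rewrite !ffunE -mulrA.
congr (x _ * (y _ * z _)); apply: eq_from_tnth => s; rewrite !tnth_mktuple;
  congr tnth; apply: val_inj => //=.
by rewrite -e1 addnA.
Defined.

Definition tvec (w : W) : tensor_algebra 1 :=
  [ffun t => bcoord (tnth t ord0) w].
Definition tvec2 (v w : W) : tensor_algebra 2 :=
  gmul (erefl : (1 + 1)%N = 2) (tvec v) (tvec w).

Definition symmetric_algebra : galg k :=
  gquot (A := tensor_algebra) (fun r => exists v w, r = tvec2 v w - tvec2 w v).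
Definition exterior_algebra : galg k :=
  gquot (A := tensor_algebra) (fun r => exists w, r = tvec2 w w).

End TensorAlgebra.
Arguments tensor_algebra {k} W.
Arguments symmetric_algebra {k} W.
Arguments exterior_algebra {k} W.

Section QuadraticDual.
Variables (k : fieldType) (V : vectType k).

Definition dual : vectType k := 'Hom(V, k^o).

(* For a graded algebra B with generators [iota : V -> B 1], the kernel of the
   multiplication map from the tensor square of V to B 2. *)
Definition quadratic_relations (B : galg k) (iota : V -> B 1)
    (r : tensor_algebra V 2) : Prop :=
  \sum_(t : 2.-tuple 'I_(\dim {:V}))
    (r t : k) *: gmul (erefl : (1 + 1)%N = 2)
                   (iota (bvec (tnth t ord0))) (iota (bvec (tnth t ord_max)))
  = 0.

(* The pairing of the tensor squares of [dual] and V determined by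
   <f (x) g, v (x) w> = f v * g w. *)
Definition pairing2 (f : tensor_algebra dual 2) (r : tensor_algebra V 2) : k :=
  \sum_t \sum_s f t * r s *
    ((bvec (tnth t ord0) : dual) (bvec (tnth s ord0)) *
     (bvec (tnth t ord_max) : dual) (bvec (tnth s ord_max))).

Definition quadratic_dual (B : galg k) (iota : V -> B 1) : galg k :=
  gquot (A := tensor_algebra dual)
    (fun f => forall r, quadratic_relations iota r -> pairing2 f r = 0).

End QuadraticDual.

Section Clifford.
Variables (K : fieldType) (n : nat).

(* The exterior algebra of K^n, on the usual basis indexed by subsets. *)
Definition ext_type := {ffun {set 'I_n} -> K^o}.
Implicit Types (x y z : ext_type) (v w u : 'rV[K]_n) (J : {set 'I_n}).

Definition ext_one : ext_type := [ffun J : {set 'I_n} => (J == set0)%:R].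

Definition ext_sign (i : 'I_n) J : K :=
  \prod_(j in J) (if (j < i)%N then -1 else 1).

(* Left multiplication by the i-th basis vector. *)
Definition ext_mulb (i : 'I_n) x : ext_type :=
  [ffun J : {set 'I_n} => if i \in J then ext_sign i J * x (J :\ i) else 0].

Definition ext_mulv v x : ext_type := \sum_i v 0 i *: ext_mulb i x.

Definition wedge (ws : seq 'rV[K]_n) : ext_type := foldr ext_mulv ext_one ws.

Definition bilf (q : 'M[K]_n) v w : K := (v *m q *m w^T) 0 0.

Definition drop_nth (t : nat) (ws : seq 'rV[K]_n) := take t ws ++ drop t.+1 ws.

Definition is_clifford_product (q : 'M[K]_n)
    (mul : ext_type -> ext_type -> ext_type) : Prop :=
  [/\ (forall a x x' y, mul (a *: x + x') y = a *: mul x y + mul x' y) /\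
      (forall a x y y', mul x (a *: y + y') = a *: mul x y + mul x y'),
      associative mul,
      left_id ext_one mul,
      right_id ext_one mul &
      forall v ws, mul (wedge [:: v]) (wedge ws) = wedge (v :: ws) +
        \sum_(t < size ws)
          ((-1) ^+ t * bilf q v (nth 0 ws t)) *: wedge (drop_nth t ws)].

(* For a family [H] of subgroups of K, the elements of the direct sum over s of
   the tensor products of the (i - 2s)-th exterior power and [H s]. *)
Definition ext_degree (H : int -> K -> Prop) (i : int) x : Prop := forall J,
  (exists s : int, i = #|J|%:Z + 2 * s /\ H s (x J)) \/ x J = 0.

(* Contraction by the i-th vector of the dual basis. *)
Let ctr (i : 'I_n) x : ext_type :=
  [ffun J : {set 'I_n} => if i \in J then 0 else ext_sign i J * x (i |: J)].

Let ext_mulb_linear i : linear (ext_mulb i).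
Proof.
move=> a x y; apply/ffunP=> J; rewrite !ffunE; case: ifP => _.
  by rewrite mulrDr; congr (_ + _); exact: mulrCA.
by rewrite scaler0 addr0.
Qed.
HB.instance Definition _ i :=
  GRing.isLinear.Build K ext_type ext_type _ (ext_mulb i) (ext_mulb_linear i).

Let ctr_linear i : linear (ctr i).
Proof.
move=> a x y; apply/ffunP=> J; rewrite !ffunE; case: ifP => _.
  by rewrite scaler0 addr0.
by rewrite mulrDr; congr (_ + _); exact: mulrCA.
Qed.
HB.instance Definition _ i :=
  GRing.isLinear.Build K ext_type ext_type _ (ctr i) (ctr_linear i).

Let sU i j J : j \notin J ->
  ext_sign i (j |: J) = (if (j < i)%N then -1 else 1) * ext_sign i J.
Proof. by move=> jJ; rewrite /ext_sign big_setU1. Qed.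

Let sD i j J : j \in J ->
  ext_sign i J = (if (j < i)%N then -1 else 1) * ext_sign i (J :\ j).
Proof. by move=> jJ; rewrite /ext_sign (big_setD1 j). Qed.

Let ss (i j : 'I_n) : i != j ->
  (if (j < i)%N then -1 else 1) = - (if (i < j)%N then -1 else 1) :> K.
Proof.
move=> ij; have : i != j :> nat by [].
by case: ltngtP; rewrite ?opprK.
Qed.

Let sgn2 i J : ext_sign i J * ext_sign i J = 1.
Proof.
rewrite -big_split /= big1 // => j _.
by case: ifP => _; rewrite ?mulrNN mulr1.
Qed.

Let mulbb i j x : ext_mulb i (ext_mulb j x) + ext_mulb j (ext_mulb i x)
  = (0 : K) *: x.
Proof.
rewrite scale0r; apply/ffunP=> J; rewrite !ffunE !inE.
have [->|ij] := eqVneq i j; first by rewrite /= !mulr0 if_same addr0.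
case iJ: (i \in J); case jJ: (j \in J); rewrite /= ?mulr0 ?addr0 //.
rewrite (sD i jJ) (sD j iJ) (ss ij) !setDDl [[set j] :|: _]setUC.
by case: ifP => _; ring.
Qed.

Let ctrctr i j x : ctr i (ctr j x) + ctr j (ctr i x) = (0 : K) *: x.
Proof.
rewrite scale0r; apply/ffunP=> J; rewrite !ffunE !inE.
have [->|ij] := eqVneq i j; first by rewrite /= !mulr0 if_same addr0.
case iJ: (i \in J); case jJ: (j \in J); rewrite /= ?mulr0 ?addr0 //.
rewrite (sU i (negbT jJ)) (sU j (negbT iJ)) (ss ij) !setUA [[set j] :|: _]setUC.
by case: ifP => _; ring.
Qed.

Let ctrmulb i j x :
  ctr i (ext_mulb j x) + ext_mulb j (ctr i x) = (i == j)%:R *: x.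
Proof.
apply/ffunP=> J; rewrite !ffunE !inE.
have [<-|ij] := eqVneq i j.
  rewrite scale1r; case iJ: (i \in J) => /=.
    by rewrite add0r (sD i iJ) ltnn mul1r mulrA sgn2 mul1r setD1K.
  by rewrite addr0 sU ?iJ // ltnn mul1r mulrA sgn2 mul1r setU1K ?iJ.
rewrite scale0r; case iJ: (i \in J); case jJ: (j \in J);
  rewrite /= ?mulr0 ?addr0 //.
rewrite (sU j (negbT iJ)) (sD i jJ) (ss ij).
have -> : (i |: J) :\ j = i |: (J :\ j).
  by apply/setP => l; rewrite !inE; case: eqVneq => // ->;
    rewrite eq_sym (negbTE ij).
by case: ifP => _; ring.
Qed.

Let lc (a : 'I_n -> {linear ext_type -> ext_type}) (f : 'I_n -> K) x :=
  \sum_i f i *: a i x.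

Let lc_linear a f : linear (lc a f).
Proof.
move=> c x y; rewrite /lc scaler_sumr -big_split /=; apply: eq_bigr => i _.
by rewrite linearP scalerDr !scalerA mulrC.
Qed.
HB.instance Definition _ a f :=
  GRing.isLinear.Build K ext_type ext_type _ (lc a f) (lc_linear a f).

Let lc_rel (a b : 'I_n -> {linear ext_type -> ext_type})
    (c : 'I_n -> 'I_n -> K) f g x :
  (forall i j x, a i (b j x) + b j (a i x) = c i j *: x) ->
  lc a f (lc b g x) + lc b g (lc a f x) =
  (\sum_i \sum_j f i * g j * c i j) *: x.
Proof.
move=> ab; have -> : lc a f (lc b g x) =
    \sum_i \sum_j (f i * g j) *: a i (b j x).
  apply: eq_bigr => i _; rewrite linear_sum scaler_sumr; apply: eq_bigr => j _.
  by rewrite linearZ /= scalerA.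
have -> : lc b g (lc a f x) = \sum_i \sum_j (f i * g j) *: b j (a i x).
  rewrite exchange_big; apply: eq_bigr => i _.
  rewrite linear_sum scaler_sumr; apply: eq_bigr => j _.
  by rewrite linearZ /= scalerA mulrC.
rewrite -big_split scaler_suml; apply: eq_bigr => i _ /=.
rewrite -big_split scaler_suml; apply: eq_bigr => j _ /=.
by rewrite -scalerDr ab scalerA.
Qed.

Let parity x : ext_type := [ffun J : {set 'I_n} => (-1) ^+ #|J| * x J].

Let parity_mulb i x : parity (ext_mulb i x) = - ext_mulb i (parity x).
Proof.
apply/ffunP=> J; rewrite !ffunE; case: ifP => iJ; last by rewrite mulr0 oppr0.
by rewrite (cardsD1 i J) iJ exprS; ring.
Qed.

Let parity_ctr i x : parity (ctr i x) = - ctr i (parity x).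
Proof.
apply/ffunP=> J; rewrite !ffunE; case: ifP => iJ; first by rewrite mulr0 oppr0.
by rewrite cardsU1 iJ exprS; ring.
Qed.

Let parity_linear : linear parity.
Proof.
move=> a x y; apply/ffunP=> J; rewrite !ffunE.
by rewrite mulrDr; congr (_ + _); exact: mulrCA.
Qed.
HB.instance Definition _ :=
  GRing.isLinear.Build K ext_type ext_type _ parity parity_linear.

Let be J : ext_type := [ffun J' : {set 'I_n} => (J' == J)%:R].

Let be0 : be set0 = ext_one. Proof. by []. Qed.

Let be_sum x : x = \sum_J x J *: be J.
Proof.
apply/ffunP=> J; rewrite sum_ffunE (bigD1 J) //= !ffunE eqxx.
rewrite big1 ?addr0; first by rewrite /GRing.scale /= mulr1.
by move=> J' /negbTE JJ'; rewrite !ffunE eq_sym JJ' scaler0.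
Qed.

Let mulb_be i J : i \in J -> ext_mulb i (be (J :\ i)) = ext_sign i J *: be J.
Proof.
move=> iJ; apply/ffunP=> J'; rewrite !ffunE.
case: ifP => iJ'; last first.
  by case: eqP => [JJ|_]; rewrite ?scaler0 //; rewrite JJ iJ in iJ'.
have -> : (J' :\ i == J :\ i) = (J' == J).
  by apply/eqP/eqP => [E|->//]; rewrite -(setD1K iJ) -(setD1K iJ') E.
by case: eqP => [->|_]; rewrite ?mulr0 ?scaler0.
Qed.

Let ctr_be i J : ctr i (be J) =
  (if i \in J then ext_sign i (J :\ i) else 0) *: be (J :\ i).
Proof.
apply/ffunP=> J'; rewrite !ffunE; case: ifP => iJ'.
  case: eqP => [E|_]; rewrite ?scaler0 //.
  by move: iJ'; rewrite E !inE eqxx.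
case: ifP => iJ; last first.
  rewrite scale0r; case: eqP => [E|_]; rewrite ?mulr0 //.
  by move: iJ; rewrite -E !inE eqxx.
have -> : (i |: J' == J) = (J' == J :\ i).
  by apply/eqP/eqP => [<-|->]; rewrite ?setD1K // setU1K // iJ'.
by case: eqP => [->|_]; rewrite ?mulr0 ?scaler0.
Qed.

Section Product.
Variable q : 'M[K]_n.
Hypothesis q_sym : q^T = q.

Let D v := lc ctr ((v *m q) 0).
Let W v := lc ext_mulb (v 0).
Let C v x := W v x + D v x.
Let Rt v x := W v (parity x) - D v (parity x).

Let WE v x : W v x = ext_mulv v x. Proof. by []. Qed.

Let bilf_sym u v : bilf q u v = bilf q v u.
Proof.
rewrite /bilf (_ : v *m q *m u^T = (u *m q *m v^T)^T).
  by rewrite [RHS]mxE.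
by rewrite !trmx_mul trmxK q_sym mulmxA.
Qed.

Let WW u v x : W u (W v x) + W v (W u x) = 0.
Proof.
rewrite (lc_rel _ _ _ (fun i j y => mulbb i j y)).
by rewrite big1 ?scale0r // => i _; rewrite big1 // => j _; rewrite mulr0.
Qed.

Let DD u v x : D u (D v x) + D v (D u x) = 0.
Proof.
rewrite (lc_rel _ _ _ (fun i j y => ctrctr i j y)).
by rewrite big1 ?scale0r // => i _; rewrite big1 // => j _; rewrite mulr0.
Qed.

Let DW u v x : D u (W v x) + W v (D u x) = bilf q u v *: x.
Proof.
rewrite (lc_rel _ _ _ (fun i j y => ctrmulb i j y)); congr (_ *: _).
rewrite /bilf mxE; apply: eq_bigr => i _.
set c := (u *m q) 0 i; rewrite (bigD1 i) //= eqxx mulr1 [v^T _ _]mxE.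
by rewrite big1 ?addr0 // => j /negbTE ji; rewrite eq_sym ji mulr0.
Qed.

Let parityW v x : parity (W v x) = - W v (parity x).
Proof.
rewrite /W /lc linear_sum -sumrN; apply: eq_bigr => i _.
by rewrite linearZ /= parity_mulb scalerN.
Qed.

Let parityD v x : parity (D v x) = - D v (parity x).
Proof.
rewrite /D /lc linear_sum -sumrN; apply: eq_bigr => i _.
by rewrite linearZ /= parity_ctr scalerN.
Qed.

Let WDl v x y : W v (x + y) = W v x + W v y. Proof. exact: raddfD. Qed.
Let WN v x : W v (- x) = - W v x. Proof. exact: raddfN. Qed.
Let DDl v x y : D v (x + y) = D v x + D v y. Proof. exact: raddfD. Qed.
Let DN v x : D v (- x) = - D v x. Proof. exact: raddfN. Qed.

Let CR u v x : C u (Rt v x) = Rt v (C u x).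
Proof.
rewrite /Rt /C !raddfD /= !parityW !parityD !(WDl, DDl, WN, DN).
set y := parity x; move: (WW u v y) (DD u v y) (DW u v y) (DW v u y).
rewrite (bilf_sym v u); move: (bilf q u v *: y).
generalize (W u (W v y)) (W v (W u y)) (D u (D v y)) (D v (D u y)).
generalize (W u (D v y)) (W v (D u y)) (D u (W v y)) (D v (W u y)).
move=> a1 a2 a3 a4 b1 b2 b3 b4 r /eqP.
rewrite addr_eq0 => /eqP-> /eqP; rewrite addr_eq0 => /eqP-> <- e.
apply/ffunP => J; move/ffunP/(_ J): e; rewrite !ffunE.
move: (a1 J) (a2 J) (a3 J) (a4 J) (b2 J) (b4 J) => c1 c2 c3 c4 d2 d4 e.
have -> : c4 = c3 + c2 - c1 by rewrite -e addrK.
ring.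
Qed.

Let gen (eps : K) (Q : ext_type -> Prop) :
  (forall a x y, Q x -> Q y -> Q (a *: x + y)) -> Q ext_one ->
  (forall v J, Q (be J) -> Q (W v (be J) + eps *: D v (be J))) ->
  forall x, Q x.
Proof.
move=> QL Q1 QC.
have Q0 : Q 0 by rewrite -(addNr ext_one) -scaleN1r; apply: (QL).
have QZ a x : Q x -> Q (a *: x) by rewrite -[_ *: x]addr0 => Qx; apply: (QL).
have QD x y : Q x -> Q y -> Q (x + y) by rewrite -{2}[x]scale1r; apply: (QL).
suff Qbe J : Q (be J).
  by move=> x; rewrite (be_sum x); elim/big_ind: _ => // J _; exact: QZ.
have [N] := ubnP #|J|; elim: N J => // N IH J; rewrite ltnS => JN.
have [->|[i iJ]] := set_0Vmem J; first by rewrite be0.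
have J'N : (#|J :\ i| < N)%N.
  by rewrite (leq_trans _ JN) // [leqRHS](cardsD1 i) iJ.
have := QC (delta_mx 0 i) _ (IH _ J'N).
have -> : W (delta_mx 0 i) (be (J :\ i)) = ext_sign i J *: be J.
  rewrite -mulb_be // /W /lc (bigD1 i) //= mxE !eqxx scale1r big1 ?addr0 //.
  by move=> j /negbTE ji; rewrite mxE ji scale0r.
set d := D _ _ => Qd.
have Qd' : Q d.
  rewrite /d /D /lc; elim/big_ind: _ => // j _; apply: (QZ).
  suff: Q (ctr j (be (J :\ i))) by [].
  rewrite ctr_be; apply: (QZ); apply: (IH).
  by apply: leq_ltn_trans J'N; apply/subset_leq_card/subsetDl.
have -> : be J = ext_sign i J *: ((ext_sign i J *: be J + eps *: d) - eps *: d).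
  by rewrite addrK scalerA sgn2 scale1r.
by apply: (QZ); apply: (QD) => //; rewrite -scaleNr; apply: (QZ).
Qed.

Let comm (T : ext_type -> ext_type) :=
  linear T /\ forall v x, T (Rt v x) = Rt v (T x).

Let Rt_be v J :
  Rt v ((-1) ^+ #|J| *: be J) = W v (be J) + (-1) *: D v (be J).
Proof.
have -> : Rt v ((-1) ^+ #|J| *: be J) =
    W v (parity ((-1) ^+ #|J| *: be J)) - D v (parity ((-1) ^+ #|J| *: be J)).
  by [].
have -> : parity ((-1) ^+ #|J| *: be J) = be J.
  apply/ffunP=> J'; rewrite !ffunE; case: eqP => [->|_].
    by rewrite /GRing.scale /= mulr1 -exprMn mulrNN mulr1 expr1n.
  by rewrite scaler0 mulr0.
by rewrite scaleN1r.
Qed.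

Let comm_eq T T' : comm T -> comm T' -> T ext_one = T' ext_one ->
  forall x, T x = T' x.
Proof.
move=> [TL TR] [T'L T'R] e1; apply: (gen (eps := -1)) => //.
  by move=> a x y; rewrite TL T'L => -> ->.
have T0 : T 0 = 0 by have := TL (-1) 0 0; rewrite scaler0 addr0 scaleN1r addNr.
have T'0 : T' 0 = 0.
  by have := T'L (-1) 0 0; rewrite scaler0 addr0 scaleN1r addNr.
move=> v J e; rewrite -Rt_be TR T'R; congr (Rt v _).
by rewrite -[_ *: _]addr0 TL T'L T0 T'0 e.
Qed.

Let C_linear v : linear (C v).
Proof.
move=> a x y; rewrite /C {1}/W {1}/D !linearP /= -/(W v) -/(D v).
by rewrite scalerDr addrACA.
Qed.

Let comm_ex x : exists T, comm T /\ T ext_one = x.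
Proof.
move: x; apply: (gen (eps := 1)).
- move=> a _ _ [T [[TL TR] <-]] [T' [[T'L T'R] <-]].
  exists (fun z => a *: T z + T' z); split=> //; split=> [c y z|v z].
    rewrite TL T'L !scalerDr !scalerA [a * c]mulrC -!scalerA.
    by rewrite -!addrA; congr (_ + _); rewrite addrCA.
  rewrite TR T'R /Rt [parity (_ + _)]linearP !(WDl, DDl).
  rewrite [W v (a *: _)]linearZ [D v (a *: _)]linearZ /=.
  by rewrite scalerBr opprD addrACA.
- by exists id.
move=> v J [T [[TL TR] TJ]]; exists (C v \o T); split; last first.
  by rewrite /= TJ scale1r.
split=> [a y z|u z] /=; first by rewrite TL C_linear.
by rewrite TR CR.
Qed.

Let ctr_one i : ctr i ext_one = 0.
Proof.
apply/ffunP=> J; rewrite !ffunE; case: ifP => // iJ.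
by case: eqP => [E|_]; rewrite ?mulr0 //; move/setP/(_ i): E; rewrite !inE eqxx.
Qed.

Let D_one v : D v ext_one = 0.
Proof.
rewrite /D /lc big1 // => i _.
by rewrite [GRing.Linear.sort _ _]ctr_one scaler0.
Qed.

Let D_wedge v ws : D v (wedge ws) = \sum_(t < size ws)
  ((-1) ^+ t * bilf q v (nth 0 ws t)) *: wedge (drop_nth t ws).
Proof.
elim: ws => [|w ws IH]; first by rewrite big_ord0 D_one.
rewrite big_ord_recl /= expr0 mul1r /drop_nth /= drop0 -/(wedge ws) -WE.
rewrite -[LHS](addrK (W w (D v (wedge ws)))) DW; congr (_ + _).
rewrite IH -WN -sumrN /W linear_sum; apply: eq_bigr => t _.
by rewrite -scaleNr linearZ /= exprS mulN1r mulNr.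
Qed.

Lemma clifford_product_exists : exists mul, is_clifford_product q mul.
Proof.
have [T TP] := choice comm_ex.
have TL x : linear (T x) by case: (TP x) => [[]].
have T1 x : T x ext_one = x by case: (TP x).
have Tu x T' : comm T' -> T' ext_one = x -> forall y, T x y = T' y.
  by move=> cT' e; apply: comm_eq => //; [case: (TP x)|rewrite T1].
exists T; split.
- split=> [a x x' y|a x y y']; last exact: TL.
  rewrite (Tu (a *: x + x') (fun z => a *: T x z + T x' z)) ?T1 //.
  split=> [c z z'|v z].
    rewrite !TL !scalerDr !scalerA [a * c]mulrC -!scalerA.
    by rewrite -!addrA; congr (_ + _); rewrite addrCA.
  have [[_ ->] _] := TP x; have [[_ ->] _] := TP x'.
  rewrite /Rt [parity (_ + _)]linearP !(WDl, DDl).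
  rewrite [W v (a *: _)]linearZ [D v (a *: _)]linearZ /=.
  by rewrite scalerBr opprD addrACA.
- move=> x y z; rewrite [RHS](Tu _ (T x \o T y)) //= ?T1 //.
  split=> [c u u'|v u] /=; first by rewrite !TL.
  by have [[_ ->] _] := TP y; have [[_ ->] _] := TP x.
- by move=> y; rewrite (Tu _ id).
- exact: T1.
move=> v ws; rewrite (Tu _ (C v)); last 2 first.
- by split=> [a y z|u z]; [exact: C_linear|exact: CR].
- by rewrite /C D_one addr0.
by rewrite /C D_wedge.
Qed.

Section Degree.
Variable mul : ext_type -> ext_type -> ext_type.
Hypothesis mulP : is_clifford_product q mul.
Variable H : int -> K -> Prop.
Hypothesis HL : forall s a b, H s a -> H s b -> H s (a + b).
Hypothesis HM : forall s t a b, H s a -> H t b -> H (s + t) (a * b).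
Hypothesis H1 : H 0 1.
Hypothesis HN1 : H 0 (-1).
Hypothesis Hq : forall i j, H 1 (q i j).

Let mulL a x x' y : mul (a *: x + x') y = a *: mul x y + mul x' y.
Proof. by case: mulP => [[]]. Qed.
Let mulR a x y y' : mul x (a *: y + y') = a *: mul x y + mul x y'.
Proof. by case: mulP => [[]]. Qed.
Let mul0l y : mul 0 y = 0.
Proof. by have := mulL (-1) 0 0 y; rewrite scaler0 addr0 scaleN1r addNr. Qed.
Let mulZl a x y : mul (a *: x) y = a *: mul x y.
Proof. by rewrite -[a *: x]addr0 mulL mul0l addr0. Qed.
Let mulDl x x' y : mul (x + x') y = mul x y + mul x' y.
Proof. by rewrite -{1}[x]scale1r mulL scale1r. Qed.
Let mul_suml I r (F : I -> ext_type) y :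
  mul (\sum_(i <- r) F i) y = \sum_(i <- r) mul (F i) y.
Proof.
by elim: r => [|i r IH]; rewrite ?big_nil ?mul0l // !big_cons mulDl IH.
Qed.
Let mul0r x : mul x 0 = 0.
Proof. by have := mulR (-1) x 0 0; rewrite scaler0 addr0 scaleN1r addNr. Qed.
Let mulZr a x y : mul x (a *: y) = a *: mul x y.
Proof. by rewrite -[a *: y]addr0 mulR mul0r addr0. Qed.
Let W_delta i x : W (delta_mx 0 i) x = ext_mulb i x.
Proof.
rewrite /W /lc (bigD1 i) //= mxE !eqxx scale1r big1 ?addr0 //.
by move=> j /negbTE ji; rewrite mxE ji scale0r.
Qed.

Let D_delta i x : D (delta_mx 0 i) x = \sum_j q i j *: ctr j x.
Proof. by apply: eq_bigr => j _; rewrite -rowE mxE. Qed.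

Let be_wedge J : exists c ws, be J = c *: wedge ws.
Proof.
have [N] := ubnP #|J|; elim: N J => // N IH J; rewrite ltnS => JN.
have [->|[i iJ]] := set_0Vmem J; first by exists 1, [::]; rewrite scale1r be0.
have [c [ws E]] : exists c ws, be (J :\ i) = c *: wedge ws.
  by apply: (IH); rewrite (leq_trans _ JN) // [leqRHS](cardsD1 i) iJ.
exists (ext_sign i J * c), (delta_mx 0 i :: ws) => /=.
have e : ext_sign i J *: be J = c *: W (delta_mx 0 i) (wedge ws).
  by rewrite -mulb_be // -W_delta E /W linearZ.
by rewrite -WE -scalerA -e scalerA sgn2 scale1r.
Qed.

Let mul_vec v y : mul (wedge [:: v]) y = W v y + D v y.
Proof.
rewrite (be_sum y); elim/big_rec: _ => [|J z _ IH].
  by rewrite mul0r /W /D !raddf0 addr0.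
rewrite mulR IH -/(C v z) -/(C v _) C_linear; congr (_ *: _ + _).
have [c [ws ->]] := be_wedge J.
rewrite mulZr /C /W /D !linearZ -scalerDr; congr (_ *: _).
by rewrite [X in _ = _ + X](D_wedge v ws); case: mulP => _ _ _ _ ->.
Qed.

Let sect := ext_degree H.

Lemma ext_degree0 i : ext_degree H i 0.
Proof. by move=> J; right; rewrite ffunE. Qed.

Lemma ext_degreeD i x y :
  ext_degree H i x -> ext_degree H i y -> ext_degree H i (x + y).
Proof.
move=> sx sy J; rewrite ffunE.
have [[s [es Hs]]|->] := sx J; last by rewrite add0r; exact: sy.
have [[t [et Ht]]|->] := sy J; last by rewrite addr0; left; exists s.
left; exists s; split=> //; apply: (HL) => //.
suff -> : s = t by [].
by move: es; rewrite et => /addrI /mulfI -> .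
Qed.

Let sectZ i t c x : H t c -> sect i x -> sect (i + 2 * t) (c *: x).
Proof.
move=> Ht sx J; rewrite ffunE.
have [[s [-> Hs]]|->] := sx J; last by right; rewrite scaler0.
by left; exists (t + s); split; [ring|exact: HM].
Qed.

Lemma ext_degreeZ i c x :
  H 0 c -> ext_degree H i x -> ext_degree H i (c *: x).
Proof. by move=> Hc sx; have := sectZ Hc sx; rewrite mulr0 addr0. Qed.

Let Hsign i J : H 0 (ext_sign i J).
Proof.
apply: big_ind => // [a b Ha Hb|j _]; last by case: ifP.
by rewrite -[0](addr0 (0 : int)); exact: HM.
Qed.

Let HsignM i J s a : H s a -> H s (ext_sign i J * a).
Proof. by move=> Ha; rewrite -[s]add0r; exact: HM. Qed.

Let sect_mulb i j x : sect i x -> sect (i + 1) (ext_mulb j x).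
Proof.
move=> sx J; rewrite ffunE; case: ifP => jJ; last by right.
have [[s [-> Hs]]|->] := sx (J :\ j); last by right; rewrite mulr0.
left; exists s; split; last exact: HsignM.
by rewrite (cardsD1 j J) jJ add1n intS; ring.
Qed.

Let sect_ctr i j x : sect i x -> sect (i - 1) (ctr j x).
Proof.
move=> sx J; rewrite ffunE; case: ifP => jJ; first by right.
have [[s [-> Hs]]|->] := sx (j |: J); last by right; rewrite mulr0.
left; exists s; split; last exact: HsignM.
by rewrite cardsU1 jJ add1n intS; ring.
Qed.

Let sect_D i j x : sect i x -> sect (i + 1) (D (delta_mx 0 j) x).
Proof.
move=> sx; rewrite D_delta.
elim/big_ind: _ => [|y z|l _]; [exact: ext_degree0|exact: ext_degreeD|].
have -> : i + 1 = (i - 1) + 2 * 1 by ring.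
by apply: sectZ => //; exact: sect_ctr.
Qed.

Let sect_be J i y : sect i y -> sect (i + #|J|%:Z) (mul (be J) y).
Proof.
have [N] := ubnP #|J|; elim: N J i y => // N IH J i y; rewrite ltnS => JN sy.
have [->|[j jJ]] := set_0Vmem J.
  by rewrite be0 cards0 addr0; case: mulP => _ _ ->.
have cJ : #|J| = #|J :\ j|.+1 by rewrite (cardsD1 j) jJ.
have J'N : (#|J :\ j| < N)%N by rewrite -cJ.
have -> : be J = ext_sign j J *:
    (mul (wedge [:: delta_mx 0 j]) (be (J :\ j)) -
     D (delta_mx 0 j) (be (J :\ j))).
  by rewrite mul_vec addrK W_delta mulb_be // scalerA sgn2 scale1r.
rewrite mulZl mulDl; apply: ext_degreeZ => //; apply: ext_degreeD.
  have mulA : associative mul by case: mulP.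
  rewrite -mulA mul_vec W_delta; have sy' := IH _ _ _ J'N sy.
  have -> : i + #|J|%:Z = i + #|J :\ j|%:Z + 1 by rewrite cJ -addn1 PoszD addrA.
  by apply: ext_degreeD; [exact: sect_mulb|exact: sect_D].
rewrite -scaleN1r mulZl D_delta mul_suml; apply: ext_degreeZ => //.
elim/big_ind: _ => [|u v|l _]; [exact: ext_degree0|exact: ext_degreeD|].
rewrite mulZl ctr_be; case: ifP => lJ; last first.
  by rewrite scale0r mul0l scaler0; exact: ext_degree0.
rewrite mulZl; have cJ' : #|J :\ j| = #|J :\ j :\ l|.+1.
  by rewrite (cardsD1 l (J :\ j)) lJ.
have -> : i + #|J|%:Z = i + #|J :\ j :\ l|%:Z + 2 * 1.
  by rewrite cJ cJ' -addn2 PoszD addrA.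
apply: sectZ => //; apply: ext_degreeZ => //; apply: (IH) => //.
by apply: leq_ltn_trans J'N; rewrite [leqRHS]cJ'.
Qed.

Lemma ext_degree_one : ext_degree H 0 ext_one.
Proof.
move=> J; rewrite ffunE; case: eqP => [->|_]; last by right.
by left; exists 0; rewrite cards0 mulr0.
Qed.

Lemma ext_degree_vec v :
  (forall a, H 0 (v 0 a)) -> ext_degree H 1 (wedge [:: v]).
Proof.
move=> Hv; rewrite /= /ext_mulv; elim/big_ind: _ => [|x y|a _].
- exact: ext_degree0.
- exact: ext_degreeD.
by apply: ext_degreeZ => //; rewrite -[1]add0r; apply/sect_mulb/ext_degree_one.
Qed.

Lemma ext_degree_clifford i j x y : ext_degree H i x -> ext_degree H j y ->
  ext_degree H (i + j) (mul x y).
Proof.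
move=> sx sy; rewrite (be_sum x) mul_suml.
elim/big_ind: _ => [|u v|J _]; [exact: ext_degree0|exact: ext_degreeD|].
rewrite mulZl; have [[s [-> Hs]]|->] := sx J; last first.
  by rewrite scale0r; exact: ext_degree0.
have -> : #|J|%:Z + 2 * s + j = j + #|J|%:Z + 2 * s by ring.
by apply: sectZ => //; exact: sect_be.
Qed.

End Degree.
End Product.
End Clifford.
(* The vector space of bilinear forms on V.  In characteristic zero the second
   symmetric power of the dual of V is the subspace of symmetric forms: a
   quadratic form is identified with its polarization. *)
Definition bilin (k : fieldType) (V : vectType k) : vectType k :=
  'Hom(V, 'Hom(V, k^o)).

Definition bilin_eval (k : fieldType) (V : vectType k) (u : bilin V)
    (v w : V) : k :=
  (u v : 'Hom(V, k^o)) w.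

Definition symmetric_forms (k : fieldType) (V : vectType k)
    (U : {vspace bilin V}) : Prop :=
  forall u, u \in U -> forall v w, bilin_eval u v w = bilin_eval u w v.

Section CoordinateAlgebra.
Variables (k : fieldType) (V : vectType k) (U : {vspace bilin V}).

Local Notation n := (\dim {:V}).
Local Notation m := (\dim U).

(* The fraction field of the homogeneous coordinate ring Sym(U^dual) of P(U);
   the variables are the basis of U^dual dual to [vbasis U]. *)
Definition PU_frac : fieldType := {fraction (mpoly m k)}.
Definition PU_const (c : k) : PU_frac := tofrac (mpolyC m c).
Definition PU_var (i : 'I_m) : PU_frac := tofrac (mpolyX k (mnm1 i)).

(* The global sections of O(s) on P(U) = Proj(Sym(U^dual)): the elements of the
   fraction field which over each chart [PU_var i != 0] are of the form
   p / PU_var i ^ N with p homogeneous of degree N + s. *)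
Definition PU_sections (s : int) (g : PU_frac) : Prop :=
  forall i : 'I_m, exists (N d : nat) (p : mpoly m k),
    [/\ p \is ishomog1 d (mdeg (n := m)), d%:Z = N%:Z + s &
        g * PU_var i ^+ N = tofrac p].

(* The form q_U with values in linear forms on U, in the basis [bvec] of V:
   q_U (v, w) is the linear form u |-> u (v, w). *)
Definition universal_form : 'M[PU_frac]_n := \matrix_(a, b)
  \sum_(i < m) PU_const (bilin_eval (vbasis U)`_i (bvec a) (bvec b)) * PU_var i.

Lemma universal_form_sym :
  symmetric_forms U -> universal_form^T = universal_form.
Proof.
move=> symU; apply/matrixP=> a b; rewrite !mxE; apply: eq_bigr => i _.
by rewrite symU // vbasis_mem // mem_nth // size_tuple.
Qed.

Lemma PU_sections0 s : PU_sections s 0.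
Proof.
move=> i; have [N [d E]] : exists N d : nat, d%:Z = N%:Z + s.
  case: s => s; first by exists 0, s; rewrite add0r.
  by exists s.+1, 0; rewrite NegzE subrr.
by exists N, d, 0; split=> //; [exact: dhomog0|rewrite mul0r tofrac0].
Qed.

Lemma PU_sectionsM s t a b :
  PU_sections s a -> PU_sections t b -> PU_sections (s + t) (a * b).
Proof.
move=> Ha Hb i; have [N [d [p [hp E e]]]] := Ha i.
have [N' [d' [p' [hp' E' e']]]] := Hb i.
exists (N + N')%N, (d + d')%N, (p * p'); split.
- exact: dhomogM.
- by rewrite !PoszD E E' addrACA.
by rewrite exprD mulrACA e e' tofracM.
Qed.

Lemma PU_sections_const c : PU_sections 0 (PU_const c).
Proof.
move=> i; exists 0, 0, (mpolyC m c); split; rewrite ?addr0 ?mulr1 //.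
by rewrite -[mpolyC m c]mulr1 mul_mpolyC; apply: dhomogZ; exact: dhomog1.
Qed.

Lemma PU_sections_var j : PU_sections 1 (PU_var j).
Proof.
move=> i; exists 0, 1, (mpolyX k (mnm1 j)); split; rewrite ?mulr1 //.
by rewrite dhomogX /= mdeg1.
Qed.

Lemma PU_sectionsD s a b :
  PU_sections s a -> PU_sections s b -> PU_sections s (a + b).
Proof.
move=> Ha Hb i; have [N [d [p [hp E e]]]] := Ha i.
have [N' [d' [p' [hp' E' e']]]] := Hb i.
set y := mpolyX k (mnm1 i).
have hy l : y ^+ l \is ishomog1 l (mdeg (n := m)).
  rewrite -[X in ishomog1 X]mul1n; apply: dhomogMn.
  by rewrite dhomogX /= mdeg1.
exists (N + N')%N, (d + N')%N, (p * y ^+ N' + p' * y ^+ N); split.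
- apply: dhomogD; first exact: dhomogM.
  have /eqP : (d + N')%:Z = (d' + N)%:Z by rewrite !PoszD E E'; ring.
  by rewrite eqz_nat => /eqP ->; exact: dhomogM.
- by rewrite !PoszD E addrAC.
rewrite tofracD !tofracM !tofracXn -e -e' exprD mulrDl.
by congr (_ + _); rewrite ?mulrA // -mulrA [_ ^+ N * _]mulrC mulrA.
Qed.

Lemma universal_form_section a b : PU_sections 1 (universal_form a b).
Proof.
rewrite mxE; elim/big_ind: _ => [|x y|i _].
- exact: PU_sections0.
- exact: PU_sectionsD.
rewrite -[X in PU_sections X]add0r; apply: PU_sectionsM.
  exact: PU_sections_const.
exact: PU_sections_var.
Qed.

(* The global sections of Cl_i(V): the subspace, of the exterior algebra of V
   over the fraction field of P(U), of the elements of the direct sum over s of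
   the (i - 2s)-th exterior power of V tensored with H^0(P(U), O(s)). *)
Definition cl_pred (i : nat) : {pred ext_type PU_frac n} :=
  fun x => `[< ext_degree PU_sections i%:Z x >].

Lemma cl_pred_zmod_closed i : zmod_closed (cl_pred i).
Proof.
split=> [|x y /asboolP Hx /asboolP Hy]; apply/asboolP.
  exact: ext_degree0.
apply: ext_degreeD => //; first exact: PU_sectionsD.
rewrite -scaleN1r; apply: ext_degreeZ => //; first exact: PU_sectionsM.
by rewrite -tofrac1 -tofracN -mpolyC1 -mpolyCN; exact: PU_sections_const.
Qed.
HB.instance Definition _ i :=
  GRing.isZmodClosed.Build (ext_type PU_frac n) (cl_pred i)
    (cl_pred_zmod_closed i).

Record cl_sections (i : nat) :=
  ClSections { cl_val : ext_type PU_frac n; _ : cl_pred i cl_val }.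
HB.instance Definition _ i := [isSub for @cl_val i].
HB.instance Definition _ i := [Choice of cl_sections i by <:].
HB.instance Definition _ i := [SubChoice_isSubZmodule of cl_sections i by <:].


Lemma PU_constD a b : PU_const (a + b) = PU_const a + PU_const b.
Proof. by rewrite /PU_const mpolyCD tofracD. Qed.
Lemma PU_constM a b : PU_const (a * b) = PU_const a * PU_const b.
Proof. by rewrite /PU_const mpolyCM tofracM. Qed.
Lemma PU_const1 : PU_const 1 = 1.
Proof. by rewrite /PU_const mpolyC1 tofrac1. Qed.

Lemma cl_degree i (x : cl_sections i) : ext_degree PU_sections i%:Z (cl_val x).
Proof. by apply/asboolP; case: x. Qed.

Lemma cl_scale_subproof i (c : k) (x : cl_sections i) :
  cl_pred i (PU_const c *: cl_val x).
Proof.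
apply/asboolP; apply: ext_degreeZ; [exact: PU_sectionsM| |exact: cl_degree].
exact: PU_sections_const.
Qed.
Definition cl_scale i c (x : cl_sections i) : cl_sections i :=
  ClSections (cl_scale_subproof c x).

Lemma cl_scaleA i a b (x : cl_sections i) :
  cl_scale a (cl_scale b x) = cl_scale (a * b) x.
Proof. by apply: val_inj; rewrite /= scalerA PU_constM. Qed.
Lemma cl_scale1 i : left_id 1 (@cl_scale i).
Proof. by move=> x; apply: val_inj; rewrite /= PU_const1 scale1r. Qed.
Lemma cl_scaleDr i : right_distributive (@cl_scale i) +%R.
Proof. by move=> c x y; apply: val_inj; rewrite /= scalerDr. Qed.
Lemma cl_scaleDl i x : {morph (@cl_scale i)^~ x : a b / a + b}.
Proof. by move=> a b; apply: val_inj; rewrite /= PU_constD scalerDl. Qed.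
HB.instance Definition _ i := GRing.Zmodule_isLmodule.Build k (cl_sections i)
  (@cl_scaleA i) (@cl_scale1 i) (@cl_scaleDr i) (@cl_scaleDl i).

Hypothesis symU : symmetric_forms U.

(* The Clifford product at the generic point of P(U); it is unique, being
   determined by the conditions [is_clifford_product]. *)
Definition cl_mul : ext_type PU_frac n -> ext_type PU_frac n ->
    ext_type PU_frac n :=
  sval (cid (clifford_product_exists (universal_form_sym symU))).

Lemma cl_mulP : is_clifford_product universal_form cl_mul.
Proof. exact: svalP. Qed.

Lemma cl_gmul_subproof i j l (e : (i + j)%N = l)
    (x : cl_sections i) (y : cl_sections j) :
  cl_pred l (cl_mul (cl_val x) (cl_val y)).
Proof.
apply/asboolP; rewrite -e PoszD.
apply: (ext_degree_clifford cl_mulP);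
  [exact: PU_sectionsD|exact: PU_sectionsM| | | | | ].
- by rewrite -PU_const1; exact: PU_sections_const.
- by rewrite -tofrac1 -tofracN -mpolyC1 -mpolyCN; exact: PU_sections_const.
- exact: universal_form_section.
- exact: cl_degree.
exact: cl_degree.
Qed.
Definition cl_gmul i j l (e : (i + j)%N = l)
    (x : cl_sections i) (y : cl_sections j) : cl_sections l :=
  ClSections (cl_gmul_subproof e x y).

Lemma cl_one_subproof : cl_pred 0 (@ext_one PU_frac n).
Proof.
apply/asboolP; apply: ext_degree_one.
by rewrite -PU_const1; exact: PU_sections_const.
Qed.
Definition cl_one : cl_sections 0 := ClSections cl_one_subproof.

Definition coordinate_algebra : galg k.
Proof.
refine (@Galg k cl_sections cl_one cl_gmul _ _ _ _ _).
- move=> i j l e c x x' y; apply: val_inj => /=.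
  by case: cl_mulP => [[-> _] _ _ _ _].
- move=> i j l e c x y y'; apply: val_inj => /=.
  by case: cl_mulP => [[_ ->] _ _ _ _].
- by move=> i e x; apply: val_inj => /=; case: cl_mulP => _ _ ->.
- by move=> i e x; apply: val_inj => /=; case: cl_mulP => _ _ _ ->.
move=> a b c ab bc d e1 e2 e3 e4 x y z; apply: val_inj => /=.
by case: cl_mulP => _ <-.
Defined.

Lemma cl_vec_subproof (v : V) :
  cl_pred 1 (wedge [:: \row_a PU_const (bcoord a v)]).
Proof.
apply/asboolP; apply: ext_degree_vec => //.
- exact: PU_sectionsD.
- exact: PU_sectionsM.
- by rewrite -PU_const1; exact: PU_sections_const.
- by rewrite -tofrac1 -tofracN -mpolyC1 -mpolyCN; exact: PU_sections_const.
by move=> a; rewrite mxE; exact: PU_sections_const.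
Qed.

(* The identification of V with the component of degree 1. *)
Definition coordinate_vec (v : V) : coordinate_algebra 1 :=
  ClSections (cl_vec_subproof v).

End CoordinateAlgebra.

(* For an algebraic closure [iota : k -> K]: the forms in U have no common
   isotropic vector in K (x) V other than 0. *)
Definition base_point_free (k : fieldType) (V : vectType k)
    (U : {vspace bilin V}) (K : closedFieldType) (iota : {rmorphism k -> K}) :
    Prop :=
  forall x : 'I_(\dim {:V}) -> K,
    (forall u, u \in U -> \sum_i \sum_j
       iota (bilin_eval u (bvec i) (bvec j)) * (x i * x j) = 0) ->
    forall i, x i = 0.

(* Main.v *)
(* All the families have as base the spectrum of the semilocal ring of the affine
   line at 0 and 1.  They are lattices over k[t] in an algebra over k(t), spanned
   by finitely many elements in each degree; flatness is the absence of torsion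
   at t = 0 and t = 1.

   Since dim U = n, the algebra B_U has a basis indexed by the monomials x^a in n
   variables of degree 1: writing a = 2 b + c with c squarefree, it is the monomial
   of exponent b in the coordinates of P(U) times an exterior monomial.  Scaling the
   forms of U to 0 degenerates B_U to the algebra with the product
   x^a x^a' = q^i s^j x^(a + a'), for q = -1 and s = 0, where i is the number of
   inversions and j the number of squares formed.  This product is associative for
   all q and s, and gives Sym V for q = s = 1.

   The algebra B_U^! is the quotient of Sym V^dual by the quadrics in U.  By
   hypothesis these n quadrics have no common zero, so that their relations are
   generated by the Koszul relations.  The linear deformation of the quadrics to
   the squares of the coordinates is flat, as the Koszul relations at t = 0 and
   t = 1 lift to the whole family.  The algebra with basis the squarefree monomials
   and product x^a x^a' = q^i x^(a + a') deforms the case q = 1, which is the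
   quotient by the squares, to the exterior algebra, the case q = -1. *)
From HB Require Import structures.
From Stdlib Require Import Relation_Operators.
From mathcomp Require Import boolp classical_sets topology_structure connected.
From mathcomp Require Import all_boot all_order all_algebra generic_quotient.
From mathcomp Require Import ring_quotient fraction.
From mathcomp Require Import ring zify.
From mathcomp Require Import -(notations) mpoly.
Require Import Defs.

Set Implicit Arguments.
Unset Strict Implicit.
Unset Printing Implicit Defensive.

Import GRing.Theory.
Local Open Scope ring_scope.

(** * The affine line localized at two points *)

(** On the line from the quadrics of U to the squares of the coordinates, intermediate systems may
    acquire a common zero, where flatness fails. Localizing at 0 and 1 discards these parameters;
    the base stays connected with two k-points, and its three points make it explicit. Local
    freeness is Nakayama's lemma at the two closed points.

    The relations between n forms without common zero are determined without dimension theory: the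
    sequence of the variables, exact by Euler's formula in characteristic zero, is exchanged term by
    term for generic combinations of the forms. An exchange only needs a power of the removed
    variable in the new ideal, which is obtained by specializing the coordinates to roots over the
    algebraic closure. Exactness descends to k by a k-linear retraction of the closure.

    The degeneration of B_U is a Rees algebra for the degree in the coordinates of P(U): the
    Clifford product never lowers this degree, and its part that preserves it is the exterior
    product. *)

Section Fraction.
Import FracField.
Local Open Scope quotient_scope.

Lemma fraction_ex (R : idomainType) (f : {fraction R}) :
  exists u p, u != 0 /\ tofrac u * f = tofrac p.
Proof.
elim/quotW: f => x; exists (frac x).2, (frac x).1.
split; first exact: denom_ratioP.
rewrite !piE; apply/eqmodP => /=.
rewrite FracField.equivfE /FracField.mulf !numden_Ratio ?oner_neq0
  ?mulf_neq0 ?denom_ratioP ?oner_eq0 //.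
by rewrite mul1r !mulr1 mulrC.
Qed.

End Fraction.

(* The spectrum of the semilocal ring of the affine line at 0 and 1: [None] is
   the generic point and [Some b] the closed point b. *)
Definition germ_pt := option bool.
HB.instance Definition _ := Choice.on germ_pt.

(** The Zariski topology: with only two closed points, every set that contains the generic point is
    open. *)
Definition germ_open : set (set germ_pt) :=
  fun W => forall x, W x -> W None.

Lemma germ_openT : germ_open [set: germ_pt]%classic. Proof. by []. Qed.
Lemma germ_openI : setI_closed germ_open.
Proof. by move=> A B oA oB x [Ax Bx]; split; [exact: oA Ax|exact: oB Bx]. Qed.
Lemma germ_open_bigU (I : Type) (f : I -> set germ_pt) :
  (forall i, germ_open (f i)) -> germ_open (\bigcup_i f i)%classic.
Proof. by move=> of_ x [i _ fx]; exists i => //; exact: of_ fx. Qed.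
HB.instance Definition _ :=
  isOpenTopological.Build germ_pt germ_openT germ_openI germ_open_bigU.

Lemma germ_openE (W : set germ_pt) : open W = germ_open W.
Proof. by []. Qed.

Lemma germ_opens (W : opens germ_pt) x : W x -> W None.
Proof. by have := oset_open W; rewrite germ_openE; exact. Qed.

Section GermRing.
Variable k : fieldType.
Local Notation K := {fraction {poly k}}.
Local Notation "p %:F" := (tofrac p) : ring_scope.
Implicit Types (b : bool) (u p q : {poly k}) (f g : K).

(** The local ring of k[t] at b. The boolean b stands for the point 0 or 1 of the line, through
    [b%:R]. *)
Definition regular b f := exists u p, u.[b%:R] != 0 /\ u%:F * f = p%:F.

(** Independent of the chosen fraction by [germ_valE]; the default 0 is taken outside the local
    ring. *)
Definition germ_val b f : k :=
  xget 0 [set c | exists u p, [/\ u.[b%:R] != 0, u%:F * f = p%:F &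
                                 c = p.[b%:R] / u.[b%:R]]]%classic.

Lemma neq0_horner b u : u.[b%:R] != 0 -> u != 0.
Proof. by apply: contraNneq => ->; rewrite horner0. Qed.

Lemma germ_valE b u p f : u.[b%:R] != 0 -> u%:F * f = p%:F ->
  germ_val b f = p.[b%:R] / u.[b%:R].
Proof.
move=> ub E; rewrite /germ_val; case: xgetP => [c _ [u' [p' [u'b E' ->]]]|/(_ (p.[b%:R] / u.[b%:R]))].
  have /eqP : u%:F * p'%:F = u'%:F * p%:F by rewrite -E -E' mulrCA.
  rewrite -!rmorphM tofrac_eq => /eqP /(congr1 (horner^~ b%:R)).
  rewrite !hornerM => e; apply: (mulfI ub); rewrite mulrA e.
  by rewrite mulrAC mulfV // mul1r mulrC divfK.
by case; exists u, p.
Qed.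

Lemma regular_tofrac b p : regular b p%:F.
Proof. by exists 1, p; rewrite hornerC oner_neq0 rmorph1 mul1r. Qed.

Lemma germ_val_tofrac b p : germ_val b p%:F = p.[b%:R].
Proof.
by rewrite (@germ_valE _ 1 p) ?hornerC ?oner_neq0 ?divr1 // rmorph1 mul1r.
Qed.

Lemma regularD b f g : regular b f -> regular b g ->
  regular b (f + g) /\ germ_val b (f + g) = germ_val b f + germ_val b g.
Proof.
move=> [u [p [ub E]]] [u' [p' [u'b E']]].
have uu : (u * u').[b%:R] != 0 by rewrite hornerM mulf_neq0.
have e : (u * u')%:F * (f + g) = (p * u' + p' * u)%:F.
  rewrite rmorphD !rmorphM /= -E -E' mulrDr; congr (_ + _).
    by rewrite mulrAC.
  by rewrite -mulrA mulrC.
split; first by exists (u * u'), (p * u' + p' * u).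
rewrite (germ_valE uu e) (germ_valE ub E) (germ_valE u'b E').
rewrite hornerD !hornerM addf_div //.
Qed.

Lemma regularM b f g : regular b f -> regular b g ->
  regular b (f * g) /\ germ_val b (f * g) = germ_val b f * germ_val b g.
Proof.
move=> [u [p [ub E]]] [u' [p' [u'b E']]].
have uu : (u * u').[b%:R] != 0 by rewrite hornerM mulf_neq0.
have e : (u * u')%:F * (f * g) = (p * p')%:F.
  by rewrite !rmorphM /= -E -E' mulrACA.
split; first by exists (u * u'), (p * p').
rewrite (germ_valE uu e) (germ_valE ub E) (germ_valE u'b E').
by rewrite !hornerM mulf_div.
Qed.

Lemma regular0 b : regular b 0.
Proof. by rewrite -(rmorph0 (@tofrac {poly k})); exact: regular_tofrac. Qed.
Lemma regular1 b : regular b 1.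
Proof. by rewrite -(rmorph1 (@tofrac {poly k})); exact: regular_tofrac. Qed.
Lemma regularN b f : regular b f -> regular b (- f).
Proof.
move=> rf; rewrite -mulN1r -(rmorph1 (@tofrac {poly k})) -rmorphN.
exact: (regularM (regular_tofrac _ _) rf).1.
Qed.
Lemma germ_val0 b : germ_val b 0 = 0.
Proof. by rewrite -(rmorph0 (@tofrac {poly k})) germ_val_tofrac horner0. Qed.
Lemma germ_val1 b : germ_val b 1 = 1.
Proof. by rewrite -(rmorph1 (@tofrac {poly k})) germ_val_tofrac hornerC. Qed.

Lemma regularV b f : regular b f -> germ_val b f != 0 -> regular b f^-1.
Proof.
move=> [u [p [ub E]]]; rewrite (germ_valE ub E) => pb.
have pb' : p.[b%:R] != 0 by apply: contraNneq pb => ->; rewrite mul0r.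
exists p, u; split=> //; rewrite -E -mulrA mulfV ?mulr1 //.
apply/eqP=> f0; move: E; rewrite f0 mulr0 => /esym/eqP; rewrite tofrac_eq0.
by rewrite (negbTE (neq0_horner pb')).
Qed.

(* The sections over the open set W; over the empty set they form the zero
   ring. *)
Definition germ_sect_pred (W : opens germ_pt) : pred K := fun f =>
  `[< (~ W None -> f = 0) /\ forall b, W (Some b) -> regular b f >].

Lemma germ_sect_zmod W : zmod_closed (germ_sect_pred W).
Proof.
split=> [|f g /asboolP [f0 fr] /asboolP [g0 gr]]; apply/asboolP.
  by split=> // b _; exact: regular0.
split=> [h|b Wb]; first by rewrite f0 // g0 // subr0.
by apply: (regularD _ _).1; [exact: fr|apply: regularN; exact: gr].
Qed.
HB.instance Definition _ W :=
  GRing.isZmodClosed.Build K (germ_sect_pred W) (germ_sect_zmod W).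
Record germ_sect W := GermSect { germ_fun : K; _ : germ_sect_pred W germ_fun }.
HB.instance Definition _ W := [isSub for @germ_fun W].
HB.instance Definition _ W := [Choice of germ_sect W by <:].
HB.instance Definition _ W := [SubChoice_isSubZmodule of germ_sect W by <:].

Lemma germ_sectP W (s : germ_sect W) :
  (~ W None -> germ_fun s = 0) /\ forall b, W (Some b) -> regular b (germ_fun s).
Proof. by apply/asboolP; case: s. Qed.

(** The unit of the ring of sections, which is 0 over the empty set. Restriction to W is
    multiplication by it, so that all sections live in the same field K. *)
Definition germ_unit (W : opens germ_pt) : K := if `[< W None >] then 1 else 0.

Lemma germ_unit1 (W : opens germ_pt) x : W x -> germ_unit W = 1.
Proof. by move=> /germ_opens Wx; rewrite /germ_unit asboolT. Qed.

Lemma germ_unit0 (W : opens germ_pt) : ~ W None -> germ_unit W = 0.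
Proof. by move=> Wx; rewrite /germ_unit asboolF. Qed.

Lemma germ_unitM (W W' : opens germ_pt) : (W' `<=` W)%classic ->
  germ_unit W' * germ_unit W = germ_unit W'.
Proof.
move=> h; have [w|w] := pselect (W' None); last by rewrite germ_unit0 ?mul0r.
by rewrite (germ_unit1 (h _ w)) mulr1.
Qed.

Lemma germ_unit_sect W (s : germ_sect W) : germ_unit W * germ_fun s = germ_fun s.
Proof.
have [w|w] := pselect (W None); first by rewrite (germ_unit1 w) mul1r.
by rewrite (germ_sectP s).1 // mulr0.
Qed.

Lemma germ_restr_subproof (W' : opens germ_pt) f : 
  (forall b, W' (Some b) -> regular b f) -> germ_sect_pred W' (germ_unit W' * f).
Proof.
move=> fr; apply/asboolP; split=> [w|b w]; first by rewrite germ_unit0 ?mul0r.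
by rewrite (germ_unit1 w) mul1r; exact: fr.
Qed.

Definition germ_one W : germ_sect W.
Proof.
exists (germ_unit W); rewrite -[germ_unit W]mulr1.
by apply: germ_restr_subproof => // b _; exact: regular1.
Defined.

Lemma germ_mul_subproof W (s t : germ_sect W) :
  germ_sect_pred W (germ_fun s * germ_fun t).
Proof.
apply/asboolP; split=> [w|b w]; first by rewrite (germ_sectP s).1 ?mul0r.
by apply: (regularM _ _).1; apply: (germ_sectP _).2.
Qed.
Definition germ_mul W (s t : germ_sect W) := GermSect (germ_mul_subproof s t).

Lemma germ_mulA W : associative (@germ_mul W).
Proof. by move=> s t u; apply: val_inj; rewrite /= mulrA. Qed.
Lemma germ_mulC W : commutative (@germ_mul W).
Proof. by move=> s t; apply: val_inj; rewrite /= mulrC. Qed.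
Lemma germ_mul1 W : left_id (germ_one W) (@germ_mul W).
Proof. by move=> s; apply: val_inj; rewrite /= germ_unit_sect. Qed.
Lemma germ_mulDl W : left_distributive (@germ_mul W) +%R.
Proof. by move=> s t u; apply: val_inj; rewrite /= mulrDl. Qed.
HB.instance Definition _ W := GRing.Zmodule_isComPzRing.Build (germ_sect W)
  (@germ_mulA W) (@germ_mulC W) (@germ_mul1 W) (@germ_mulDl W).

Lemma germ_funD W (s t : germ_sect W) : germ_fun (s + t) = germ_fun s + germ_fun t.
Proof. by []. Qed.
Lemma germ_funM W (s t : germ_sect W) : germ_fun (s * t) = germ_fun s * germ_fun t.
Proof. by []. Qed.
Lemma germ_fun1 W : germ_fun (1 : germ_sect W) = germ_unit W.
Proof. by []. Qed.

Definition germ_str_fun W (c : k) : germ_sect W :=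
  GermSect (@germ_restr_subproof W c%:P%:F (fun b _ => regular_tofrac b _)).

Lemma germ_str_additive W : zmod_morphism (germ_str_fun W).
Proof. by move=> c d; apply: val_inj; rewrite /= polyCB rmorphB mulrBr. Qed.
Lemma germ_str_mult W : monoid_morphism (germ_str_fun W).
Proof.
split=> [|c d]; apply: val_inj; rewrite /= ?polyC1 ?rmorph1 ?mulr1 //.
by rewrite polyCM rmorphM mulrACA germ_unitM.
Qed.
HB.instance Definition _ W := GRing.isZmodMorphism.Build k (germ_sect W)
  (germ_str_fun W) (germ_str_additive W).
HB.instance Definition _ W := GRing.isMonoidMorphism.Build k (germ_sect W)
  (germ_str_fun W) (germ_str_mult W).

Definition germ_res_fun (W W' : opens germ_pt) (h : (W' `<=` W)%classic) (s : germ_sect W) :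
    germ_sect W' :=
  GermSect (@germ_restr_subproof W' (germ_fun s)
             (fun b w => (germ_sectP s).2 b (h _ w))).

Lemma germ_res_additive (W W' : opens germ_pt) (h : (W' `<=` W)%classic) :
  zmod_morphism (germ_res_fun h).
Proof. by move=> s t; apply: val_inj; rewrite /= mulrBr. Qed.
Lemma germ_res_mult (W W' : opens germ_pt) (h : (W' `<=` W)%classic) :
  monoid_morphism (germ_res_fun h).
Proof.
split=> [|s t]; apply: val_inj; rewrite /= ?germ_unitM //.
by rewrite mulrACA germ_unitM.
Qed.
HB.instance Definition _ W W' h := GRing.isZmodMorphism.Build
  (germ_sect W) (germ_sect W') (@germ_res_fun W W' h) (germ_res_additive h).
HB.instance Definition _ W W' h := GRing.isMonoidMorphism.Build
  (germ_sect W) (germ_sect W') (@germ_res_fun W W' h) (germ_res_mult h).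

(* Gluing for subsheaves of the constant sheaf V extended by zero. *)
Lemma germ_sheaf (V : zmodType) (F : opens germ_pt -> zmodType)
    (val : forall W, F W -> V) (P : opens germ_pt -> V -> Prop)
    (res : forall W W' : opens germ_pt, (W' `<=` W)%classic -> F W -> F W') :
  (forall W, injective (@val W)) ->
  (forall W s, P W (@val W s)) ->
  (forall W v, P W v -> exists s, @val W s = v) ->
  (forall W v, P W v <-> (~ W None -> v = 0) /\
     forall b, W (Some b) -> exists2 W' : opens germ_pt, W' (Some b) & P W' v) ->
  (forall (W W' : opens germ_pt) (h : (W' `<=` W)%classic) s,
     val _ (res _ _ h s) = if `[< W' None >] then val _ s else 0) ->
  is_sheaf res.
Proof.
move=> vI vP Pv PE vres I W D DW cov s agree.
have [w|w] := pselect (W None); last first.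
  have P0 : P W 0.
    by apply/PE; split=> // b /germ_opens /w.
  have [t0 t0E] := Pv _ _ P0.
  have F0 : forall t : F W, t = t0.
    by move=> t; apply: vI; rewrite t0E; have /PE [-> //] := vP _ t.
  exists t0; split=> [i|t _]; last by rewrite (F0 t).
  have nD : ~ D i None by move=> /DW.
  apply: vI; rewrite vres asboolF //.
  by have /PE [-> //] := vP _ (s i).
have [i0 D0] := cov _ w.
(* Nonempty members of the cover all contain the generic point, so that compatible sections are
   equal as elements of V. *)
have sE i : D i None -> val _ (s i) = val _ (s i0).
  move=> Di; have oI : open ([set x | D i x /\ D i0 x]%classic : set germ_pt).
    by rewrite germ_openE => x [].
  have hi : (Opens oI `<=` D i)%classic by move=> x [].
  have h0 : (Opens oI `<=` D i0)%classic by move=> x [].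
  have := congr1 (val _) (agree i i0 _ hi h0).
  by rewrite !vres asboolT.
have PW : P W (val _ (s i0)).
  apply/PE; split=> // b Wb; have [i Di] := cov _ Wb.
  by exists (D i) => //; rewrite -(sE i (germ_opens Di)); exact: vP.
have [t tE] := Pv _ _ PW.
exists t; split=> [i|t' t'E].
  apply: vI; rewrite vres tE; case: asboolP => Di; first by rewrite sE.
  by have /PE [-> //] := vP _ (s i).
by apply: vI; rewrite tE -(t'E i0) vres asboolT.
Qed.

Lemma germ_res_val (W W' : opens germ_pt) (h : (W' `<=` W)%classic) (s : germ_sect W) :
  germ_fun (germ_res_fun h s) = if `[< W' None >] then germ_fun s else 0.
Proof.
by rewrite /= /germ_unit; case: ifP => _; rewrite ?mul1r ?mul0r.
Qed.

Lemma germ_sect_sheaf :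
  @is_sheaf _ germ_sect (fun W W' h => @germ_res_fun W W' h).
Proof.
apply: (@germ_sheaf K germ_sect germ_fun germ_sect_pred).
- by move=> W; exact: val_inj.
- by move=> W; case.
- by move=> W v Pv; exists (GermSect Pv).
- move=> W v; split=> [/asboolP [v0 vr]|[v0 vr]].
    split=> // b Wb; exists W => //; apply/asboolP; split=> //.
  apply/asboolP; split=> // b Wb; have [W' W'b /asboolP [_]] := vr b Wb.
  exact.
exact: germ_res_val.
Qed.

Definition germ_rs : ringed_space k.
Proof.
refine (@RingedSpace k germ_pt germ_sect (fun W => germ_str_fun W)
  (fun W W' h => @germ_res_fun W W' h) _ _ _ germ_sect_sheaf).
- by move=> W W' h c; apply: val_inj; rewrite /= mulrA germ_unitM.
- by move=> W h s; apply: val_inj; rewrite /= germ_unit_sect.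
by move=> W W' W'' h h' h'' s; apply: val_inj; rewrite /= mulrA germ_unitM.
Defined.

End GermRing.

Section GermScheme.
Variable k : fieldType.
Local Notation K := {fraction {poly k}}.
Local Notation "p %:F" := (tofrac p) : ring_scope.
Implicit Types (b : bool) (u p q : {poly k}) (f g : K).

Definition germ_top : opens germ_pt := Opens openT.

Local Notation A := (germ_sect k germ_top).

Lemma germ_top_regular (a : A) b : regular b (germ_fun a).
Proof. by apply: (germ_sectP a).2. Qed.

Definition germ_sect_of f (fr : forall b, regular b f) : A.
Proof. by exists f; apply/asboolP; split=> [h|b _]; [case: h|exact: fr]. Defined.

Definition germ_poly p : A := germ_sect_of (fun b => regular_tofrac b p).

Definition germ_ideal (x : germ_pt) : set A := fun a =>
  if x is Some b then germ_val b (germ_fun a) = 0 else a = 0.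

Local Notation tau b := ('X - (b%:R)%:P : {poly k}).

Lemma factor_tau b p : p.[b%:R] = 0 -> exists p', p = tau b * p'.
Proof.
by move=> /eqP /factor_theorem [p' ->]; exists p'; rewrite mulrC.
Qed.

Lemma tau_neq0 b : tau b != 0. Proof. by rewrite polyXsubC_eq0. Qed.

Lemma hornerXsubC_neq b b' : b != b' -> (tau b).[b'%:R] != 0.
Proof.
by case: b; case: b' => // _; rewrite !hornerE ?sub0r ?subr0 ?oppr_eq0 oner_neq0.
Qed.

Lemma germ_unit_inv (a : A) : (forall b, germ_val b (germ_fun a) != 0) ->
  exists a' : A, a * a' = 1.
Proof.
move=> h; have r b : regular b (germ_fun a)^-1.
  by apply: regularV => //; exact: germ_top_regular.
exists (germ_sect_of r); apply: val_inj => /=.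
rewrite /germ_unit asboolT // mulfV //.
by apply: contraNneq (h true) => ->; rewrite germ_val0.
Qed.

(** The maximal ideal at b is generated by t - b: the quotient is regular at b because the numerator
    has the root b, and at the other point because t - b is a unit there. *)
Lemma germ_val_eq0 (a : A) b : germ_val b (germ_fun a) = 0 ->
  exists a' : A, a = germ_poly (tau b) * a'.
Proof.
have [u [p [ub E]]] := germ_top_regular a b.
rewrite (germ_valE ub E) => /eqP; rewrite mulf_eq0 invr_eq0 (negbTE ub) orbF.
move=> /eqP /factor_tau [p' pE].
have r b' : regular b' (germ_fun a / (tau b)%:F).
  have [->|bb'] := eqVneq b' b.
    exists u, p'; split=> //; rewrite mulrA E pE rmorphM mulrAC mulfV ?mul1r //.
    by rewrite tofrac_eq0 tau_neq0.
  apply: (regularM _ _).1; first exact: germ_top_regular.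
  apply: regularV; first exact: regular_tofrac.
  by rewrite germ_val_tofrac hornerXsubC_neq // eq_sym.
exists (germ_sect_of r); apply: val_inj; rewrite /= mulrCA mulfV ?mulr1 //.
by rewrite tofrac_eq0 tau_neq0.
Qed.

Lemma germ_ideal_prime x : prime_ideal (germ_ideal x).
Proof.
have one_n0 : (1 : A) <> 0.
  move=> /(congr1 (@germ_fun _ _)); rewrite ?germ_fun1 /germ_unit asboolT //=.
  by move/eqP; rewrite oner_eq0.
case: x => [b|]; split=> //=.
- by rewrite germ_val0.
- move=> a a' a0 a'0; rewrite ?germ_funD.
  by rewrite (regularD _ _).2 ?a0 ?a'0 ?addr0 //; exact: germ_top_regular.
- move=> a a' a'0; rewrite ?germ_funM.
  by rewrite (regularM _ _).2 ?a'0 ?mulr0 //; exact: germ_top_regular.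
- rewrite ?germ_fun1 /germ_unit asboolT // germ_val1 => /eqP.
  by rewrite oner_eq0.
- move=> a a'; rewrite ?germ_funM (regularM _ _).2; try exact: germ_top_regular.
  by move/eqP; rewrite mulf_eq0 => /orP [] /eqP; [left|right].
- by move=> a a' -> ->; rewrite addr0.
- by move=> a a' ->; rewrite mulr0.
move=> a a' /(congr1 (@germ_fun _ _)) /eqP; rewrite ?germ_funM mulf_eq0.
by case/orP => /eqP e; [left|right]; apply: val_inj.
Qed.

(** A nonzero prime contains a nonzero polynomial. Without the roots 0 and 1 it would be a unit, so
    that the prime contains some t - b, and hence is the maximal ideal at b. *)
Lemma germ_prime_ex (P : set A) : prime_ideal P -> exists x, germ_ideal x = P.
Proof.
move=> [P0 PD PM P1 PP].
have [h|] := pselect (forall a, P a -> a = 0).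
  exists None; apply/funext => a; apply/propext; split=> [->//|]; exact: h.
move/existsNP => [a /not_implyP [Pa a0]].
have [b Pb] : exists b, P (germ_poly (tau b)).
  have [u [p [ub E]]] := germ_top_regular a true.
  have Pp : P (germ_poly p).
    have -> : germ_poly p = germ_poly u * a by apply: val_inj; rewrite /= -E.
    exact: PM.
  have p0 : p != 0.
    apply/eqP => p0; apply: a0; apply: val_inj => /=; apply/eqP.
    move: E; rewrite p0 rmorph0 => /eqP; rewrite mulf_eq0 tofrac_eq0.
    by rewrite (negbTE (neq0_horner ub)).
  have [N] := ubnP (size p); elim: N p p0 Pp {a u a0 Pa ub E} => // N IH p p0 Pp pN.
  have [|nb] := pselect (exists b, p.[b%:R] = 0).
    move=> [b /factor_tau [p' pE]].
    have p'0 : p' != 0 by apply: contraNneq p0 => p'0; rewrite pE p'0 mulr0.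
    have /PP [] : P (germ_poly (tau b) * germ_poly p').
    - have <- : germ_poly p = germ_poly (tau b) * germ_poly p'.
        by apply: val_inj; rewrite /= pE rmorphM.
      exact: Pp.
    - by exists b.
    move=> Pp'; apply: (IH p') => //; rewrite ltnS in pN; apply: leq_trans pN.
    by rewrite pE mulrC size_Mmonic ?monicXsubC // size_XsubC addn2.
  have [|a' E] := @germ_unit_inv (germ_poly p).
    move=> b; rewrite germ_val_tofrac; apply/eqP => pb; apply: nb.
    by exists b.
  by case: P1; rewrite -E mulrC; exact: PM.
exists (Some b); apply/funext => f; apply/propext; split.
  by move=> /germ_val_eq0 [f' ->]; rewrite mulrC; exact: PM.
move=> Pf /=; apply/eqP; apply: contraPT P1 => fb; apply; set c := germ_val b _ in fb.
have [|f' E] := @germ_val_eq0 (f - germ_poly c%:P) b.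
  rewrite /= (regularD _ _).2 -?rmorphN; try exact: regular_tofrac; last exact: germ_top_regular.
  by rewrite germ_val_tofrac !hornerE subrr.
have -> : 1 = germ_poly (c^-1)%:P * (f + (- f') * germ_poly (tau b)).
  have -> : f + - f' * germ_poly (tau b) = germ_poly c%:P.
    by rewrite mulNr mulrC -E opprB addrC subrK.
  apply: val_inj; rewrite /= -rmorphM -polyCM mulVf // rmorph1.
  by rewrite /germ_unit asboolT.
by apply: (PM); apply: (PD) => //; exact: PM.
Qed.

Lemma germ_ideal_inj : injective germ_ideal.
Proof.
have tb b : germ_ideal (Some b) (germ_poly (tau b)).
  by rewrite /= germ_val_tofrac !hornerE subrr.
have tN b : ~ germ_ideal None (germ_poly (tau b)).
  by move=> /(congr1 (@germ_fun _ _)) /eqP /=; rewrite tofrac_eq0 polyXsubC_eq0.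
move=> [b|] [b'|] // E.
- have [->//|bb'] := eqVneq b b'; move: (tb b); rewrite E /= germ_val_tofrac.
  by move=> /eqP; rewrite (negbTE (hornerXsubC_neq bb')).
- by case: (tN b); rewrite -E.
by case: (tN b'); rewrite E.
Qed.

Lemma germ_basis (W : set germ_pt) : open W <->
  forall x, W x -> exists a, ~ germ_ideal x a /\ forall y, ~ germ_ideal y a -> W y.
Proof.
split=> [oW x Wx|h]; last first.
  rewrite germ_openE => x /h [a [xa]]; apply => /= a0; apply: xa; rewrite a0.
  by case: x => [b|] //=; rewrite germ_val0.
(* The product of the two [T b] vanishes exactly at the closed points outside W. *)
pose T b := if `[< W (Some b) >] then 1 else tau b.
exists (germ_poly (T true * T false)); split; last first.
  case=> [b|] /=; last by move=> _; exact: oW Wx.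
  rewrite germ_val_tofrac hornerM => nz; apply: contrapT => w; apply: nz.
  have Tb : (T b).[b%:R] = 0 by rewrite /T asboolF // !hornerE subrr.
  by clear -Tb; case: b Tb => ->; rewrite ?mul0r ?mulr0.
have T0 b : T b != 0 by rewrite /T; case: ifP => _; rewrite ?oner_eq0 ?polyXsubC_eq0.
case: x Wx => [b|] Wb /=; last first.
  move=> /(congr1 (@germ_fun _ _)) /eqP /=.
  by rewrite tofrac_eq0 mulf_eq0 !(negbTE (T0 _)).
rewrite germ_val_tofrac hornerM => /eqP; rewrite mulf_eq0.
have Tb b' : (T b').[b%:R] != 0.
  have [->|bb'] := eqVneq b' b; first by rewrite /T asboolT // hornerC oner_eq0.
  by rewrite /T; case: ifP => _; rewrite ?hornerC ?oner_eq0 // hornerXsubC_neq.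
by rewrite !(negbTE (Tb _)).
Qed.

(** Each multiplication by a, which vanishes at b, cancels one factor t - b of the denominator. *)
Lemma germ_clear (a : A) b f : germ_fun a != 0 -> germ_val b (germ_fun a) = 0 ->
  exists N, regular b (f * germ_fun a ^+ N).
Proof.
move=> a0 ab; have [a' aE] := germ_val_eq0 ab.
have aF : germ_fun a = (tau b)%:F * germ_fun a' by rewrite aE germ_funM.
have [q [p [q0 E]]] := fraction_ex f.
have [N] := ubnP (size q); elim: N => // N IH in q p q0 f E *; rewrite ltnS => qN.
have [qb|qb] := eqVneq q.[b%:R] 0; last by exists 0; rewrite mulr1; exists q, p.
have [q' qE] := factor_tau qb.
have q'0 : q' != 0 by apply: contraNneq q0 => q'0; rewrite qE q'0 mulr0.
have [||M rM] := IH q' p q'0 (f * (tau b)%:F).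
- by rewrite -E qE rmorphM mulrA [LHS]mulrC mulrA.
- by apply: leq_trans qN; rewrite qE mulrC size_Mmonic ?monicXsubC // size_XsubC addn2.
exists M.+1; rewrite exprS {1}aF.
have -> : f * ((tau b)%:F * germ_fun a' * germ_fun a ^+ M) =
    f * (tau b)%:F * germ_fun a ^+ M * germ_fun a'.
  by rewrite -!mulrA; congr (_ * (_ * _)); rewrite mulrC.
by apply: (regularM rM _).1; exact: germ_top_regular.
Qed.

Lemma germ_affine : affine (X := germ_rs k) germ_top.
Proof.
exists A, germ_ideal, idfun; split.
- by move=> x _; exact: germ_ideal_prime.
- move=> P /germ_prime_ex [x xE]; exists x; split=> // y [_ yE].
  by apply: germ_ideal_inj; rewrite xE yE.
- move=> W' _; rewrite germ_basis; split=> h x /h [a [xa aW]]; exists a; split=> //.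
    by move=> y _; exact: aW.
  by move=> y; apply: aW.
move=> a D h DE /=.
have DN : D None <-> a <> 0 by rewrite DE; split=> [[]|].
have unitD : ~ D None -> a = 0 by move=> w; apply: contrapT => /DN.
have resE (s : A) : germ_fun (germ_res_fun h s) = germ_unit k D * germ_fun s by [].
split.
- have aV : germ_sect_pred D (germ_unit k D * (germ_fun a)^-1).
    apply: (@germ_restr_subproof k D) => b /DE [_ ab]; apply: regularV.
      exact: germ_top_regular.
    by apply/eqP.
  exists (GermSect aV); apply: val_inj; rewrite /= /germ_unit.
  case: asboolP => [/DN a0|w]; last by rewrite !mul0r.
  rewrite !mul1r mulfV //; apply/eqP => a0'; apply: a0; exact: val_inj.
- move=> s; have [w|w] := pselect (D None); last first.
    exists 0, 0; apply: val_inj => /=.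
    by rewrite (germ_sectP s).1 // mul0r mulr0.
  have a0 : germ_fun a != 0.
    by apply/eqP => a0'; move/DN: w; apply; exact: val_inj.
  have ex b : exists N, regular b (germ_fun s * germ_fun a ^+ N).
    have [ab|ab] := eqVneq (germ_val b (germ_fun a)) 0; first exact: germ_clear.
    exists 0; rewrite mulr1; apply: (germ_sectP s).2; apply/DE; split=> //=.
    exact/eqP.
  have rX b N : regular b (germ_fun a ^+ N).
    elim: N => [|N IH]; first by rewrite expr0; exact: regular1.
    by rewrite exprS; apply: (regularM _ IH).1; exact: germ_top_regular.
  have [N1 r1] := ex true; have [N2 r2] := ex false.
  have r b : regular b (germ_fun s * germ_fun a ^+ (N1 + N2)).
    case: b; rewrite exprD; first by rewrite mulrA; exact: (regularM r1 _).1.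
    by rewrite mulrCA mulrC; exact: (regularM r2 _).1.
  exists (N1 + N2)%N, (germ_sect_of r); apply: val_inj.
  change (germ_fun s * germ_fun (germ_res_fun h a ^+ (N1 + N2)) =
          germ_unit k D * (germ_fun s * germ_fun a ^+ (N1 + N2))).
  have -> : germ_fun (germ_res_fun h a ^+ (N1 + N2)) = germ_unit k D * germ_fun a ^+ (N1 + N2).
    elim: (N1 + N2)%N => [|N IH]; first by rewrite !expr0 mulr1.
    by rewrite !exprS germ_funM IH mulrACA germ_unitM.
  by rewrite mulrCA.
move=> b /(congr1 (@germ_fun _ _)) e.
have [w|w] := pselect (D None); last by exists 1; rewrite expr1 unitD ?mul0r.
exists 0; rewrite expr0 mul1r; apply: val_inj; move: e.
by rewrite resE (germ_unit1 k w) mul1r.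
Qed.

Definition germ_scheme : scheme k :=
  @Scheme k (germ_rs k) (fun x => ex_intro2 _ _ germ_top I germ_affine).

(** A nonempty open set contains the generic point, whose closure is the whole space. *)
Lemma germ_connected : connected [set: germ_scheme]%classic.
Proof.
move=> B [x Bx] [C oC BC] [C' cC' BC'].
move: BC BC'; rewrite !classical_sets.setTI => BC BC'; subst C'.
have BN : B None by rewrite BC; rewrite BC in Bx; exact: oC Bx.
apply/seteqP; split=> // y _; apply: contrapT => By.
have := closed_openC cC'; rewrite germ_openE => /(_ y By); exact.
Qed.

Definition germ_ev b (W : opens germ_pt) (hx : W (Some b)) (s : germ_sect k W) :=
  germ_val b (germ_fun s).

Lemma germ_ev_zmod b W hx : zmod_morphism (@germ_ev b W hx).
Proof.
have r s := (germ_sectP (s : germ_sect k W)).2 _ hx.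
move=> s t; rewrite /germ_ev [germ_fun _]/= (regularD (r s) (regularN (r t))).2.
congr (_ + _); rewrite -mulN1r -(rmorph1 (@tofrac {poly k})) -rmorphN.
rewrite (regularM (regular_tofrac _ _) (r t)).2 germ_val_tofrac.
by rewrite hornerN hornerC mulN1r.
Qed.
Lemma germ_ev_monoid b W hx : monoid_morphism (@germ_ev b W hx).
Proof.
have r s := (germ_sectP (s : germ_sect k W)).2 _ hx.
split=> [|s t]; first by rewrite /germ_ev germ_fun1 (germ_unit1 k hx) germ_val1.
by rewrite /germ_ev germ_funM (regularM (r s) (r t)).2.
Qed.
HB.instance Definition _ b W hx := GRing.isZmodMorphism.Build (germ_sect k W) k
  (@germ_ev b W hx) (germ_ev_zmod hx).
HB.instance Definition _ b W hx := GRing.isMonoidMorphism.Build (germ_sect k W) k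
  (@germ_ev b W hx) (germ_ev_monoid hx).

Definition germ_kpoint b : kpoint germ_scheme.
Proof.
refine (@KPoint k germ_scheme (Some b) (fun W hx => @germ_ev b W hx) _ _ _).
- move=> W hx c; rewrite /= /germ_ev /= (germ_unit1 k hx) mul1r germ_val_tofrac.
  by rewrite hornerC.
- by move=> W W' h hx hx' s; rewrite /= /germ_ev /= (germ_unit1 k hx') mul1r.
move=> W hx s sb.
have oW : open ([set x | x = None \/ x = Some b]%classic : set germ_pt).
  by rewrite germ_openE => x _; left.
have h : (Opens oW `<=` W)%classic by move=> x [] ->; [exact: germ_opens hx|].
exists (Opens oW), h; split; first by right.
have V : germ_sect_pred (Opens oW) (germ_unit k (Opens oW) * (germ_fun s)^-1).
  apply: (@germ_restr_subproof k (Opens oW)) => b' [//|[->]].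
  by apply: regularV => //; apply: (germ_sectP s).2.
exists (GermSect V); apply: val_inj => /=.
rewrite mulrACA germ_unitM // mulfV ?mulr1 //.
by apply: contraNneq sb => s0; rewrite /= /germ_ev s0 germ_val0.
Defined.

End GermScheme.

(** * Families of algebras given by spanning elements *)

Lemma common_denominator (R : idomainType) (T : finType) (c : T -> {fraction R}) :
  exists u (p : T -> R), u != 0 /\ forall t, tofrac u * c t = tofrac (p t).
Proof.
have /choice [u /choice [p up]] t : exists u p, u != 0 /\ tofrac u * c t = tofrac p.
  exact: fraction_ex.
exists (\prod_t u t), (fun t => (\prod_(s | s != t) u s) * p t); split.
  by apply/prodf_neq0 => t _; case: (up t).
move=> t; rewrite (bigD1 t) //= !tofracM -(up t).2; ring.
Qed.

Lemma mulf_cancel2 (F : fieldType) (w u q p : F) : w != 0 -> u != 0 ->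
  w * u * (q / w * p / u) = q * p.
Proof. by move=> w0 u0; field; rewrite w0 u0. Qed.

Section GalgLinear.
Variables (k : fieldType) (A : galg k).

Lemma gmulDl1 i j l (e : (i + j)%N = l) (x x' : A i) (y : A j) :
  gmul e (x + x') y = gmul e x y + gmul e x' y.
Proof. by rewrite -{1}[x]scale1r gmulDl scale1r. Qed.

Lemma gmulDr1 i j l (e : (i + j)%N = l) (x : A i) (y y' : A j) :
  gmul e x (y + y') = gmul e x y + gmul e x y'.
Proof. by rewrite -{1}[y]scale1r gmulDr scale1r. Qed.

Lemma gmulZl i j l (e : (i + j)%N = l) c (x : A i) (y : A j) :
  gmul e (c *: x) y = c *: gmul e x y.
Proof. by rewrite -[c *: x]addr0 gmulDl gmul0l addr0. Qed.

Lemma gmulZr i j l (e : (i + j)%N = l) c (x : A i) (y : A j) :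
  gmul e x (c *: y) = c *: gmul e x y.
Proof. by rewrite -[c *: y]addr0 gmulDr gmul0r addr0. Qed.

Lemma gmul_suml i j l (e : (i + j)%N = l) (T : Type) (r : seq T) (P : pred T)
    (F : T -> A i) (y : A j) :
  gmul e (\sum_(t <- r | P t) F t) y = \sum_(t <- r | P t) gmul e (F t) y.
Proof. by apply: (big_morph (fun x => gmul e x y)) => [u v|]; rewrite ?gmulDl1 ?gmul0l. Qed.

Lemma gmul_sumr i j l (e : (i + j)%N = l) (T : Type) (r : seq T) (P : pred T)
    (x : A i) (F : T -> A j) :
  gmul e x (\sum_(t <- r | P t) F t) = \sum_(t <- r | P t) gmul e x (F t).
Proof. by apply: (big_morph (gmul e x)) => [u v|]; rewrite ?gmulDr1 ?gmul0r. Qed.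

End GalgLinear.

Section SpanFamily.
Variable k : fieldType.
Local Notation K := {fraction {poly k}}.
Local Notation "p %:F" := (tofrac p) : ring_scope.
Local Notation tau b := ('X - (b%:R)%:P : {poly k}).
Implicit Types (b : bool).
Variables (AK : galg K) (A : bool -> galg k) (I : nat -> finType).
Variables (e : forall d, I d -> AK d) (al : forall b d, I d -> A b d).

Definition ecomb d (p : I d -> {poly k}) : AK d := \sum_i (p i)%:F *: e i.
Definition acomb b d (p : I d -> {poly k}) : A b d :=
  \sum_i (p i).[b%:R] *: al b i.

Hypothesis span_e : forall d (x : AK d), exists c : I d -> K, x = \sum_i c i *: e i.
Hypothesis span_al : forall b d (a : A b d),
  exists c : I d -> k, a = \sum_i c i *: al b i.
Hypothesis mul_e : forall i j l (E : (i + j)%N = l) (a : I i) (c : I j),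
  exists p, gmul E (e a) (e c) = ecomb p /\
    forall b, gmul E (al b a) (al b c) = acomb b p.
Hypothesis one_e : exists p, gone AK = ecomb p /\ forall b, gone (A b) = acomb b p.
(** Specialization at b is well defined on the lattice spanned by the e ([spec_e]), and its kernel
    is t - b times the lattice ([ker_e]). These two conditions are the form in which flatness is
    checked; freeness is deduced from them. *)
Hypothesis spec_e : forall b d (p : I d -> {poly k}), ecomb p = 0 -> acomb b p = 0.
Hypothesis ker_e : forall b d (p : I d -> {poly k}), acomb b p = 0 ->
  exists p', ecomb p = (tau b)%:F *: ecomb p'.

Lemma ecombL d c (p p' : I d -> {poly k}) :
  ecomb (fun i => c * p i + p' i) = c%:F *: ecomb p + ecomb p'.
Proof.
rewrite /ecomb scaler_sumr -big_split; apply: eq_bigr => i _ /=.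
by rewrite scalerA -scalerDl rmorphD rmorphM.
Qed.

Lemma acombL b d c (p p' : I d -> {poly k}) :
  acomb b (fun i => c * p i + p' i) = c.[b%:R] *: acomb b p + acomb b p'.
Proof.
rewrite /acomb scaler_sumr -big_split; apply: eq_bigr => i _ /=.
by rewrite scalerA -scalerDl hornerD hornerM.
Qed.

Lemma ecomb0 d : ecomb (fun _ : I d => 0) = 0.
Proof. by rewrite /ecomb big1 // => i _; rewrite rmorph0 scale0r. Qed.
Lemma acomb0 b d : acomb b (fun _ : I d => 0) = 0.
Proof. by rewrite /acomb big1 // => i _; rewrite horner0 scale0r. Qed.

Lemma ecombZ d c (p : I d -> {poly k}) : ecomb (fun i => c * p i) = c%:F *: ecomb p.
Proof.
rewrite -[RHS]addr0 -(ecomb0 d) -ecombL; apply: eq_bigr => i _; by rewrite addr0.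
Qed.
Lemma acombZ b d c (p : I d -> {poly k}) :
  acomb b (fun i => c * p i) = c.[b%:R] *: acomb b p.
Proof.
rewrite -[RHS]addr0 -(acomb0 b d) -acombL; apply: eq_bigr => i _; by rewrite addr0.
Qed.

(* [x] belongs to the k[t]-lattice spanned by the [e i], localized at b. *)
Definition lat b d (x : AK d) : Prop :=
  exists u p, u.[b%:R] != 0 /\ u%:F *: x = ecomb p.

(** The specialization at b of an element of the localized lattice; [specE] shows that the
    presentation does not matter. *)
Definition spec b d (x : AK d) : A b d :=
  xget 0 [set a | exists u p, [/\ u.[b%:R] != 0, u%:F *: x = ecomb p &
                                 a = u.[b%:R]^-1 *: acomb b p]]%classic.

Lemma specE b d (x : AK d) u p : u.[b%:R] != 0 -> u%:F *: x = ecomb p ->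
  spec b x = u.[b%:R]^-1 *: acomb b p.
Proof.
move=> ub E; rewrite /spec.
case: xgetP => [a _ [u' [p' [u'b E' ->]]]|/(_ (u.[b%:R]^-1 *: acomb b p))]; last first.
  by case; exists u, p.
have /(spec_e b) : ecomb (fun i => u' * p i + (- u) * p' i) = 0.
  rewrite ecombL ecombZ -E -E' !scalerA -!rmorphM -scalerDl -rmorphD mulNr.
  by rewrite [u' * u]mulrC subrr rmorph0 scale0r.
rewrite acombL acombZ hornerN scaleNr => /eqP; rewrite subr_eq0 => /eqP e1.
apply: (scalerI ub); apply: (scalerI u'b).
by rewrite !scalerA mulrAC mulfV // mul1r -[u'.[_] * _ * _]mulrA mulfV // mulr1.
Qed.

Lemma latL b d c (x y : AK d) : regular b c -> lat b x -> lat b y ->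
  lat b (c *: x + y) /\
  spec b (c *: x + y) = germ_val b c *: spec b x + spec b y.
Proof.
move=> [w [q [wb Ec]]] [u [p [ub E]]] [u' [p' [u'b E']]].
pose r i := (u' * q) * p i + (w * u) * p' i.
have wu : (w * u * u').[b%:R] != 0 by rewrite !hornerM !mulf_neq0.
have Er : (w * u * u')%:F *: (c *: x + y) = ecomb r.
  rewrite ecombL [ecomb (fun _ => _ * _)]ecombZ -E -E' scalerDr !scalerA.
  rewrite !tofracM -Ec; congr (_ *: _ + _ *: _); ring.
split; first by exists (w * u * u'), r.
rewrite (specE wu Er) (specE ub E) (specE u'b E') (germ_valE wb Ec).
rewrite acombL acombZ !hornerM scalerDr !scalerA; congr (_ *: _ + _ *: _).
  by field; rewrite ub u'b wb.
by field; rewrite ub u'b wb.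
Qed.

Lemma lat0 b d : lat b (0 : AK d).
Proof.
by exists 1, (fun=> 0); rewrite hornerC oner_neq0 ecomb0 scaler0.
Qed.

Lemma spec0 b d : spec b (0 : AK d) = 0.
Proof.
rewrite (@specE b d 0 1 (fun=> 0)) ?acomb0 ?scaler0 //.
  by rewrite hornerC oner_neq0.
by rewrite ecomb0.
Qed.

Lemma lat_ecomb b d (p : I d -> {poly k}) :
  lat b (ecomb p) /\ spec b (ecomb p) = acomb b p.
Proof.
have h : (1 : {poly k}).[b%:R] != 0 by rewrite hornerC oner_neq0.
have E : 1%:F *: ecomb p = ecomb p by rewrite rmorph1 scale1r.
by split; [exists 1, p|rewrite (specE h E) hornerC invr1 scale1r].
Qed.

Lemma mul_ecomb i j l (E : (i + j)%N = l) (p : I i -> {poly k})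
    (q : I j -> {poly k}) : exists r,
  gmul E (ecomb p) (ecomb q) = ecomb r /\
  forall b, gmul E (acomb b p) (acomb b q) = acomb b r.
Proof.
(* [rel X Y] says that X and all [Y b] come from the same polynomial coefficients, a condition
   stable under combinations over k[t]. *)
pose rel (X : AK l) (Y : forall b, A b l) :=
  exists r, X = ecomb r /\ forall b, Y b = acomb b r.
have rel0 : rel 0 (fun=> 0).
  by exists (fun=> 0); rewrite ecomb0; split=> // b; rewrite acomb0.
have relL c X X' Y Y' : rel X Y -> rel X' Y' ->
    rel (c%:F *: X + X') (fun b => c.[b%:R] *: Y b + Y' b).
  move=> [r [-> Er]] [r' [-> Er']]; exists (fun i => c * r i + r' i).
  by rewrite ecombL; split=> // b; rewrite acombL Er Er'.
have rel_sum T (s : seq T) (c : T -> {poly k}) X Y : (forall t, rel (X t) (Y t)) ->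
    rel (\sum_(t <- s) (c t)%:F *: X t) (fun b => \sum_(t <- s) (c t).[b%:R] *: Y t b).
  move=> h; elim: s => [|t s IH].
    by case: rel0 => r [r1 r2]; exists r; rewrite big_nil; split=> // b; rewrite big_nil.
  have [r [r1 r2]] := relL (c t) _ _ _ _ (h t) IH; exists r; rewrite big_cons.
  by split=> // b; rewrite big_cons.
have [r [r1 r2]] : rel (gmul E (ecomb p) (ecomb q)) (fun b => gmul E (acomb b p) (acomb b q)).
  have -> : (fun b => gmul E (acomb b p) (acomb b q)) = fun b =>
      \sum_a (p a).[b%:R] *: \sum_c (q c).[b%:R] *: gmul E (al b a) (al b c).
    apply: functional_extensionality_dep => b.
    rewrite gmul_suml; apply: eq_bigr => a _; rewrite gmulZl gmul_sumr; congr (_ *: _).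
    by apply: eq_bigr => c _; rewrite gmulZr.
  have -> : gmul E (ecomb p) (ecomb q) =
      \sum_a (p a)%:F *: \sum_c (q c)%:F *: gmul E (e a) (e c).
    rewrite gmul_suml; apply: eq_bigr => a _; rewrite gmulZl gmul_sumr; congr (_ *: _).
    by apply: eq_bigr => c _; rewrite gmulZr.
  apply: (rel_sum) => a; apply: (rel_sum) => c; exact: mul_e.
by exists r.
Qed.

Lemma latM b i j l (E : (i + j)%N = l) (x : AK i) (y : AK j) :
  lat b x -> lat b y ->
  lat b (gmul E x y) /\ spec b (gmul E x y) = gmul E (spec b x) (spec b y).
Proof.
move=> [u [p [ub Ex]]] [u' [p' [u'b Ey]]].
have [r [r1 r2]] := mul_ecomb E p p'.
have uu : (u * u').[b%:R] != 0 by rewrite hornerM mulf_neq0.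
have Er : (u * u')%:F *: gmul E x y = ecomb r.
  by rewrite -r1 -Ex -Ey gmulZl gmulZr scalerA rmorphM.
split; first by exists (u * u'), r.
rewrite (specE uu Er) (specE ub Ex) (specE u'b Ey) -r2 gmulZl gmulZr scalerA.
by rewrite hornerM invfM.
Qed.

Lemma lat_one b : lat b (gone AK) /\ spec b (gone AK) = gone (A b).
Proof.
by have [p [-> ->]] := one_e; exact: lat_ecomb.
Qed.

Lemma spec_surj b d (a : A b d) : exists x, lat b x /\ spec b x = a.
Proof.
have [c ->] := span_al a; exists (ecomb (fun i => (c i)%:P)).
have [h ->] := lat_ecomb b (fun i => (c i)%:P); split=> //.
by apply: eq_bigr => i _; rewrite hornerC.
Qed.

Lemma spec_ker b d (x : AK d) : lat b x -> spec b x = 0 ->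
  exists y, lat b y /\ x = (tau b)%:F *: y.
Proof.
move=> [u [p [ub E]]]; rewrite (specE ub E) => /eqP.
rewrite scaler_eq0 invr_eq0 (negbTE ub) => /eqP /ker_e [p' E'].
have u0 : u%:F != 0 by rewrite tofrac_eq0 (neq0_horner ub).
exists (u%:F^-1 *: ecomb p'); split.
  by exists u, p'; rewrite scalerA mulfV // scale1r.
by rewrite scalerA mulrC -scalerA -E' -E scalerA mulVf // scale1r.
Qed.

(** A basis of the special fiber chosen among the spanning elements, as a spanning subset of least
    cardinality. *)
Lemma min_span b d : exists B : {set I d},
  (forall j, exists c : I d -> k, al b j = \sum_(i in B) c i *: al b i) /\
  (forall c : I d -> k, \sum_(i in B) c i *: al b i = 0 ->
     forall i, i \in B -> c i = 0).
Proof.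
pose sp (B : {set I d}) :=
  `[< forall j, exists c : I d -> k, al b j = \sum_(i in B) c i *: al b i >].
have spT : sp [set: I d]%SET.
  apply/asboolP => j; exists (fun i => (i == j)%:R).
  rewrite (bigD1 j) ?inE //= eqxx scale1r big1 ?addr0 // => i /andP [_ /negbTE ->].
  by rewrite scale0r.
case: (arg_minnP (fun B : {set I d} => #|B|) spT) => B /asboolP spB minB.
exists B; split=> // c c0 i0 Bi0; apply/eqP; apply: contraT => ci0.
have : sp (B :\ i0).
  apply/asboolP => j; have [c' ->] := spB j.
  exists (fun i => c' i - c' i0 * (c i / c i0)).
  have e0 : al b i0 = - \sum_(i in B :\ i0) (c i / c i0) *: al b i.
    apply: (scalerI ci0); move/eqP: c0; rewrite (big_setD1 i0) //= addr_eq0 => /eqP ->.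
    rewrite scalerN scaler_sumr; congr (- _); apply: eq_bigr => i _.
    by rewrite scalerA mulrCA mulfV // mulr1.
  rewrite (big_setD1 i0) //= e0 scalerN scaler_sumr addrC -sumrB.
  by apply: eq_bigr => i _; rewrite scalerA -scalerBl.
by move=> /minB; rewrite leqNgt [X in (_ < X)%N](cardsD1 i0) Bi0 ltnSn.
Qed.

(** A relation over k[t] specializes to one over k, which is trivial; so all its coefficients are
    divisible by t - b, and dividing lowers their sizes. *)
Lemma ecomb_free b d (B : {set I d}) :
  (forall c : I d -> k, \sum_(i in B) c i *: al b i = 0 ->
     forall i, i \in B -> c i = 0) ->
  forall p : I d -> {poly k}, \sum_(i in B) (p i)%:F *: e i = 0 ->
    forall i, i \in B -> p i = 0.
Proof.
move=> freeB p; have [N] : exists N, forall i, i \in B -> (size (p i) <= N)%N.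
  by exists (\max_i size (p i)) => i _; exact: leq_bigmax.
elim: N p => [|N IH] p pN p0.
  by move=> i /pN; rewrite leqn0 size_poly_eq0 => /eqP.
have pb i : i \in B -> (p i).[b%:R] = 0.
  apply: (freeB (fun i => (p i).[b%:R])); pose q i := if i \in B then p i else 0.
  have <- : acomb b q = \sum_(i in B) (p i).[b%:R] *: al b i.
    rewrite /acomb [RHS]big_mkcond; apply: eq_bigr => j _; rewrite /q.
    by case: ifP => // _; rewrite horner0 scale0r.
  apply: spec_e; rewrite -[RHS]p0 /ecomb [RHS]big_mkcond; apply: eq_bigr => j _.
  by rewrite /q; case: ifP => // _; rewrite rmorph0 scale0r.
have /choice [p' pE] i : exists p', i \in B -> p i = tau b * p'.
  case Bi: (i \in B); last by exists 0.
  by have [p' ->] := factor_tau (pb i Bi); exists p'.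
have p'0 := IH p' _ _; move=> i Bi; rewrite pE // p'0 ?mulr0 // {i Bi}.
  move=> i Bi; have := pN i Bi; rewrite pE //.
  have [->|nz] := eqVneq (p' i) 0; first by rewrite size_poly0.
  by rewrite mulrC size_Mmonic ?monicXsubC // size_XsubC addn2.
have tF : (tau b)%:F != 0 by rewrite tofrac_eq0 tau_neq0.
apply: (scalerI tF); rewrite scaler0 -[RHS]p0 scaler_sumr; apply: eq_bigr => i Bi.
by rewrite scalerA pE // tofracM.
Qed.

(** Nakayama's lemma by the determinant trick. Modulo t - b the e j are combinations of those
    indexed by B; the matrix M = 1 - (t - b) D of the errors has determinant 1 at b, and its
    adjugate solves for the e j. *)
Lemma ecomb_span b d (B : {set I d}) :
  (forall j, exists c : I d -> k, al b j = \sum_(i in B) c i *: al b i) ->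
  exists (u : {poly k}) (p : I d -> I d -> {poly k}), u.[b%:R] != 0 /\
    forall j, u%:F *: e j = \sum_(i in B) (p j i)%:F *: e i.
Proof.
move=> /choice [c cE].
have /choice [D DE] j : exists D : I d -> {poly k},
    e j = \sum_(i in B) (c j i)%:P%:F *: e i + (tau b)%:F *: ecomb D.
  pose p i : {poly k} := (i == j)%:R - (if i \in B then (c j i)%:P else 0).
  have [|D pD] := @ker_e b d p.
    have -> : acomb b p = al b j - \sum_(i in B) c j i *: al b i; last first.
      by rewrite -cE subrr.
    rewrite /acomb [X in _ - X]big_mkcond (bigD1 j) //= [X in _ - X](bigD1 j) //=.
    rewrite opprD addrA; congr (_ + _).
      rewrite /p eqxx hornerD hornerN hornerC scalerBl scale1r; congr (_ - _).
      by case: ifP; rewrite ?hornerC ?scale0r.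
    rewrite -sumrN; apply: eq_bigr => i /negbTE ij; rewrite /p ij sub0r hornerN scaleNr.
    by case: ifP; rewrite ?hornerC ?scale0r.
  exists D; rewrite -pD; apply/eqP; rewrite addrC -subr_eq eq_sym; apply/eqP.
  rewrite /ecomb [X in _ - X]big_mkcond (bigD1 j) //= [X in _ - X](bigD1 j) //=.
  rewrite opprD addrA; congr (_ + _).
    rewrite /p eqxx rmorphB rmorph1 scalerBl scale1r; congr (_ - _).
    by case: ifP; rewrite ?rmorph0 ?scale0r.
  rewrite -sumrN; apply: eq_bigr => i /negbTE ij; rewrite /p ij sub0r rmorphN scaleNr.
  by case: ifP; rewrite ?rmorph0 ?scale0r.
pose M : 'M[{poly k}]_(#|I d|) :=
  \matrix_(i, j) ((i == j)%:R - tau b * D (enum_val i) (enum_val j)).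
exists (\det M), (fun j i => \sum_l \adj M (enum_rank j) l * (c (enum_val l) i)%:P).
split.
  have -> : (\det M).[b%:R] = \det (map_mx (horner_eval b%:R) M).
    by rewrite det_map_mx.
  suff -> : map_mx (horner_eval b%:R) M = 1%:M by rewrite det1 oner_neq0.
  apply/matrixP => i j; rewrite !mxE /= /horner_eval hornerD hornerN hornerM.
  rewrite !hornerE subrr mul0r subr0 -polyC_natr hornerC; by case: eqP.
move=> j; pose v l := \sum_(i in B) (c l i)%:P%:F *: e i.
have vE l : v (enum_val l) = \sum_l' (M l l')%:F *: e (enum_val l').
  have -> : v (enum_val l) = e (enum_val l) - (tau b)%:F *: ecomb (D (enum_val l)).
    by rewrite [X in X - _]DE addrK.
  have Ml : (M l l)%:F = 1 - (tau b)%:F * (D (enum_val l) (enum_val l))%:F.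
    by rewrite mxE eqxx [LHS]tofracB tofracM tofrac1.
  rewrite (bigD1 l) //= Ml scalerBl scale1r -addrA; congr (_ + _).
  rewrite /ecomb (reindex (@enum_val _ (I d))); last first.
    by exists enum_rank => i _; rewrite ?enum_valK ?enum_rankK.
  rewrite (bigD1 l) //= scalerDr opprD scalerA; congr (_ + _).
  rewrite scaler_sumr -sumrN; apply: eq_bigr => i /negbTE il.
  by rewrite mxE eq_sym il sub0r tofracN scaleNr scalerA tofracM.
transitivity (\sum_l (\adj M (enum_rank j) l)%:F *: v (enum_val l)).
  have -> : \sum_l (\adj M (enum_rank j) l)%:F *: v (enum_val l) =
      \sum_l' ((\adj M *m M) (enum_rank j) l')%:F *: e (enum_val l').
    under eq_bigr => l _ do rewrite vE scaler_sumr.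
    rewrite exchange_big; apply: eq_bigr => l' _ /=; rewrite mxE rmorph_sum scaler_suml.
    by apply: eq_bigr => l _; rewrite scalerA -tofracM.
  rewrite mul_adj_mx (bigD1 (enum_rank j)) //= mxE eqxx mulr1n enum_rankK big1 ?addr0 //.
  by move=> i /negbTE ij; rewrite mxE eq_sym ij mulr0n rmorph0 scale0r.
under eq_bigr => l _ do rewrite scaler_sumr.
rewrite exchange_big; apply: eq_bigr => i _ /=; rewrite rmorph_sum scaler_suml.
by apply: eq_bigr => l _; rewrite scalerA -tofracM.
Qed.

(** The elements that lift a basis of the special fiber at b form a basis both of the localized
    lattice, by [ecomb_span], and of the generic fiber, by [ecomb_free]. *)
Lemma lat_basis b d : exists r (be : 'I_r -> AK d),
  [/\ forall t, lat b (be t),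
      forall x, exists c : 'I_r -> K, x = \sum_t c t *: be t /\
        (lat b x -> forall t, regular b (c t)) &
      forall c : 'I_r -> K, \sum_t c t *: be t = 0 -> forall t, c t = 0].
Proof.
have [B [spB frB]] := min_span b d.
have [u [p [ub upE]]] := ecomb_span spB.
have uF : u%:F != 0 by rewrite tofrac_eq0 (neq0_horner ub).
have xE (c : I d -> K) : \sum_j c j *: e j =
    \sum_(t < #|B|) (\sum_j c j * (p j (enum_val t))%:F / u%:F) *: e (enum_val t).
  rewrite -(big_enum_val (fun i => (\sum_j c j * (p j i)%:F / u%:F) *: e i)).
  under [RHS]eq_bigr do rewrite scaler_suml.
  rewrite exchange_big; apply: eq_bigr => j _ /=; apply: (scalerI uF).
  rewrite scalerA mulrC -scalerA upE !scaler_sumr; apply: eq_bigr => i _.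
  rewrite !scalerA; congr (_ *: _); by rewrite [RHS]mulrC divfK.
exists #|B|, (fun t => e (enum_val t)); split.
- move=> t; have -> : e (enum_val t) = ecomb (fun i => (i == enum_val t)%:R).
    rewrite /ecomb (bigD1 (enum_val t)) //= eqxx rmorph1 scale1r big1 ?addr0 //.
    by move=> i /negbTE ->; rewrite rmorph0 scale0r.
  exact: (lat_ecomb _ _).1.
- move=> x; have [[w [q [wb E]]]|nl] := pselect (lat b x); last first.
    have [c xc] := span_e x; exists (fun t => \sum_j c j * (p j (enum_val t))%:F / u%:F).
    by split=> [|/nl //]; rewrite {1}xc; exact: xE.
  have wF : w%:F != 0 by rewrite tofrac_eq0 (neq0_horner wb).
  have -> : x = \sum_j ((q j)%:F / w%:F) *: e j.
    apply: (scalerI wF); rewrite E scaler_sumr; apply: eq_bigr => j _.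
    by rewrite scalerA mulrC divfK.
  exists (fun t => \sum_j (q j)%:F / w%:F * (p j (enum_val t))%:F / u%:F).
  split=> [|_ t]; first exact: xE.
  elim/big_ind: _ => [|f g rf rg|j _]; first exact: regular0.
    exact: (regularD rf rg).1.
  exists (w * u), (q j * p j (enum_val t)); split; first by rewrite hornerM mulf_neq0.
  rewrite (tofracM w u) (tofracM (q j)).
  exact (mulf_cancel2 _ _ wF uF).
move=> c c0 t; have [v [q [v0 qE]]] := common_denominator c.
have vF : v%:F != 0 by rewrite tofrac_eq0.
pose q' i := if i \in B =P true is ReflectT Bi then q (enum_rank_in Bi i) else 0.
have q'E t' : q' (enum_val t') = q t'.
  rewrite /q'; case: eqP => [Bi|]; last by rewrite enum_valP.
  by rewrite enum_valK_in.
have := ecomb_free frB (p := q') _ (enum_valP t).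
rewrite q'E => qt; apply: (mulfI vF); rewrite qE mulr0 qt ?rmorph0 //.
transitivity (v%:F *: \sum_t c t *: e (enum_val t)); last by rewrite c0 scaler0.
rewrite (big_enum_val (fun i => (q' i)%:F *: e i)).
by rewrite scaler_sumr; apply: eq_bigr => s _; rewrite q'E scalerA qE.
Qed.

Definition lat_pred (W : opens germ_pt) d : pred (AK d) := fun x =>
  `[< (~ W None -> x = 0) /\ forall b, W (Some b) -> lat b x >].

Lemma lat_zmod W d : zmod_closed (@lat_pred W d).
Proof.
split=> [|x y /asboolP [x0 lx] /asboolP [y0 ly]]; apply/asboolP.
  by split=> // b _; exact: lat0.
split=> [h|b Wb]; first by rewrite x0 // y0 // subr0.
rewrite addrC -scaleN1r; apply: (latL _ _ _).1; [|exact: ly|exact: lx].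
exact/regularN/regular1.
Qed.
HB.instance Definition _ W d :=
  GRing.isZmodClosed.Build (AK d) (@lat_pred W d) (lat_zmod W d).
Record lsect W d := LSect { lval : AK d; _ : @lat_pred W d lval }.
HB.instance Definition _ W d := [isSub for @lval W d].
HB.instance Definition _ W d := [Choice of lsect W d by <:].
HB.instance Definition _ W d := [SubChoice_isSubZmodule of lsect W d by <:].

Lemma lsectP W d (s : lsect W d) :
  (~ W None -> lval s = 0) /\ forall b, W (Some b) -> lat b (lval s).
Proof. by apply/asboolP; case: s. Qed.

Lemma lat_regZ b d f (x : AK d) : regular b f -> lat b x ->
  lat b (f *: x) /\ spec b (f *: x) = germ_val b f *: spec b x.
Proof.
move=> rf lx; rewrite -[f *: x]addr0; have [l ->] := latL rf lx (lat0 b d).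
by split; [exact: l|rewrite spec0 addr0].
Qed.

Lemma lsect_scale_subproof W d (f : germ_sect k W) (s : lsect W d) :
  lat_pred W (germ_fun f *: lval s).
Proof.
apply/asboolP; split=> [w|b Wb]; first by rewrite (lsectP s).1 ?scaler0.
by apply: (lat_regZ _ _).1; [apply: (germ_sectP f).2|apply: (lsectP s).2].
Qed.
Definition lsect_scale W d f s : lsect W d := LSect (lsect_scale_subproof f s).

Lemma germ_unit_lsect W d (s : lsect W d) : germ_unit k W *: lval s = lval s.
Proof.
have [w|w] := pselect (W None); first by rewrite (germ_unit1 k w) scale1r.
by rewrite (lsectP s).1 // scaler0.
Qed.

Lemma lsect_scaleA W d f g (s : lsect W d) :
  lsect_scale f (lsect_scale g s) = lsect_scale (f * g) s.
Proof. by apply: val_inj; rewrite /= scalerA. Qed.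
Lemma lsect_scale1 W d : left_id 1 (@lsect_scale W d).
Proof. by move=> s; apply: val_inj; rewrite /= germ_unit_lsect. Qed.
Lemma lsect_scaleDr W d : right_distributive (@lsect_scale W d) +%R.
Proof. by move=> f s t; apply: val_inj; rewrite /= scalerDr. Qed.
Lemma lsect_scaleDl W d s : {morph (@lsect_scale W d)^~ s : f g / f + g}.
Proof. by move=> f g; apply: val_inj; rewrite /= scalerDl. Qed.
HB.instance Definition _ W d := GRing.Zmodule_isLmodule.Build (germ_sect k W)
  (lsect W d) (@lsect_scaleA W d) (@lsect_scale1 W d) (@lsect_scaleDr W d)
  (@lsect_scaleDl W d).

Lemma lvalZ W d (f : germ_sect k W) (s : lsect W d) :
  lval (f *: s) = germ_fun f *: lval s.
Proof. by []. Qed.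
Lemma lval_sum W d (T : Type) (r : seq T) (F : T -> lsect W d) :
  lval (\sum_(t <- r) F t) = \sum_(t <- r) lval (F t).
Proof. by apply: (big_morph (@lval W d)). Qed.

Lemma lsect_restr_subproof (W : opens germ_pt) d (x : AK d) :
  (forall b, W (Some b) -> lat b x) -> lat_pred W (germ_unit k W *: x).
Proof.
move=> lx; apply/asboolP; split=> [w|b Wb]; first by rewrite germ_unit0 ?scale0r.
by rewrite (germ_unit1 k Wb) scale1r; exact: lx.
Qed.
Definition lsect_of (W : opens germ_pt) d (x : AK d)
  (lx : forall b, W (Some b) -> lat b x) := LSect (lsect_restr_subproof lx).

Definition lsect_res d (W W' : opens germ_pt) (h : (W' `<=` W)%classic)
    (s : lsect W d) : lsect W' d :=
  lsect_of (fun b w => (lsectP s).2 b (h _ w)).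

Lemma lsect_mul_subproof W i j l (E : (i + j)%N = l) (s : lsect W i) (t : lsect W j) :
  lat_pred W (gmul E (lval s) (lval t)).
Proof.
apply/asboolP; split=> [w|b Wb]; first by rewrite (lsectP s).1 ?gmul0l.
by apply: (latM _ _ _).1; apply: (lsectP _).2.
Qed.
Definition lsect_mul W i j l E s t : lsect W l := LSect (@lsect_mul_subproof W i j l E s t).

(** The smallest open neighbourhood of the closed point b, on which sections only have to be regular
    at b. *)
Definition germ_nbhs b : opens germ_pt.
Proof.
exists [set x | x = None \/ x = Some b]%classic.
by rewrite germ_openE => x _; left.
Defined.

Lemma lsect_sheaf d : is_sheaf (fun W W' h => @lsect_res d W W' h).
Proof.
apply: (@germ_sheaf (AK d) (fun W => lsect W d) (fun W => @lval W d)
  (fun W => @lat_pred W d)).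
- by move=> W; exact: val_inj.
- by move=> W; case.
- by move=> W v Pv; exists (LSect Pv).
- move=> W v; split=> [/asboolP [v0 vr]|[v0 vr]].
    split=> // b Wb; exists W => //; apply/asboolP; split=> //.
  apply/asboolP; split=> // b Wb; have [W' W'b /asboolP [_]] := vr b Wb.
  exact.
by move=> W W' h s; rewrite /= /germ_unit; case: ifP; rewrite ?scale1r ?scale0r.
Qed.

Lemma lsect_locally_free d (x : germ_pt) :
  exists (W : opens germ_pt) (r : nat) (be : 'I_r -> lsect W d),
    W x /\ forall (W' : opens germ_pt) (h : (W' `<=` W)%classic) (s : lsect W' d),
      exists! c : 'I_r -> germ_sect k W', s = \sum_i c i *: lsect_res h (be i).
Proof.
have [b xb] : exists b, germ_nbhs b x.
  by case: x => [b|]; [exists b; right|exists true; left].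
have [r [be [be_lat be_span be_free]]] := lat_basis b d.
have bl t b' : germ_nbhs b (Some b') -> lat b' (be t) by case=> // -[->].
exists (germ_nbhs b), r, (fun t => lsect_of (bl t)); split=> //.
move=> W' h s.
have sumE (c : 'I_r -> germ_sect k W') :
    lval (\sum_i c i *: lsect_res h (lsect_of (bl i))) = \sum_i germ_fun (c i) *: be i.
  rewrite lval_sum; apply: eq_bigr => i _.
  rewrite lvalZ /= !scalerA germ_unitM // mulrC.
  by rewrite germ_unit_sect.
have [w|w] := pselect (W' None); last first.
  exists (fun=> 0); split=> [|c _].
    by apply: val_inj; rewrite /= sumE big1 ?(lsectP s).1 // => i _; rewrite scale0r.
  apply: functional_extensionality_dep => i; apply: val_inj.
  by rewrite /= (germ_sectP (c i)).1.
have [c [cE creg]] := be_span (lval s).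
have cr t : germ_sect_pred W' (germ_unit k W' * c t).
  apply: germ_restr_subproof => b' W'b'.
  have lb := (lsectP s).2 _ W'b'; case: (h _ W'b') => // -[e1]; subst b'.
  exact: creg.
exists (fun t => GermSect (cr t)); split.
  apply: val_inj; rewrite /= sumE {1}cE; apply: eq_bigr => t _.
  by rewrite /= (germ_unit1 k w) mul1r.
move=> c' c'E; apply: functional_extensionality_dep => t; apply: val_inj.
rewrite /= (germ_unit1 k w) mul1r; apply/eqP; rewrite -subr_eq0; apply/eqP.
move: t; apply: (be_free (fun t => c t - germ_fun (c' t))).
under eq_bigr do rewrite scalerBl.
by rewrite sumrB -cE {1}c'E sumE subrr.
Qed.

Definition germ_family : flat_family (germ_scheme k).
Proof.
refine (@FlatFamily k (germ_scheme k) (fun d W => lsect W d)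
  (fun d W W' h => @lsect_res d W W' h) _ _ _ (fun d => @lsect_sheaf d)
  lsect_locally_free
  (fun W => lsect_of (fun b _ => (lat_one b).1))
  (fun W i j l E => @lsect_mul W i j l E) _ _ _ _ _ _ _).
- move=> d W W' h f s t; apply: val_inj => /=.
  by rewrite scalerDr !scalerA; congr (_ *: _ + _); rewrite [RHS]mulrAC germ_unitM.
- by move=> d W h s; apply: val_inj; rewrite /= germ_unit_lsect.
- by move=> d W W' W'' h h' h'' s; apply: val_inj; rewrite /= scalerA germ_unitM.
- by move=> W W' h; apply: val_inj; rewrite /= scalerA germ_unitM.
- move=> W W' h i j l E s t; apply: val_inj => /=.
  by rewrite gmulZl gmulZr scalerA germ_unitM.
- by move=> W i j l E f s s' t; apply: val_inj; rewrite /= gmulDl.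
- by move=> W i j l E f s t t'; apply: val_inj; rewrite /= gmulDr.
- by move=> W i E s; apply: val_inj; rewrite /= gmulZl gmul1l germ_unit_lsect.
- by move=> W i E s; apply: val_inj; rewrite /= gmulZr gmul1r germ_unit_lsect.
move=> W a b c ab bc d e1 e2 e3 e4 s t u; apply: val_inj => /=; exact: gmulA.
Defined.

(** The map to the fiber is [spec]; by [spec_ker] its kernel is generated by the single function t -
    b. *)
Lemma germ_family_fiber b : is_fiber germ_family (germ_kpoint k b) (A b).
Proof.
exists (fun d W hx s => spec b (lval s)); split.
- move=> d W hx f s t /=.
  by rewrite (latL ((germ_sectP f).2 _ hx) ((lsectP s).2 _ hx) ((lsectP t).2 _ hx)).2.
- by move=> d W W' h hx hx' s /=; rewrite (germ_unit1 k hx') scale1r.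
- split=> [W hx|W hx i j l E s t] /=.
    by rewrite (germ_unit1 k hx) scale1r (lat_one b).2.
  by rewrite (latM E ((lsectP s).2 _ hx) ((lsectP t).2 _ hx)).2.
- move=> d a; have [x [lx <-]] := spec_surj a.
  have bl b' : germ_nbhs b (Some b') -> lat b' x by case=> // -[->].
  have hx : germ_nbhs b (Some b) by right.
  exists (germ_nbhs b), hx, (lsect_of bl) => /=.
  by rewrite (germ_unit1 k hx) scale1r.
move=> d W hx s s0.
have [y [ly yE]] := spec_ker ((lsectP s).2 _ hx) s0.
have h : (germ_nbhs b `<=` W)%classic by move=> x [] ->; [exact: germ_opens hx|].
have bl b' : germ_nbhs b (Some b') -> lat b' y by case=> // -[->].
have hx' : germ_nbhs b (Some b) by right.
have tr b' : germ_nbhs b (Some b') -> regular b' (tau b)%:F.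
  by move=> _; exact: regular_tofrac.
exists (germ_nbhs b), h, hx', 1%N, (fun=> GermSect (germ_restr_subproof tr)), (fun=> lsect_of bl).
split=> [_|].
  rewrite /= /germ_ev /= (germ_unit1 k hx') mul1r germ_val_tofrac.
  by rewrite !hornerE subrr.
rewrite big_ord1; apply: val_inj => /=.
by rewrite yE !scalerA mulrAC germ_unitM // mulrC mulrC.
Qed.

Theorem span_family : fibers_of_one_family (A false) (A true).
Proof.
exists (germ_scheme k), germ_family, (germ_kpoint k false), (germ_kpoint k true).
by split; [exact: germ_connected|exact: germ_family_fiber|exact: germ_family_fiber].
Qed.

End SpanFamily.

(** * Families given by structure constants *)

Section StructureConstants.
Variables (R : comNzRingType) (I : nat -> finType).
Variables (gam : forall i j l, I i -> I j -> I l -> R) (ups : I 0 -> R).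

(** The algebra axioms in coordinates, [ups] being those of the unit. The degrees are constrained in
    the laws only, so that [gam] carries no proof of i + j = l. *)
Definition sc_axioms : Prop :=
  [/\ forall i (a x : I i), \sum_z ups z * gam z a x = (a == x)%:R,
      forall i (a x : I i), \sum_z ups z * gam a z x = (a == x)%:R &
      forall i j l ij jl d, (i + j)%N = ij -> (ij + l)%N = d ->
        (j + l)%N = jl -> (i + jl)%N = d ->
      forall (a : I i) (b : I j) (c : I l) (x : I d),
        \sum_(z : I ij) gam a b z * gam z c x =
        \sum_(z : I jl) gam b c z * gam a z x].

End StructureConstants.

Definition has_sc (F : fieldType) (I : nat -> finType) (A : galg F)
    (gam : forall i j l, I i -> I j -> I l -> F) (ups : I 0 -> F) : Prop :=
  exists al : forall d, I d -> A d,
  [/\ forall d (x : A d), exists c : I d -> F, x = \sum_i c i *: al d i,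
      forall d (c : I d -> F), \sum_i c i *: al d i = 0 -> forall i, c i = 0,
      forall i j l (E : (i + j)%N = l) a b,
        gmul E (al i a) (al j b) = \sum_x gam i j l a b x *: al l x &
      gone A = \sum_z ups z *: al 0 z].

Lemma sum4C (V : nmodType) (I1 I2 I3 I4 : finType) (T : I1 -> I2 -> I3 -> I4 -> V) :
  \sum_z \sum_c \sum_a \sum_b T z c a b = \sum_a \sum_b \sum_c \sum_z T z c a b.
Proof.
transitivity (\sum_z \sum_a \sum_c \sum_b T z c a b).
  by apply: eq_bigr => z _; rewrite exchange_big.
rewrite exchange_big; apply: eq_bigr => a _ /=.
transitivity (\sum_z \sum_b \sum_c T z c a b).
  by apply: eq_bigr => z _; rewrite exchange_big.
by rewrite exchange_big; apply: eq_bigr => b _ /=; rewrite exchange_big.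
Qed.

Section ScGalg.
Variables (F : fieldType) (I : nat -> finType).
Variables (gam : forall i j l, I i -> I j -> I l -> F) (ups : I 0 -> F).
Hypothesis ax : sc_axioms gam ups.

Definition sc_comp d : lmodType F := {ffun I d -> F^o}.
Definition sc_one : sc_comp 0 := [ffun z => ups z].
Definition sc_mul i j l (E : (i + j)%N = l) (f : sc_comp i) (g : sc_comp j) :
  sc_comp l := [ffun x => \sum_a \sum_b (f a * g b : F) * gam a b x].

Lemma sum_delta (T : finType) (S : pzSemiRingType) (x : T) (G : T -> S) :
  \sum_a G a * (a == x)%:R = G x.
Proof.
rewrite (bigD1 x) //= eqxx mulr1 big1 ?addr0 // => a /negbTE ->.
by rewrite mulr0.
Qed.

Definition sc_galg : galg F.
Proof.
refine (@Galg F sc_comp sc_one sc_mul _ _ _ _ _).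
- move=> i j l E c f f' g; apply/ffunP=> x; rewrite !ffunE /GRing.scale /=.
  rewrite mulr_sumr -big_split; apply: eq_bigr => a _ /=.
  rewrite mulr_sumr -big_split; apply: eq_bigr => b _ /=.
  by rewrite !ffunE /GRing.scale /=; ring.
- move=> i j l E c f g g'; apply/ffunP=> x; rewrite !ffunE /GRing.scale /=.
  rewrite mulr_sumr -big_split; apply: eq_bigr => a _ /=.
  rewrite mulr_sumr -big_split; apply: eq_bigr => b _ /=.
  by rewrite !ffunE /GRing.scale /=; ring.
- have [ax1 _ _] := ax.
  move=> i E f; apply/ffunP=> x; rewrite !ffunE exchange_big /=.
  rewrite -[RHS](sum_delta x (f : I i -> F)); apply: eq_bigr => a _.
  rewrite -ax1 mulr_sumr; apply: eq_bigr => z _; rewrite ffunE; ring.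
- have [_ ax2 _] := ax; move=> i E f; apply/ffunP=> x; rewrite !ffunE.
  rewrite -[RHS](sum_delta x (f : I i -> F)); apply: eq_bigr => a _.
  rewrite -ax2 mulr_sumr; apply: eq_bigr => z _; rewrite ffunE; ring.
have [_ _ axA] := ax; move=> i j l ij jl d e1 e2 e3 e4 f g h; apply/ffunP=> x; rewrite !ffunE.
transitivity (\sum_a \sum_b \sum_c \sum_(z : I ij)
    (f a * g b * h c : F) * (gam a b z * gam z c x)).
  rewrite -sum4C; apply: eq_bigr => z _; apply: eq_bigr => c _; rewrite ffunE.
  rewrite !mulr_suml; apply: eq_bigr => a _; rewrite !mulr_suml.
  by apply: eq_bigr => b _; ring.
apply: eq_bigr => a _.
transitivity (\sum_(z : I jl) \sum_b \sum_c
    (f a * g b * h c : F) * (gam b c z * gam a z x)).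
  rewrite [RHS]exchange_big; apply: eq_bigr => b _ /=.
  rewrite [RHS]exchange_big; apply: eq_bigr => c _ /=.
  by rewrite -!mulr_sumr (axA _ _ _ ij jl d).
apply: eq_bigr => z _; rewrite ffunE mulr_sumr mulr_suml; apply: eq_bigr => b _.
by rewrite mulr_sumr mulr_suml; apply: eq_bigr => c _; ring.
Defined.

Lemma sc_delta_sum d (x : sc_comp d) :
  x = \sum_i (x i : F) *: ([ffun y => (y == i)%:R] : sc_comp d).
Proof.
apply/ffunP => y; rewrite sum_ffunE (bigD1 y) //= !ffunE eqxx.
rewrite big1 ?addr0 => [|i /negbTE iy]; first by rewrite /GRing.scale /= mulr1.
by rewrite !ffunE eq_sym iy scaler0.
Qed.

Lemma sc_galg_has_sc : has_sc sc_galg gam ups.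
Proof.
exists (fun d i => [ffun y => (y == i)%:R] : sc_comp d); split.
- by move=> d x; exists x; exact: sc_delta_sum.
- move=> d c c0 i; have := congr1 (fun f : sc_comp d => f i) c0.
  have {1}-> : \sum_i c i *: ([ffun y => (y == i)%:R] : sc_comp d) =
      [ffun y => c y] :> sc_comp d.
    rewrite [RHS]sc_delta_sum; apply: eq_bigr => j _; by rewrite ffunE.
  by rewrite !ffunE.
- move=> i j l E a b; apply/ffunP => x.
  rewrite sum_ffunE ffunE (bigD1 a) //= [X in _ + X]big1 ?addr0; last first.
    by move=> a' /negbTE a'a; rewrite big1 // => b' _; rewrite !ffunE a'a !mul0r.
  rewrite (bigD1 b) //= big1 ?addr0; last first.
    by move=> b' /negbTE b'b; rewrite !ffunE b'b mulr0 mul0r.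
  rewrite !ffunE !eqxx !mul1r (bigD1 x) //= !ffunE eqxx big1 ?addr0.
    by rewrite /GRing.scale /= mulr1.
  by move=> y /negbTE yx; rewrite !ffunE eq_sym yx scaler0.
by rewrite [LHS]sc_delta_sum; apply: eq_bigr => z _; rewrite ffunE.
Qed.

End ScGalg.

(** Associativity of an algebra already constructed becomes identities between constants, which
    [rees_family] homogenizes. *)
Lemma sc_axioms_of (F : fieldType) (I : nat -> finType) (A : galg F)
    (gam : forall i j l, I i -> I j -> I l -> F) (ups : I 0 -> F) :
  has_sc A gam ups -> sc_axioms gam ups.
Proof.
move=> [al [_ free mul one]].
have ext d (c c' : I d -> F) :
    \sum_i c i *: al d i = \sum_i c' i *: al d i -> c =1 c'.
  move=> e i; apply/eqP; rewrite -subr_eq0; apply/eqP; move: i.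
  apply: (free _ (fun i => c i - c' i)); under eq_bigr do rewrite scalerBl.
  by rewrite sumrB e subrr.
have alE d a : al d a = \sum_x (a == x)%:R *: al d x.
  rewrite (bigD1 a) //= eqxx scale1r big1 ?addr0 // => x /negbTE.
  by rewrite eq_sym => ->; rewrite scale0r.
split.
- move=> i a; apply: ext; rewrite -alE -[RHS](gmul1l (erefl : (0 + i)%N = i)) one.
  rewrite gmul_suml; under [LHS]eq_bigr do rewrite scaler_suml.
  rewrite exchange_big; apply: eq_bigr => z _ /=; rewrite gmulZl mul scaler_sumr.
  by apply: eq_bigr => x _; rewrite scalerA.
- move=> i a; apply: ext; rewrite -alE -[RHS](gmul1r (addn0 i)) one.
  rewrite gmul_sumr; under [LHS]eq_bigr do rewrite scaler_suml.
  rewrite exchange_big; apply: eq_bigr => z _ /=; rewrite gmulZr mul scaler_sumr.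
  by apply: eq_bigr => x _; rewrite scalerA.
move=> i j l ij jl d e1 e2 e3 e4 a b c; apply: ext.
have := gmulA e1 e2 e3 e4 (al i a) (al j b) (al l c).
rewrite (mul _ _ _ e1) (mul _ _ _ e3) gmul_suml gmul_sumr => e.
transitivity (\sum_z gmul e2 (gam i j ij a b z *: al ij z) (al l c)).
  under [LHS]eq_bigr do rewrite scaler_suml.
  rewrite exchange_big; apply: eq_bigr => z _ /=; rewrite gmulZl mul scaler_sumr.
  by apply: eq_bigr => x _; rewrite scalerA.
rewrite e; under [RHS]eq_bigr do rewrite scaler_suml.
rewrite [RHS]exchange_big; apply: eq_bigr => z _ /=; rewrite gmulZr mul scaler_sumr.
by apply: eq_bigr => x _; rewrite scalerA.
Qed.

Lemma sc_axioms_map (R S : comNzRingType) (f : {rmorphism R -> S})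
    (I : nat -> finType) (gam : forall i j l, I i -> I j -> I l -> R)
    (ups : I 0 -> R) :
  sc_axioms gam ups ->
  sc_axioms (fun i j l a b x => f (gam i j l a b x)) (fun z => f (ups z)).
Proof.
move=> [ax1 ax2 axA]; split.
- move=> i a x; rewrite -(rmorph_nat f) -ax1 rmorph_sum; apply: eq_bigr => z _.
  by rewrite rmorphM.
- move=> i a x; rewrite -(rmorph_nat f) -ax2 rmorph_sum; apply: eq_bigr => z _.
  by rewrite rmorphM.
move=> i j l ij jl d e1 e2 e3 e4 a b c x.
have /(congr1 f) := axA _ _ _ _ _ _ e1 e2 e3 e4 a b c x.
rewrite !rmorph_sum => e; transitivity (\sum_z f (gam i j ij a b z * gam ij l d z c x)).
  by apply: eq_bigr => z _; rewrite rmorphM.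
by rewrite e; apply: eq_bigr => z _; rewrite rmorphM.
Qed.

(** With constants in k[t] the lattice is free on the e, and both conditions on specialization are
    checked on coefficients. *)
Theorem free_family (k : fieldType) (I : nat -> finType)
    (gam : forall i j l, I i -> I j -> I l -> {poly k}) (ups : I 0 -> {poly k})
    (A0 A1 : galg k) :
  sc_axioms gam ups ->
  has_sc A0 (fun i j l a b x => (gam i j l a b x).[0]) (fun z => (ups z).[0]) ->
  has_sc A1 (fun i j l a b x => (gam i j l a b x).[1]) (fun z => (ups z).[1]) ->
  fibers_of_one_family A0 A1.
Proof.
move=> ax h0 h1; pose A (b : bool) := if b then A1 else A0.
have [e [e_span e_free e_mul e_one]] :=
  sc_galg_has_sc (sc_axioms_map (@tofrac {poly k}) ax).
have hA b : has_sc (A b) (fun i j l a c x => (gam i j l a c x).[b%:R])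
    (fun z => (ups z).[b%:R]) by case: b.
have {h0 h1 hA} [al hal] : exists al : forall b d, I d -> A b d, forall b,
  [/\ forall d (x : A b d), exists c : I d -> k, x = \sum_i c i *: al b d i,
      forall d (c : I d -> k), \sum_i c i *: al b d i = 0 -> forall i, c i = 0,
      forall i j l (E : (i + j)%N = l) a c,
        gmul E (al b i a) (al b j c) = \sum_x (gam i j l a c x).[b%:R] *: al b l x &
      gone (A b) = \sum_z (ups z).[b%:R] *: al b 0 z].
  have [al1 hal1] := hA true; have [al0 hal0] := hA false.
  by exists (fun b => if b return forall d, I d -> A b d then al1 else al0); case.
apply: (@span_family k _ A I e al) => //.
- by move=> b; case: (hal b).
- move=> i j l E a c; exists (gam i j l a c).
  by rewrite e_mul; split=> // b; case: (hal b) => _ _ ->.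
- by exists ups; rewrite e_one; split=> // b; case: (hal b) => _ _ _ ->.
- move=> b d p /e_free p0; rewrite /acomb big1 // => i _.
  by have /eqP := p0 i; rewrite tofrac_eq0 => /eqP ->; rewrite horner0 scale0r.
move=> b d p; have [_ fr _ _] := hal b => /fr p0.
have /choice [p' pE] i : exists p', p i = ('X - (b%:R)%:P) * p'.
  by apply: factor_tau; exact: p0.
exists p'; rewrite /ecomb scaler_sumr; apply: eq_bigr => i _.
by rewrite scalerA pE tofracM.
Qed.

Lemma has_sc_ext (F : fieldType) (I : nat -> finType) (A : galg F)
    (gam gam' : forall i j l, I i -> I j -> I l -> F) (ups ups' : I 0 -> F) :
  (forall i j l, (i + j)%N = l -> forall a b x, gam i j l a b x = gam' i j l a b x) ->
  ups =1 ups' -> has_sc A gam ups -> has_sc A gam' ups'.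
Proof.
move=> eg eu [al [h1 h2 h3 h4]]; exists al; split=> //.
  by move=> i j l E a b; rewrite h3; apply: eq_bigr => x _; rewrite eg.
by rewrite h4; apply: eq_bigr => z _; rewrite eu.
Qed.

(* The Rees algebra of the filtration given by the weights [w]. *)
Lemma rees_family (k : fieldType) (I : nat -> finType) (w : forall d, I d -> nat)
    (gam : forall i j l, I i -> I j -> I l -> k) (ups : I 0 -> k)
    (A0 A1 : galg k) :
  has_sc A1 gam ups ->
  (forall i j l, (i + j)%N = l -> forall a b x, gam i j l a b x != 0 ->
    (w i a + w j b <= w l x)%N) ->
  (forall z, ups z != 0 -> w 0 z = 0) ->
  has_sc A0 (fun i j l a b x =>
    if (w l x == w i a + w j b)%N then gam i j l a b x else 0) ups ->
  fibers_of_one_family A0 A1.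
Proof.
move=> h1 wgam wups h0; have [ax1 ax2 axA] := sc_axioms_of h1.
(* The excess of weight in a product becomes a power of t: at t = 1 all constants are recovered, at
   t = 0 only those that preserve the weight survive. *)
pose e i j l a b x := (w l x - (w i a + w j b))%N.
pose g i j l a b x : {poly k} := (gam i j l a b x)%:P * 'X^(e i j l a b x).
pose u z : {poly k} := (ups z)%:P.
have uE i (a x : I i) (p : I 0 -> k) (v : I 0 -> nat) :
    \sum_z ups z * p z = (a == x)%:R ->
    (forall z, ups z * p z != 0 -> v z = (w i x - w i a)%N) ->
    \sum_z u z * ((p z)%:P * 'X^(v z)) = (a == x)%:R.
  move=> ps vE; transitivity ((\sum_z ups z * p z)%:P * 'X^(w i x - w i a)).
    rewrite rmorph_sum mulr_suml; apply: eq_bigr => z _; rewrite mulrA -polyCM.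
    by have [->|/vE ->//] := eqVneq (ups z * p z) 0; rewrite !mul0r.
  by rewrite ps; case: eqP => [->|_]; rewrite ?subnn ?mulr1 ?polyC1 ?polyC0 ?mul0r.
apply: (@free_family k I g u).
- split=> [i a x|i a x|i j l ij jl d e1 e2 e3 e4 a b c x].
  + apply: uE => // z; rewrite mulf_eq0 negb_or => /andP [/wups w0].
    by move/(wgam _ _ _ (add0n i)); rewrite /e w0.
  + apply: uE => // z; rewrite mulf_eq0 negb_or => /andP [/wups w0].
    by move/(wgam _ _ _ (addn0 i)); rewrite /e w0 addn0.
  (* All nonzero terms on either side carry the same power of t; the weight inequalities for them
     make the truncated subtractions exact. *)
  pose N := (w d x - (w i a + w j b + w l c))%N.
  transitivity ((\sum_z gam i j ij a b z * gam ij l d z c x)%:P * 'X^N).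
    rewrite rmorph_sum mulr_suml; apply: eq_bigr => z _.
    rewrite /g mulrACA -exprD -polyCM.
    have [->|nz] := eqVneq (gam i j ij a b z * gam ij l d z c x) 0.
      by rewrite !mul0r.
    move: nz; rewrite mulf_eq0 negb_or => /andP [/(wgam _ _ _ e1) h /(wgam _ _ _ e2) h'].
    by congr (_ * 'X^_); rewrite /e /N; lia.
  rewrite (axA _ _ _ ij jl d) // rmorph_sum mulr_suml; apply: eq_bigr => z _.
  rewrite /g mulrACA -exprD -polyCM.
  have [->|nz] := eqVneq (gam j l jl b c z * gam i jl d a z x) 0.
    by rewrite !mul0r.
  move: nz; rewrite mulf_eq0 negb_or => /andP [/(wgam _ _ _ e3) h /(wgam _ _ _ e4) h'].
  by congr (_ * 'X^_); rewrite /e /N; lia.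
- apply: has_sc_ext h0 => [i j l E a b x|z]; last by rewrite /u hornerC.
  rewrite /g hornerM hornerC hornerXn expr0n /e subn_eq0.
  have [->|/(wgam _ _ _ E) h] := eqVneq (gam i j l a b x) 0.
    by rewrite mul0r if_same.
  by rewrite eqn_leq h andbT; case: ifP; rewrite ?mulr1 ?mulr0.
apply: has_sc_ext h1 => [i j l E a b x|z]; last by rewrite /u hornerC.
by rewrite /g hornerM hornerC hornerXn expr1n mulr1.
Qed.

(** * Twisted monomial algebras *)

Section Twist.
Variable n : nat.
Implicit Types (m : multinom n) (ok : pred (multinom n)).
Local Notation madd := (@mnm_add n).

(* The exponents of the number of inversions, and of the squares, that appear
   when two ordered monomials are multiplied. *)
Definition inversions m m' : nat := \sum_(i < n) \sum_(j < n | (j < i)%N) m i * m' j.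
Definition squares m m' : nat := \sum_(i < n) (odd (m i) && odd (m' i)).
Definition half_deg m : nat := \sum_(i < n) (m i)./2.

Lemma inversionsDl m m' m2 : inversions (madd m m') m2 =
  (inversions m m2 + inversions m' m2)%N.
Proof.
rewrite /inversions -big_split; apply: eq_bigr => i _ /=.
by rewrite -big_split; apply: eq_bigr => j _; rewrite mnmDE mulnDl.
Qed.
Lemma inversionsDr m m' m2 : inversions m2 (madd m m') =
  (inversions m2 m + inversions m2 m')%N.
Proof.
rewrite /inversions -big_split; apply: eq_bigr => i _ /=.
by rewrite -big_split; apply: eq_bigr => j _; rewrite mnmDE mulnDr.
Qed.
Lemma squaresE m m' :
  (squares m m' + half_deg m + half_deg m')%N = half_deg (madd m m').
Proof.
rewrite /squares /half_deg -!big_split; apply: eq_bigr => i _ /=.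
by rewrite mnmDE halfD addnA.
Qed.

Definition tw_coef (R : comNzRingType) (q s : R) m m' : R :=
  q ^+ inversions m m' * s ^+ squares m m'.

(** The number of inversions is bilinear and, by [squaresE], the number of squares is the coboundary
    of [half_deg]: both are 2-cocycles. *)
Lemma tw_coef_cocycle (R : comNzRingType) (q s : R) a b c :
  tw_coef q s a b * tw_coef q s (madd a b) c =
  tw_coef q s b c * tw_coef q s a (madd b c).
Proof.
rewrite /tw_coef mulrACA [RHS]mulrACA -!exprD inversionsDl inversionsDr.
congr (_ ^+ _ * _ ^+ _).
  by rewrite addnA addnC.
have := squaresE a b; have := squaresE (madd a b) c.
have := squaresE b c; have := squaresE a (madd b c).
rewrite addmA; lia.
Qed.

Lemma tw_coef0l (R : comNzRingType) (q s : R) m : tw_coef q s (@mnm0 n) m = 1.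
Proof.
rewrite /tw_coef (_ : inversions _ _ = 0%N); last first.
  by apply: big1 => i _; apply: big1 => j _; rewrite mnm0E.
rewrite (_ : squares _ _ = 0%N) ?mulr1 //.
by apply: big1 => i _; rewrite mnm0E.
Qed.
Lemma tw_coef0r (R : comNzRingType) (q s : R) m : tw_coef q s m (@mnm0 n) = 1.
Proof.
rewrite /tw_coef (_ : inversions _ _ = 0%N); last first.
  by apply: big1 => i _; apply: big1 => j _; rewrite mnm0E muln0.
rewrite (_ : squares _ _ = 0%N) ?mulr1 //.
by apply: big1 => i _; rewrite mnm0E andbF.
Qed.

Lemma tw_coef_map (R S : comNzRingType) (f : {rmorphism R -> S}) q s m m' :
  f (tw_coef q s m m') = tw_coef (f q) (f s) m m'.
Proof. by rewrite rmorphM !rmorphXn. Qed.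

(** [ok] selects the monomials that are nonzero in the algebra: all of them, or the squarefree ones.
    The bound on the degree gives a finite type. *)
Definition tw_ix ok (d : nat) : finType :=
  {m : bmultinom n d.+1 | (mdeg m == d) && ok m}.
Definition tw_val ok d (a : tw_ix ok d) : multinom n := val (val a).

Lemma tw_val_inj ok d : injective (@tw_val ok d).
Proof. by move=> a b /val_inj /val_inj. Qed.
Lemma tw_valP ok d (a : tw_ix ok d) : mdeg (tw_val a) = d /\ ok (tw_val a).
Proof. by case/andP: (valP a) => /eqP. Qed.
Lemma tw_val_ex ok d m : mdeg m = d -> ok m -> exists a : tw_ix ok d, tw_val a = m.
Proof.
move=> md okm; have h : (mdeg m < d.+1)%N by rewrite md.
have h' : (mdeg (BMultinom h) == d) && ok (BMultinom h) by rewrite /= md eqxx.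
by exists (Sub (BMultinom h) h').
Qed.

Lemma tw_sum ok d (V : nmodType) m (G : multinom n -> V) :
  \sum_(z : tw_ix ok d | tw_val z == m) G (tw_val z) =
  if (mdeg m == d) && ok m then G m else 0.
Proof.
case: ifP => [/andP [/eqP md okm]|h]; last first.
  rewrite big_pred0 // => z; apply/negP => /eqP zm; move/negP: h; apply.
  by have [zd zok] := tw_valP z; rewrite -zm zd eqxx.
have [a <-] := tw_val_ex md okm.
by rewrite (big_pred1 a) // => z /=; rewrite (inj_eq (@tw_val_inj ok d)).
Qed.

Variable ok : pred (multinom n).
(** The excluded monomials are stable under multiplication, so that setting them to 0 keeps the
    product associative. *)
Hypothesis ok_down : forall a b, ok (madd a b) -> ok a && ok b.
Hypothesis ok0 : ok (@mnm0 n).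

Definition tw_gam (R : comNzRingType) (q s : R) i j l (a : tw_ix ok i)
    (b : tw_ix ok j) (x : tw_ix ok l) : R :=
  if tw_val x == madd (tw_val a) (tw_val b)
  then tw_coef q s (tw_val a) (tw_val b) else 0.
(** The only index of degree 0 is the zero exponent, whose basis element is the unit. *)
Definition tw_ups (R : comNzRingType) (z : tw_ix ok 0) : R := 1.

Lemma tw_ix0 (z : tw_ix ok 0) : tw_val z = @mnm0 n.
Proof. by apply/eqP; rewrite -mdeg_eq0; have [->] := tw_valP z. Qed.

Lemma tw_sum0 (V : nmodType) (G : tw_ix ok 0 -> V) (g : V) :
  (forall z, tw_val z = @mnm0 n -> G z = g) -> \sum_z G z = g.
Proof.
move=> Gg; transitivity (\sum_(z : tw_ix ok 0 | tw_val z == @mnm0 n) g).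
  rewrite [RHS]big_mkcond; apply: eq_bigr => z _.
  by rewrite tw_ix0 eqxx Gg // tw_ix0.
by rewrite (@tw_sum ok 0 V (@mnm0 n) (fun=> g)) mdeg0 eqxx ok0.
Qed.

Lemma tw_axioms (R : comNzRingType) (q s : R) :
  sc_axioms (fun i j l => @tw_gam R q s i j l) (@tw_ups R).
Proof.
split.
- move=> i a x; apply: tw_sum0 => z z0; rewrite /tw_gam z0 add0m tw_coef0l mul1r.
  by rewrite (inj_eq (@tw_val_inj _ _)) eq_sym; case: eqP.
- move=> i a x; apply: tw_sum0 => z z0; rewrite /tw_gam z0 addm0 tw_coef0r mul1r.
  by rewrite (inj_eq (@tw_val_inj _ _)) eq_sym; case: eqP.
move=> i j l ij jl d e1 e2 e3 e4 a b c x.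
set ma := tw_val a; set mb := tw_val b; set mc := tw_val c; set mx := tw_val x.
have [da oka] := tw_valP a; have [db okb] := tw_valP b; have [dc okc] := tw_valP c.
transitivity (\sum_(z : tw_ix ok ij | tw_val z == madd ma mb)
   (if mx == madd (tw_val z) mc then tw_coef q s ma mb * tw_coef q s (tw_val z) mc else 0)).
  rewrite [RHS]big_mkcond; apply: eq_bigr => z _; rewrite /tw_gam -/ma -/mb -/mc -/mx.
  by case: ifP; case: ifP; rewrite ?mulr0 ?mul0r.
rewrite (@tw_sum ok ij R (madd ma mb) (fun m => if mx == madd m mc then tw_coef q s ma mb * tw_coef q s m mc else 0)).
transitivity (\sum_(z : tw_ix ok jl | tw_val z == madd mb mc)
   (if mx == madd ma (tw_val z) then tw_coef q s mb mc * tw_coef q s ma (tw_val z) else 0)); last first.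
  rewrite [LHS]big_mkcond; apply: eq_bigr => z _; rewrite /tw_gam -/ma -/mb -/mc -/mx.
  by case: ifP; case: ifP; rewrite ?mulr0 ?mul0r.
rewrite (@tw_sum ok jl R (madd mb mc) (fun m => if mx == madd ma m then tw_coef q s mb mc * tw_coef q s ma m else 0)).
rewrite !mdegD da db dc e1 e3 !eqxx /= -addmA tw_coef_cocycle.
(* Both sides vanish unless x = a + b + c; in that case [ok_down] makes both intermediate products
   admissible. *)
case: (mx =P madd ma (madd mb mc)) => [xE|_]; last by rewrite !if_same.
have okx : ok (madd ma (madd mb mc)) by rewrite -xE; have [_] := tw_valP x.
have /andP [_ ->] := ok_down okx.
by move: okx; rewrite addmA => /ok_down /andP [-> _].
Qed.

(** Both parameters are interpolated linearly, since the axioms hold for all q and s in k[t]. *)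
Lemma twist_family (k : fieldType) (q0 s0 q1 s1 : k) (A0 A1 : galg k) :
  has_sc A0 (fun i j l => @tw_gam k q0 s0 i j l) (@tw_ups k) ->
  has_sc A1 (fun i j l => @tw_gam k q1 s1 i j l) (@tw_ups k) ->
  fibers_of_one_family A0 A1.
Proof.
move=> h0 h1; pose L (c0 c1 : k) := c0%:P + 'X * (c1 - c0)%:P.
have L0 c0 c1 : (L c0 c1).[0] = c0.
  by rewrite /L hornerD hornerM hornerX mul0r addr0 hornerC.
have L1 c0 c1 : (L c0 c1).[1] = c1.
  by rewrite /L hornerD hornerM hornerX mul1r !hornerC addrC subrK.
apply: (free_family (tw_axioms (L q0 q1) (L s0 s1))).
  apply: has_sc_ext h0 => [i j l E a b x|z]; last by rewrite /tw_ups hornerC.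
  rewrite /tw_gam; case: ifP => _; last by rewrite horner0.
  by rewrite -[RHS]/(horner_eval 0 _) tw_coef_map /= /horner_eval !L0.
apply: has_sc_ext h1 => [i j l E a b x|z]; last by rewrite /tw_ups hornerC.
rewrite /tw_gam; case: ifP => _; last by rewrite horner0.
by rewrite -[RHS]/(horner_eval 1 _) tw_coef_map /= /horner_eval !L1.
Qed.

Definition tw_galg (k : fieldType) (q s : k) : galg k := sc_galg (tw_axioms q s).

End Twist.

(** * Algebras presented by quadratic relations *)

Section Words.
Variables (F : fieldType) (N : nat).
Implicit Types (w : seq 'I_N) (m : multinom N).

(* The value is 0 if [w] does not have length [d]. *)
Fixpoint gword (A : galg F) (X : 'I_N -> A 1) w d : A d :=
  match w, d with
  | [::], 0 => gone A
  | i :: w', d'.+1 => gmul (add1n d') (X i) (gword X w' d')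
  | _, _ => 0
  end.

Definition mcontent w : multinom N := Multinom [tuple count_mem i w | i < N].

Definition leo (i j : 'I_N) := (i <= j)%N.

Definition mword m : seq 'I_N :=
  sort leo (flatten [seq nseq (m i) i | i <- enum 'I_N]).

Lemma leo_trans : transitive leo. Proof. by move=> i j l; exact: leq_trans. Qed.
Lemma leo_total : total leo. Proof. by move=> i j; exact: leq_total. Qed.
Lemma leo_anti : antisymmetric leo.
Proof. by move=> i j h; apply/val_inj/eqP; rewrite eqn_leq. Qed.

Lemma mcontentE w i : mcontent w i = count_mem i w.
Proof. by rewrite mnmE. Qed.

Lemma mwordK m : mcontent (mword m) = m.
Proof.
apply/mnmP => i; rewrite mcontentE count_sort count_flatten -map_comp.
rewrite sumnE big_map big_enum /= (bigD1 i) //= count_nseq /= eqxx mul1n.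
by rewrite big1 ?addn0 // => j /negbTE ji; rewrite count_nseq /= ji.
Qed.

Lemma perm_content w w' : perm_eq w w' = (mcontent w == mcontent w').
Proof.
apply/idP/eqP => [/permP h|h]; first by apply/mnmP => i; rewrite !mcontentE h.
by apply/allP => i _ /=; rewrite -!mcontentE h.
Qed.

Lemma mword_sorted m : sorted leo (mword m).
Proof. exact: (sort_sorted leo_total). Qed.

Lemma sorted_mword w : sorted leo w -> w = mword (mcontent w).
Proof.
move=> sw; apply: (sorted_eq leo_trans leo_anti sw (mword_sorted _)).
by rewrite perm_content mwordK.
Qed.

Lemma mdeg_content w : mdeg (mcontent w) = size w.
Proof.
rewrite mdegE -(count_predT w).
rewrite (eq_bigr (fun i => count_mem i w)) => [|i _]; last exact: mcontentE.
elim: w => [|j w IH] /=; first by rewrite big1.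
rewrite big_split /= IH; congr (_ + _)%N.
by rewrite (bigD1 j) //= eqxx big1 // => i /negbTE; rewrite eq_sym => ->.
Qed.

Lemma size_mword m : size (mword m) = mdeg m.
Proof. by rewrite -mdeg_content mwordK. Qed.

Lemma mcontent_cat w w' : mcontent (w ++ w') = mnm_add (mcontent w) (mcontent w').
Proof. by apply/mnmP => i; rewrite mnmDE !mcontentE count_cat. Qed.

Lemma mcontent_cons i w : mcontent (i :: w) = mnm_add (mnm1 i) (mcontent w).
Proof. by apply/mnmP => j; rewrite mnmDE !mcontentE mnm1E. Qed.

Variable A : galg F.
Variable X : 'I_N -> A 1.

Lemma gword_size w d : size w <> d -> gword X w d = 0.
Proof.
elim: w d => [|i w IH] [|d] //= h.
by rewrite IH ?gmul0r // => e; apply: h; rewrite e.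
Qed.

Lemma gword_cat u v i j l (E : (i + j)%N = l) : size u = i -> size v = j ->
  gmul E (gword X u i) (gword X v j) = gword X (u ++ v) l.
Proof.
elim: u i l E => [|a u IH] [|i] // l E.
  by move=> _ sv; subst l; exact: gmul1l.
case: l E => // l E [su] sv /=; have E' : (i + j)%N = l by case: E.
by rewrite (gmulA _ _ E' (add1n l)) IH.
Qed.

Lemma gword_swap c i j w d :
  gmul (erefl : (1 + 1)%N = 2) (X i) (X j) = c *: gmul (erefl : (1 + 1)%N = 2) (X j) (X i) ->
  gword X (i :: j :: w) d = c *: gword X (j :: i :: w) d.
Proof.
move=> sw; case: d => [|[|d]] /=; try by rewrite ?gmul0r scaler0.
have e2 : (2 + d)%N = d.+2 by [].
rewrite -(gmulA (erefl : (1 + 1)%N = 2) e2) sw gmulZl.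
by rewrite (gmulA _ _ (add1n d) (add1n d.+1)).
Qed.

Variable S : F -> Prop.
Hypothesis S1 : S 1.
Hypothesis SM : forall a b, S a -> S b -> S (a * b).
Hypothesis swapX : forall i j : 'I_N, (j < i)%N -> exists c, S c /\
  gmul (erefl : (1 + 1)%N = 2) (X i) (X j) = c *: gmul (erefl : (1 + 1)%N = 2) (X j) (X i).

(** Insertion sort of the letters, each exchange costing a scalar. [S] records what is known of
    these scalars: that they are nonzero in the twisted case, that they are 1 in the commutative
    case. *)
Lemma gword_nf w d : exists c, S c /\ gword X w d = c *: gword X (mword (mcontent w)) d.
Proof.
suff [c [s [Sc ss ps E]]] : exists c s, [/\ S c, sorted leo s, perm_eq s w &
    forall d, gword X w d = c *: gword X s d].
  exists c; split=> //; rewrite E; congr (_ *: gword X _ d).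
  by rewrite [LHS]sorted_mword //; congr mword; apply/eqP; rewrite -perm_content.
elim: w {d} => [|i w [c [s [Sc ss ps E]]]].
  by exists 1, [::]; split=> // d; rewrite scale1r.
suff [c' [s' [Sc' ss' ps' E']]] : exists c s', [/\ S c, sorted leo s', perm_eq s' (i :: s) &
    forall d, gword X (i :: s) d = c *: gword X s' d].
  exists (c * c'), s'; split=> //; first exact: SM.
    by rewrite (perm_trans ps') // perm_cons.
  case=> [|d] /=; first by have := E' 0; rewrite -scalerA => <-; rewrite scaler0.
  by rewrite E gmulZr -scalerA -E'.
elim: s ss {w ps E Sc} => [|j s IH] ss.
  by exists 1, [:: i]; split=> // d; rewrite scale1r.
have [ij|ji] := leqP i j.
  exists 1, [:: i, j & s]; split=> // [|d]; last by rewrite scale1r.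
  by rewrite /= /leo ij.
have [c' [s' [Sc' ss' ps' E']]] := IH (path_sorted ss).
have [a [Sa aE]] := swapX ji.
exists (a * c'), (j :: s'); split; first exact: SM.
- rewrite /= path_min_sorted //; apply/allP => y; rewrite (perm_mem ps') inE => /orP [/eqP ->|ys].
    exact: ltnW.
  by have /allP := order_path_min leo_trans ss; apply.
- by rewrite -(perm_cons j) in ps'; rewrite (perm_trans ps') // (perm_catCA [:: j] [:: i] s).
move=> d; rewrite (gword_swap _ _ aE) -scalerA; congr (_ *: _).
case: d => [|d]; first by rewrite /= scaler0.
change (gmul (add1n d) (X j) (gword X (i :: s) d) =
        c' *: gmul (add1n d) (X j) (gword X s' d)).
by rewrite E' gmulZr.
Qed.

End Words.

Section TensorWords.
Variables (F : fieldType) (W : vectType F).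
Local Notation N := (\dim {:W}).

Definition tletter (i : 'I_N) : tensor_algebra W 1 :=
  [ffun t : 1.-tuple 'I_N => (tnth t ord0 == i)%:R].

Lemma tvec_letter (w : W) : tvec w = \sum_i bcoord i w *: tletter i.
Proof.
apply/ffunP => t; rewrite ffunE sum_ffunE (bigD1 (tnth t ord0)) //= !ffunE eqxx.
rewrite big1 ?addr0 => [|i /negbTE it]; first by rewrite /GRing.scale /= mulr1.
by rewrite !ffunE eq_sym it scaler0.
Qed.

Lemma tvec_bvec i : tvec (bvec i) = tletter i.
Proof.
apply/ffunP => t; rewrite !ffunE /bcoord /bvec coord_free 1?eq_sym //.
exact: basis_free (vbasisP _).
Qed.

Lemma gword_tletter d (t : d.-tuple 'I_N) (w : seq 'I_N) :
  size w = d -> (gword tletter w d : tpow W d) t = (val t == w)%:R.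
Proof.
elim: w d t => [|i w IH] [|d] t //=.
  by rewrite tuple0 ffunE.
move=> [sw]; rewrite ffunE IH // ffunE tnth_mktuple.
have tE : t = [tuple of tnth t ord0 :: behead t].
  apply: eq_from_tnth => a; rewrite (tnth_nth i) [RHS](tnth_nth i) /=.
  case: (unliftP ord0 a) => [a' ->|->] /=; last by rewrite (tnth_nth i).
  by rewrite nth_behead.
rewrite [X in _ = (X == _)%:R](congr1 val tE) /= eqseq_cons -natrM mulnb; congr (_%:R); congr (nat_of_bool (_ && _)).
  by congr (_ == _); congr tnth; apply: val_inj.
congr (_ == _); apply: (@eq_from_nth _ i); first by rewrite /= size_map size_enum_ord size_behead size_tuple.
move=> a; rewrite /= size_map size_enum_ord => ad; rewrite nth_behead.
rewrite (nth_map (Ordinal ad)) ?size_enum_ord // (tnth_nth i) /=.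
by rewrite nth_enum_ord.
Qed.

Lemma tensor_sum d (f : tensor_algebra W d) :
  f = \sum_(t : d.-tuple 'I_N) ((f : tpow W d) t : F) *: gword tletter t d.
Proof.
apply/ffunP => t; rewrite sum_ffunE (bigD1 t) //= ffunE gword_tletter ?size_tuple // eqxx.
rewrite big1 ?addr0 => [|s /negbTE st]; first by rewrite /GRing.scale /= mulr1.
rewrite ffunE gword_tletter ?size_tuple //.
by rewrite eq_sym -val_eqE /= in st; rewrite st scaler0.
Qed.

Variables (B : galg F) (Y : 'I_N -> B 1).

(** The morphism given by the universal property of the tensor algebra, for the images [Y] of the
    letters. *)
Definition tmor d (f : tensor_algebra W d) : B d :=
  \sum_(t : d.-tuple 'I_N) ((f : tpow W d) t : F) *: gword Y t d.

Lemma tmor_linear d c (f g : tensor_algebra W d) :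
  tmor (c *: f + g) = c *: tmor f + tmor g.
Proof.
rewrite /tmor scaler_sumr -big_split; apply: eq_bigr => t _ /=.
by rewrite !ffunE scalerDl scalerA.
Qed.

Lemma tmor0 d : tmor (0 : tensor_algebra W d) = 0.
Proof. by rewrite /tmor big1 // => t _; rewrite ffunE scale0r. Qed.

Lemma tmorZ d c (f : tensor_algebra W d) : tmor (c *: f) = c *: tmor f.
Proof. by rewrite -[c *: f]addr0 tmor_linear tmor0 addr0. Qed.

Lemma tmorD d (f g : tensor_algebra W d) : tmor (f + g) = tmor f + tmor g.
Proof. by rewrite -[f]scale1r tmor_linear !scale1r. Qed.

Lemma tmor_sum d (T : Type) (r : seq T) (f : T -> tensor_algebra W d) :
  tmor (\sum_(t <- r) f t) = \sum_(t <- r) tmor (f t).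
Proof. by apply: (big_morph (@tmor d)) => [f1 f2|]; [exact: tmorD|exact: tmor0]. Qed.

Lemma tmor_gword w d : tmor (gword tletter w d) = gword Y w d.
Proof.
have [sw|sw] := eqVneq (size w) d; last first.
  by rewrite !gword_size ?tmor0 //; exact/eqP.
have ws : size w == d by rewrite sw.
rewrite /tmor (bigD1 (Tuple ws)) //= gword_tletter // eqxx scale1r big1 ?addr0 //.
by move=> t; rewrite -val_eqE /= gword_tletter // => /negbTE ->; rewrite scale0r.
Qed.

Lemma tmor_letter i : tmor (tletter i) = Y i.
Proof.
have := tmor_gword [:: i] 1; cbn [gword].
have g1r (C : galg F) (e : (1 + 0)%N = 1) (x : C 1) : gmul e x (gone C) = x.
  exact: gmul1r.
by rewrite !g1r.
Qed.

Lemma tmorM i j l (E : (i + j)%N = l) (f : tensor_algebra W i)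
    (g : tensor_algebra W j) : tmor (gmul E f g) = gmul E (tmor f) (tmor g).
Proof.
rewrite {1}[f]tensor_sum {1}[g]tensor_sum gmul_suml tmor_sum [in RHS]/tmor gmul_suml.
apply: eq_bigr => t _; rewrite gmul_sumr tmor_sum gmul_sumr; apply: eq_bigr => s _.
rewrite !gmulZl !gmulZr !tmorZ; congr (_ *: (_ *: _)).
by rewrite !gword_cat ?size_tuple // tmor_gword.
Qed.

Variable R : tensor_algebra W 2 -> Prop.
Hypothesis Y_R : forall r, R r -> tmor r = 0.

Lemma tmor_gideal d (f : tensor_algebra W d) : gideal R f -> tmor f = 0.
Proof.
elim=> {d f} [i j l d e e' a r b Rr|d|d c x y _ IHx _ IHy].
- by rewrite !tmorM Y_R // gmul0r gmul0l.
- exact: tmor0.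
by rewrite tmor_linear IHx IHy scaler0 addr0.
Qed.

Local Notation Q := (gquot R).

(** The morphism induced by [tmor] on the quotient, computed on a representative; [qmor_pi] shows
    independence of it. *)
Definition qmor d (x : Q d) : B d := tmor (repr x).

Lemma qmor_pi d (f : tensor_algebra W d) : qmor (gquot_pi R f) = tmor f.
Proof.
have /gquot_piP /tmor_gideal : gquot_pi R (repr (gquot_pi R f)) = gquot_pi R f.
  exact: gquot_reprK.
by rewrite -scaleN1r addrC tmor_linear scaleN1r addrC => /eqP; rewrite subr_eq0 => /eqP.
Qed.

Lemma gquot_piL d c (f g : tensor_algebra W d) :
  gquot_pi R (c *: f + g) = c *: gquot_pi R f + gquot_pi R g.
Proof. exact: lquot_pi_linear. Qed.

Lemma gquot_pi0 d : gquot_pi R (0 : tensor_algebra W d) = 0.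
Proof.
by have := gquot_piL (-1) (0 : tensor_algebra W d) 0;
  rewrite scaler0 addr0 scaleN1r addNr.
Qed.

Lemma gquot_pi_sum d (T : Type) (r : seq T) (c : T -> F) (f : T -> tensor_algebra W d) :
  gquot_pi R (\sum_(t <- r) c t *: f t) = \sum_(t <- r) c t *: gquot_pi R (f t).
Proof.
elim: r => [|t r IH]; first by rewrite !big_nil gquot_pi0.
by rewrite !big_cons gquot_piL IH.
Qed.

Lemma qmor_linear d c (x y : Q d) : qmor (c *: x + y) = c *: qmor x + qmor y.
Proof.
by rewrite -[x]gquot_reprK -[y]gquot_reprK -gquot_piL !qmor_pi tmor_linear.
Qed.

Lemma qmor0 d : qmor (0 : Q d) = 0.
Proof. by rewrite -(gquot_pi0 d) qmor_pi tmor0. Qed.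

Lemma qmor_sum d (T : Type) (r : seq T) (c : T -> F) (f : T -> Q d) :
  qmor (\sum_(t <- r) c t *: f t) = \sum_(t <- r) c t *: qmor (f t).
Proof.
elim: r => [|t r IH]; first by rewrite !big_nil qmor0.
by rewrite !big_cons qmor_linear IH.
Qed.

Lemma qmorM i j l (E : (i + j)%N = l) (x : Q i) (y : Q j) :
  qmor (gmul E x y) = gmul E (qmor x) (qmor y).
Proof.
have key f g : qmor (gmul E (gquot_pi R f : Q i) (gquot_pi R g)) = gmul E (tmor f) (tmor g).
  transitivity (qmor (gquot_pi R (gmul E f g))); last by rewrite qmor_pi tmorM.
  by apply: (congr1 (@qmor l)); exact: gquot_pi_mul.
by rewrite -(gquot_reprK x) -(gquot_reprK y) key !qmor_pi.
Qed.

Definition qletter i : Q 1 := gquot_pi R (tletter i).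

Lemma gquot_gword w d : gquot_pi R (gword tletter w d) = gword qletter w d.
Proof.
elim: w d => [|i w IH] [|d]; rewrite ?gquot_pi0 //=.
by rewrite -IH; exact (esym (gquot_pi_mul R (add1n d) (tletter i) (gword tletter w d))).
Qed.

Lemma gquot_span d (x : Q d) :
  exists c : d.-tuple 'I_N -> F, x = \sum_t c t *: gword qletter t d.
Proof.
exists (fun t => (repr x : tpow W d) t); rewrite -[LHS]gquot_reprK [repr x]tensor_sum.
rewrite gquot_pi_sum; apply: eq_bigr => t _; by rewrite gquot_gword -tensor_sum.
Qed.

Lemma qmor_gword w d : qmor (gword qletter w d) = gword Y w d.
Proof. by rewrite -gquot_gword qmor_pi tmor_gword. Qed.

End TensorWords.

Section TwistedWords.
Variables (F : fieldType) (N : nat) (ok : pred (multinom N)) (q : F).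
Hypothesis ok_down : forall a b, ok (mnm_add a b) -> ok a && ok b.
Hypothesis ok0 : ok (@mnm0 N).
Hypothesis ok1 : forall i, ok (mnm1 i).
Local Notation tw_I := (tw_ix ok).
Variables (B : galg F) (al : forall d, tw_I d -> B d).
Arguments al : clear implicits.
Hypothesis al_mul : forall i j l (E : (i + j)%N = l) a b,
  gmul E (al i a) (al j b) =
  \sum_x @tw_gam N ok F q 1 i j l a b x *: al l x.
Hypothesis al_one : gone B = \sum_z @tw_ups N ok F z *: al 0 z.

(* The value is 0 if no basis element of degree [d] has exponent [m]. *)
Definition tw_el d (m : multinom N) : B d := \sum_(x : tw_I d | tw_val x == m) al d x.

Lemma tw_elE d (a : tw_I d) : tw_el d (tw_val a) = al d a.
Proof.
by rewrite /tw_el (big_pred1 a) // => x; rewrite (inj_eq (@tw_val_inj _ _ _)).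
Qed.

Lemma tw_el0 d m : ~~ ok m -> tw_el d m = 0.
Proof.
move=> nok; rewrite /tw_el big_pred0 // => x; apply/negP => /eqP xm.
by move: nok; rewrite -xm; have [_ ->] := tw_valP x.
Qed.

Lemma tw_elM i j l (E : (i + j)%N = l) a b : mdeg a = i -> mdeg b = j -> ok a -> ok b ->
  gmul E (tw_el i a) (tw_el j b) = tw_coef q 1 a b *: tw_el l (mnm_add a b).
Proof.
move=> da db oka okb; have [x <-] := tw_val_ex da oka; have [y <-] := tw_val_ex db okb.
rewrite !tw_elE al_mul /tw_el scaler_sumr [RHS]big_mkcond; apply: eq_bigr => z _.
by rewrite /tw_gam; case: ifP => _; rewrite ?scale0r.
Qed.

Lemma tw_el_one : gone B = tw_el 0 (@mnm0 N).
Proof.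
rewrite al_one /tw_el [RHS]big_mkcond; apply: eq_bigr => z _.
by rewrite tw_ix0 eqxx scale1r.
Qed.

Definition tw_letter i : B 1 := tw_el 1 (mnm1 i).

Lemma tw_letterM i j l (E : (1 + 1)%N = l) : gmul E (tw_letter i) (tw_letter j) =
  q ^+ (j < i) *: tw_el l (mnm_add (mnm1 i) (mnm1 j)).
Proof.
rewrite tw_elM ?mdeg1 ?ok1 //; congr (_ *: _); rewrite /tw_coef expr1n mulr1.
congr (_ ^+ _); rewrite /inversions (bigD1 i) //= [X in (_ + X)%N]big1 ?addn0; last first.
  move=> a ai; rewrite big1 // => b _; rewrite mnm1E eq_sym (negbTE ai) mul0n //.
rewrite (eq_bigr (fun b => (j == b) : nat)); last by move=> b _; rewrite !mnm1E eqxx mul1n.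
case: ltnP => ji.
  rewrite (bigD1 j) //= eqxx big1 ?addn0 // => b /andP [_ /negbTE].
  by rewrite eq_sym => ->.
by rewrite big1 // => b bi; case: eqP => // jb; move: bi; rewrite -jb ltnNge ji.
Qed.

(** Multiplying a sorted word on the left by a letter that is at most all of its letters creates no
    inversion, so that no power of q appears. *)
Lemma tw_gword w d : size w = d -> sorted (@leo N) w ->
  gword tw_letter w d = tw_el d (mcontent w).
Proof.
elim: w d => [|i w IH] [|d] //=.
  move=> _ _; rewrite tw_el_one; congr tw_el.
move=> [sw] iw; rewrite IH ?(path_sorted iw) // mcontent_cons.
have [okw|nok] := boolP (ok (mcontent w)); last first.
  rewrite !tw_el0 ?gmul0r //; apply: contra nok => /ok_down /andP [] //.
rewrite tw_elM ?mdeg1 ?mdeg_content // /tw_coef expr1n mulr1.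
rewrite (_ : inversions _ _ = 0%N) ?scale1r // /inversions.
apply: big1 => a _; apply: big1 => b ba; rewrite mnm1E.
case: eqP => //= ia; rewrite mul1n mcontentE; apply/eqP.
rewrite -leqn0 leqNgt -has_count; apply/negP => /hasP [c cw /= /eqP cb].
have /allP /(_ c cw) := order_path_min (@leo_trans N) iw.
by rewrite /leo cb ia leqNgt ba.
Qed.

Lemma tw_gword_mword d m : mdeg m = d -> gword tw_letter (mword m) d = tw_el d m.
Proof. by move=> <-; rewrite tw_gword ?size_mword ?mwordK //; exact: mword_sorted. Qed.

End TwistedWords.

Section Presentation.
Variables (F : fieldType) (W : vectType F).
Local Notation N := (\dim {:W}).
Variables (ok : pred (multinom N)) (q : F) (R : tensor_algebra W 2 -> Prop).
Hypothesis ok_down : forall a b, ok (mnm_add a b) -> ok a && ok b.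
Hypothesis ok0 : ok (@mnm0 N).
Hypothesis ok1 : forall i, ok (mnm1 i).
Local Notation tw_I := (tw_ix ok).
Local Notation Q := (gquot R).
Local Notation X := (qletter R).
Hypothesis R_tw : forall (B : galg F) (al : forall d, tw_I d -> B d),
  (forall i j l (E : (i + j)%N = l) a b, gmul E (al i a) (al j b) =
     \sum_x @tw_gam N ok F q 1 i j l a b x *: al l x) ->
  (forall r, R r -> tmor (tw_letter al) r = 0).
Hypothesis swapX : forall i j : 'I_N, (j < i)%N -> exists c, c != 0 /\
  gmul (erefl : (1 + 1)%N = 2) (X i) (X j) =
  c *: gmul (erefl : (1 + 1)%N = 2) (X j) (X i).
Hypothesis nokX : forall m, ~~ ok m -> exists w, mcontent w = m /\
  gword X w (mdeg m) = 0.

(** The relations sort words and kill the excluded ones, so that the sorted admissible words span.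
    The morphism to the model [sc_galg] sends them to its basis; it is therefore injective, and the
    constants are read off in the model. *)
Lemma presentation_has_sc :
  has_sc Q (fun i j l => @tw_gam N ok F q 1 i j l) (@tw_ups N ok F).
Proof.
have [al [al_span al_free al_mul al_one]] :=
  sc_galg_has_sc (tw_axioms ok_down ok0 q (1 : F)).
set B := sc_galg _ in al al_span al_free al_mul al_one.
pose Y := tw_letter al; have RY := R_tw al_mul.
have nf w d := gword_nf (S := fun c => c != 0) (oner_neq0 F) (@mulf_neq0 F) swapX w d.
pose al' d (a : tw_I d) : Q d := gword X (mword (tw_val a)) d.
have phi_al d a : qmor Y (al' d a) = al d a.
  rewrite (qmor_gword RY) -tw_elE; have [da _] := tw_valP a.
  exact: tw_gword_mword.
have nok0 d m : ~~ ok m -> gword X (mword m) d = 0.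
  have [<-|] := eqVneq (mdeg m) d; last by move=> /eqP md _; rewrite gword_size ?size_mword.
  move=> /nokX [w [<- w0]]; have [c [c0 E]] := nf w (mdeg (mcontent w)).
  by apply: (scalerI c0); rewrite -E w0 scaler0.
have span d (x : Q d) : exists c : tw_I d -> F, x = \sum_i c i *: al' d i.
  pose P (x : Q d) := exists c : tw_I d -> F, x = \sum_i c i *: al' d i.
  have P0 : P 0 by exists (fun=> 0); rewrite big1 // => i _; rewrite scale0r.
  have PL c x1 x2 : P x1 -> P x2 -> P (c *: x1 + x2).
    move=> [c1 ->] [c2 ->]; exists (fun i => c * c1 i + c2 i).
    rewrite scaler_sumr -big_split; apply: eq_bigr => i _ /=.
    by rewrite scalerDl scalerA.
  have [c ->] := gquot_span x; elim: (index_enum _) => [|t r IH].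
    by rewrite big_nil.
  rewrite big_cons; apply: (PL) => //; have [a [_ ->]] := nf t d.
  rewrite -[_ *: _]addr0; apply: (PL) => //.
  have [okt|nok] := boolP (ok (mcontent t)); last by rewrite nok0.
  have dt : mdeg (mcontent t) = d by rewrite mdeg_content size_tuple.
  have [y yE] := tw_val_ex dt okt.
  exists (fun z => (z == y)%:R); rewrite (bigD1 y) //= eqxx scale1r big1 ?addr0.
    by rewrite /al' yE.
  by move=> z /negbTE ->; rewrite scale0r.
have phi_inj d (x : Q d) : qmor Y x = 0 -> x = 0.
  have [c ->] := span d x; rewrite (qmor_sum RY) => h.
  rewrite big1 // => i _; rewrite (al_free d c) ?scale0r // -[RHS]h.
  by apply: eq_bigr => j _; rewrite phi_al.
exists al'; split=> //.
- move=> d c c0; apply: al_free; have := congr1 (@qmor _ _ _ Y R d) c0.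
  rewrite (qmor_sum RY) (qmor0 RY) => e; rewrite -[RHS]e; apply: eq_bigr => j _.
  by rewrite phi_al.
- move=> i j l E a b; apply/eqP; rewrite -subr_eq0; apply/eqP; apply: phi_inj.
  rewrite -scaleN1r addrC (qmor_linear RY) (qmorM RY) !phi_al al_mul (qmor_sum RY).
  rewrite (eq_bigr (fun x => tw_gam q 1 a b x *: al l x)); last by move=> x _; rewrite phi_al.
  by rewrite scaleN1r addNr.
apply/eqP; rewrite -subr_eq0; apply/eqP; apply: phi_inj.
rewrite -scaleN1r addrC (qmor_linear RY) (qmor_sum RY).
rewrite (eq_bigr (fun z => @tw_ups N ok F z *: al 0 z)); last by move=> z _; rewrite phi_al.
have -> : gone Q = gword X [::] 0 by [].
have gB : gword Y [::] 0 = gone B by [].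
by rewrite (qmor_gword RY) gB al_one scaleN1r addNr.
Qed.

End Presentation.

Lemma gideal_incl (F : fieldType) (A : galg F) (R : A 2 -> Prop) (r : A 2) :
  R r -> gideal R r.
Proof.
by move=> Rr; have := gideal_gen (add0n 2) (addn0 2) (gone A) (gone A) Rr;
  rewrite gmul1l gmul1r.
Qed.

Lemma qletterM (F : fieldType) (W : vectType F) (R : tensor_algebra W 2 -> Prop) i j :
  gmul (erefl : (1 + 1)%N = 2) (qletter R i) (qletter R j) =
  gquot_pi R (tvec2 (bvec i) (bvec j)).
Proof. by rewrite /tvec2 !tvec_bvec; exact: gquot_pi_mul. Qed.

Lemma tvec2_sum (F : fieldType) (W : vectType F) (v w : W) :
  tvec2 v w = \sum_i \sum_j (bcoord i v * bcoord j w) *: tvec2 (bvec i) (bvec j).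
Proof.
rewrite /tvec2 {1}(tvec_letter v) {1}(tvec_letter w) gmul_suml; apply: eq_bigr => i _.
rewrite gmulZl gmul_sumr scaler_sumr; apply: eq_bigr => j _.
by rewrite gmulZr scalerA !tvec_bvec.
Qed.

Lemma tmor_tvec2 (F : fieldType) (W : vectType F) (B : galg F) 
    (Y : 'I_(\dim {:W}) -> B 1) (v w : W) :
  tmor Y (tvec2 v w) = \sum_i \sum_j (bcoord i v * bcoord j w) *:
    gmul (erefl : (1 + 1)%N = 2) (Y i) (Y j).
Proof.
rewrite tvec2_sum tmor_sum; apply: eq_bigr => i _.
rewrite tmor_sum; apply: eq_bigr => j _.
by rewrite tmorZ /tvec2 tmorM !tvec_bvec !tmor_letter.
Qed.

Lemma sum_antisym (F : fieldType) (V : lmodType F) (I : finType) (T : I -> I -> V) :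
  (2%:R : F) != 0 -> (forall i j, T i j = - T j i) -> \sum_i \sum_j T i j = 0.
Proof.
move=> two TN; apply: (scalerI two); rewrite scaler0 scaler_nat mulr2n.
rewrite {2}exchange_big -big_split big1 // => i _ /=.
by rewrite -big_split big1 // => j _ /=; rewrite TN addNr.
Qed.

Definition all_mon N : pred (multinom N) := predT.
Definition sqfree N : pred (multinom N) := fun m => [forall i, (m i <= 1)%N].

Lemma sqfree_down N (a b : multinom N) : sqfree (mnm_add a b) -> sqfree a && sqfree b.
Proof.
move=> /forallP h; apply/andP; split; apply/forallP => i; apply: leq_trans (h i);
  by rewrite mnmDE ?leq_addr ?leq_addl.
Qed.

Lemma sqfree0 N : sqfree (@mnm0 N).
Proof. by apply/forallP => i; rewrite mnm0E. Qed.

Lemma sqfree1 N i : sqfree (@mnm1 N i).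
Proof. by apply/forallP => j; rewrite mnm1E; case: eqP. Qed.

Lemma sqfreePn N (m : multinom N) : ~~ sqfree m ->
  exists i m', m = mnm_add (mnm1 i) (mnm_add (mnm1 i) m').
Proof.
move=> /forallPn [i]; rewrite -ltnNge => mi.
exists i, (mnm_sub m (mnm_add (mnm1 i) (mnm1 i))); apply/mnmP => j.
rewrite !mnmDE mnmBE mnmDE mnm1E; case: eqP => [<-|_]; lia.
Qed.

Lemma symmetric_has_sc (F : fieldType) (W : vectType F) N : \dim {:W} = N ->
  has_sc (symmetric_algebra W) (fun i j l => @tw_gam N (@all_mon N) F 1 1 i j l)
    (@tw_ups N (@all_mon N) F).
Proof.
move=> <-; apply: presentation_has_sc => //.
- move=> B al al_mul _ [v [w ->]].
  rewrite tmorD -scaleN1r tmorZ scaleN1r !tmor_tvec2; apply/eqP; rewrite subr_eq0; apply/eqP.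
  rewrite [RHS]exchange_big; apply: eq_bigr => i _; apply: eq_bigr => j _ /=.
  rewrite [in RHS]mulrC !(tw_letterM _ al_mul) // !expr1n !scale1r.
  by rewrite addmC.
move=> i j _; exists 1; split; first exact: oner_neq0.
rewrite scale1r !qletterM; apply/gquot_piP/gideal_incl.
by exists (bvec i), (bvec j).
Qed.

Lemma exterior_has_sc (F : fieldType) (W : vectType F) N : (2%:R : F) != 0 ->
  \dim {:W} = N ->
  has_sc (exterior_algebra W) (fun i j l => @tw_gam N (@sqfree N) F (-1) 1 i j l)
    (@tw_ups N (@sqfree N) F).
Proof.
move=> two <-; set R := (fun r => exists w, r = tvec2 w w) : tensor_algebra W 2 -> Prop.
have R0 (w : W) : gquot_pi R (tvec2 w w) = 0.
  rewrite -(gquot_pi0 R 2); apply/gquot_piP; rewrite subr0; apply: gideal_incl.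
  by exists w.
(* Polarization of the relation of w with itself. *)
have Rswap v w : gquot_pi R (tvec2 v w) = - gquot_pi R (tvec2 w v).
  apply/eqP; rewrite -addr_eq0; have := R0 (v + w).
  have -> : tvec2 (v + w) (v + w) =
      tvec2 v v + (tvec2 v w + (tvec2 w v + tvec2 w w)) :> tensor_algebra W 2.
    have tD : tvec (v + w) = tvec v + tvec w.
      by apply/ffunP => t; rewrite !ffunE /bcoord linearD.
    by rewrite /tvec2 tD gmulDl1 !gmulDr1 -addrA.
  have pD (f g : tensor_algebra W 2) : gquot_pi R (f + g) = gquot_pi R f + gquot_pi R g.
    by rewrite -[f]scale1r gquot_piL !scale1r.
  by rewrite !pD !R0 add0r addr0 => /eqP.
apply: presentation_has_sc.
- exact: sqfree_down.
- exact: sqfree0.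
- exact: sqfree1.
- move=> B al al_mul _ [w ->]; rewrite tmor_tvec2; apply: sum_antisym => // i j.
  rewrite !(tw_letterM _ al_mul); try exact: sqfree1.
  rewrite [mnm_add (mnm1 j) _]addmC [bcoord j w * _]mulrC.
  case: (ltngtP i j) => ij; rewrite ?expr1 ?expr0 ?scale1r ?scaleN1r ?scalerN ?opprK //.
  rewrite tw_el0 ?scaler0 ?oppr0 //; apply/negP => /forallP /(_ i).
  by rewrite mnmDE !mnm1E (val_inj ij) eqxx.
- move=> i j _; exists (-1); rewrite oppr_eq0 oner_neq0; split=> //.
  by rewrite !qletterM scaleN1r Rswap.
move=> m /sqfreePn [i [m' mE]]; exists (i :: i :: mword m'); split.
  by rewrite !mcontent_cons mwordK -mE.
(* Two equal letters in front have product 0, which is an exchange with factor c = 0. *)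
rewrite (@gword_swap _ _ _ _ 0) ?scale0r //.
by rewrite qletterM R0.
Qed.

(** * Divisibility by monomials and the global sections of O(s) *)

Section Monomials.
Variables (n : nat) (R : comNzRingType).
Local Notation X := (@mpolyX n R).

Lemma mcoeff_sumX (s : seq (multinom n)) (c : multinom n -> R) m : uniq s ->
  mcoeff m (\sum_(a <- s) c a *: X a) = if m \in s then c m else 0.
Proof.
move=> us; rewrite raddf_sum /=; case: ifP => ms.
  rewrite (bigD1_seq m) //= mcoeffZ mcoeffX eqxx mulr1 big1 ?addr0 //.
  by move=> a /negbTE am; rewrite mcoeffZ mcoeffX am mulr0.
rewrite big_seq big1 // => a sa; rewrite mcoeffZ mcoeffX.
by case: eqP => [am|]; rewrite ?mulr0 //; move: ms; rewrite -am sa.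
Qed.

Lemma mcoeffXM m (p : mpoly n R) a :
  mcoeff a (X m * p) = if lem m a then mcoeff (mnm_sub a m) p else 0.
Proof.
case: ifP => [ma|nma].
  have -> : mcoeff a (X m * p) = mcoeff (mnm_add m (mnm_sub a m)) (p * X m).
    by rewrite mulrC addmC submK.
  exact: mcoeffMX.
apply/eqP; apply: contraFT nma; rewrite mulrC -mcoeff_msupp.
by rewrite (perm_mem (msuppMX _ _)) => /mapP [m' _ ->]; exact: lem_addr.
Qed.

Lemma mpoly_divX m (p : mpoly n R) :
  (forall a, mcoeff a p != 0 -> lem m a) -> exists p', p = X m * p'.
Proof.
move=> h; exists (\sum_(a <- msupp p) mcoeff a p *: X (mnm_sub a m)).
rewrite {1}[p]mpolyE mulr_sumr big_seq [RHS]big_seq; apply: eq_bigr => a.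
by rewrite mcoeff_msupp => /h ma; rewrite -scalerAr -mpolyXD addmC submK.
Qed.

End Monomials.

Section Sections.
Variables (k : fieldType) (V : vectType k) (U : {vspace bilin V}).
Local Notation m := (\dim U).
Local Notation X := (@mpolyX m k).

(** Comparing the chart of i0 with that of another variable shows that x_i0 ^ N divides every
    monomial of the numerator. When m = 1 there is no other chart: for s >= 0 the degree gives the
    divisibility, while negative twists do have nonzero sections on a point. *)
Lemma PU_sections_poly s g (i0 : 'I_m) : PU_sections (U := U) s g ->
  (forall d : nat, s = d%:Z -> exists p : mpoly m k, g = tofrac p /\
     forall a, mcoeff a p != 0 -> mdeg a = d) /\
  ((1 < m)%N -> s < 0 -> g = 0).
Proof.
move=> gs; have [N [d [p [hp E e]]]] := gs i0.
have yN (i : 'I_m) M : PU_var i ^+ M = tofrac (X (mnm_muln (mnm1 i) M)).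
  by rewrite /PU_var -tofracXn mpolyXn.
have hpd a : mcoeff a p != 0 -> mdeg a = d.
  by rewrite -mcoeff_msupp => /(dhomogP _ _ _ hp).
have pN : (1 < m)%N \/ 0 <= s -> forall a, mcoeff a p != 0 -> (N <= a i0)%N.
  case: (ltnP 1 m) => [m1 _|m1 [//|s0]] a pa; last first.
    rewrite -(hpd a pa) mdegE (bigD1 i0) //= big1 ?addn0 in E.
      by lia.
    move=> i /eqP ii0; case: ii0; apply: val_inj => /=.
    by have := ltn_ord i; have := ltn_ord i0; lia.
  have [j ji] : exists j : 'I_m, j != i0.
    have [z|z] := eqVneq i0 (Ordinal (ltnW m1)).
      by exists (Ordinal m1); rewrite z.
    by exists (Ordinal (ltnW m1)); rewrite eq_sym.
  have [N' [d' [p' [_ _ e']]]] := gs j.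
  have /eqP : tofrac (X (mnm_muln (mnm1 j) N') * p) =
      tofrac (X (mnm_muln (mnm1 i0) N) * p').
    by rewrite !tofracM -!yN -e -e' mulrCA mulrA mulrAC [RHS]mulrC mulrAC.
  rewrite tofrac_eq => /eqP /(congr1 (mcoeff (mnm_add (mnm_muln (mnm1 j) N') a))).
  rewrite mcoeffXM lem_addr addmC addmK => pE; move: pa; rewrite pE mcoeffXM.
  case: ifP => [/mnm_lepP /(_ i0)|]; last by rewrite eqxx.
  by rewrite mnmDE !mulmnE !mnm1E eqxx (negbTE ji) mul1n mul0n addn0.
have gE p'' : p = X (mnm_muln (mnm1 i0) N) * p'' -> g = tofrac p''.
  move=> pE; have X0 : tofrac (X (mnm_muln (mnm1 i0) N)) != 0.
    by rewrite tofrac_eq0 -msize_poly_eq0 msizeX.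
  by apply: (mulfI X0); rewrite -tofracM -pE -e yN mulrC.
split=> [d0 sE|m1 s0].
  have [|p'' pE] := @mpoly_divX _ _ (mnm_muln (mnm1 i0) N) p.
    move=> a pa; apply/mnm_lepP => i; rewrite mulmnE mnm1E.
    case: eqP => [<-|_]; rewrite ?mul0n // mul1n; apply: pN => //; right; by rewrite sE.
  exists p''; split; first exact: gE.
  move=> a p''a; have : mcoeff (mnm_add (mnm_muln (mnm1 i0) N) a) p != 0.
    by rewrite pE mcoeffXM lem_addr addmC addmK.
  move/hpd; rewrite mdegD mdegMn mdeg1 mul1n; move: E; rewrite sE; lia.
have p0 : p = 0.
  apply/mpolyP => a; rewrite mcoeff0; apply/eqP; apply: contraT => pa.
  have := pN (or_introl m1) a pa; have := hpd a pa; rewrite mdegE (bigD1 i0) //=.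
  by move: E s0; lia.
by rewrite (gE 0) ?tofrac0 // mulr0 p0.
Qed.

End Sections.

Definition ext_basis (K : fieldType) n (J : {set 'I_n}) : ext_type K n :=
  [ffun J' : {set 'I_n} => (J' == J)%:R].

Definition modd n (a : multinom n) : {set 'I_n} := [set i | odd (a i)].

(** * The coordinate algebra *)

Section CliffordBasis.
Variables (k : fieldType) (V : vectType k) (U : {vspace bilin V}).
Local Notation n := (\dim {:V}).
Local Notation m := (\dim U).
Local Notation X := (@mpolyX m k).
Hypothesis mn : m = n.
Hypothesis n_gt0 : (0 < n)%N.
Implicit Types (J : {set 'I_n}) (a : multinom n) (y : multinom m).

(* The exponent a stands for the product of the monomial of exponent
   [mhalf a] in the coordinates of P(U) and the basis vector [modd a]. *)
Definition mhalf a : multinom m := Multinom [tuple (a (cast_ord mn i))./2 | i < m].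
Definition mjoin J y : multinom n :=
  Multinom [tuple ((y (cast_ord (esym mn) i)).*2 + (i \in J))%N | i < n].

Lemma mhalf_join J y : mhalf (mjoin J y) = y.
Proof.
apply/mnmP => i; rewrite !mnmE cast_ordK halfD odd_double doubleK.
by case: (_ \in J); rewrite /= !addn0.
Qed.
Lemma modd_join J y : modd (mjoin J y) = J.
Proof. by apply/setP => i; rewrite !inE mnmE oddD odd_double; case: (i \in J). Qed.
Lemma mjoinK a : mjoin (modd a) (mhalf a) = a.
Proof.
apply/mnmP => i; rewrite !mnmE cast_ordKV inE addnC; exact: odd_double_half.
Qed.

Lemma mdeg_half a : mdeg (mhalf a) = half_deg a.
Proof.
rewrite mdegE /half_deg (reindex (cast_ord mn)) /=.
  by apply: eq_bigr => i _; rewrite mnmE.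
by exists (cast_ord (esym mn)) => i _; rewrite ?cast_ordK ?cast_ordKV.
Qed.

Lemma mdeg_split a : mdeg a = (#|modd a| + (mdeg (mhalf a)).*2)%N.
Proof.
rewrite mdeg_half /half_deg mdegE -sum1_card [X in (X + _)%N]big_mkcond.
rewrite -mul2n big_distrr -big_split /=.
apply: eq_bigr => i _; rewrite inE /= mul2n -{1}(odd_double_half (a i)).
by case: odd.
Qed.

Lemma mdeg_join J y : mdeg (mjoin J y) = (#|J| + (mdeg y).*2)%N.
Proof. by rewrite mdeg_split mhalf_join modd_join. Qed.

Lemma PU_sections_mon y : PU_sections (U := U) (mdeg y)%:Z (tofrac (X y)).
Proof.
move=> i; exists 0, (mdeg y), (X y); split; rewrite ?mulr1 //.
by rewrite dhomogX.
Qed.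

Definition clb_val a : ext_type (PU_frac U) n :=
  (tofrac (X (mhalf a)) : PU_frac U) *: ext_basis _ (modd a).

Lemma clb_valE a J :
  clb_val a J = tofrac (if J == modd a then X (mhalf a) else 0).
Proof.
rewrite !ffunE; case: eqP => _; first by rewrite /GRing.scale /= mulr1.
by rewrite scaler0 tofrac0.
Qed.

Lemma clb_subproof d (a : tw_ix (@all_mon n) d) : @cl_pred _ V U d (clb_val (tw_val a)).
Proof.
apply/asboolP => J; rewrite clb_valE; case: eqP => [->|_]; last first.
  by right; rewrite tofrac0.
left; exists (mdeg (mhalf (tw_val a)))%:Z; split; last exact: PU_sections_mon.
have [da _] := tw_valP a.
by rewrite -{1}da mdeg_split PoszD -mul2n PoszM.
Qed.
Definition clb d (a : tw_ix (@all_mon n) d) : cl_sections U d :=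
  ClSections (clb_subproof a).

Lemma cl_poly d (x : cl_sections U d) J : exists p : mpoly m k,
  cl_val x J = tofrac p /\
  forall y, mcoeff y p != 0 -> d = (#|J| + (mdeg y).*2)%N.
Proof.
have i0 : 'I_m by rewrite mn; exact: Ordinal n_gt0.
have [[s [ds Hs]]|->] := cl_degree x J; last first.
  by exists 0; rewrite tofrac0; split=> // y; rewrite mcoeff0 eqxx.
have [spos sneg] := PU_sections_poly i0 Hs; case: s ds Hs spos sneg => s ds Hs spos sneg.
  have [p [-> hp]] := spos s erefl; exists p; split=> // y /hp ys.
  by move: ds; rewrite ys -mul2n; lia.
(* As d = |J| + 2 s is not negative, s < 0 forces |J| >= 2, hence m = n > 1. *)
rewrite sneg //; first by exists 0; rewrite tofrac0; split=> // y; rewrite mcoeff0 eqxx.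
have Jn : (#|J| <= n)%N by rewrite -[X in (_ <= X)%N]card_ord max_card.
by move: ds; rewrite mn NegzE; lia.
Qed.

Lemma cl_val_sum d (T : Type) (r : seq T) (F : T -> cl_sections U d) :
  cl_val (\sum_(t <- r) F t) = \sum_(t <- r) cl_val (F t).
Proof. by apply: (big_morph (@cl_val _ _ U d)). Qed.

Lemma clb_sum d (c : tw_ix (@all_mon n) d -> k) J :
  cl_val (\sum_a c a *: clb a) J =
  tofrac (\sum_(a | modd (tw_val a) == J) c a *: X (mhalf (tw_val a))).
Proof.
rewrite cl_val_sum sum_ffunE rmorph_sum [RHS]big_mkcond; apply: eq_bigr => a _.
rewrite ffunE clb_valE eq_sym; case: ifP => _; last by rewrite tofrac0 scaler0.
by rewrite /GRing.scale /= /PU_const -tofracM mul_mpolyC.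
Qed.

Lemma clb_expand d (x : cl_sections U d) (P : {set 'I_n} -> mpoly m k) :
  (forall J, cl_val x J = tofrac (P J)) ->
  x = \sum_a mcoeff (mhalf (tw_val a)) (P (modd (tw_val a))) *: clb a.
Proof.
move=> xP; apply: val_inj; apply/ffunP => J.
rewrite [RHS]clb_sum [LHS]xP; congr tofrac; apply/mpolyP => y.
rewrite raddf_sum /= -[LHS](_ : \sum_(a : tw_ix (@all_mon n) d |
  tw_val a == mjoin J y) mcoeff y (P J) = _).
  rewrite [LHS]big_mkcond [RHS]big_mkcond; apply: eq_bigr => a _.
  rewrite mcoeffZ mcoeffX; case: (tw_val a =P _) => [->|na].
    by rewrite modd_join mhalf_join !eqxx mulr1.
  case: eqP => // aJ; case: eqP => [ay|_]; rewrite ?mulr0 //.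
  by case: na; rewrite -aJ -ay mjoinK.
rewrite (@tw_sum n (@all_mon n) d k (mjoin J y) (fun=> mcoeff y (P J))).
case: ifP => // h; apply/esym/eqP; apply: contraFT h => nz; rewrite andbT mdeg_join.
have [p [pE hp]] := cl_poly x J; rewrite (hp y) //.
suff -> : p = P J by [].
by apply/eqP; rewrite -tofrac_eq -pE xP.
Qed.

Lemma clb_free d (c : tw_ix (@all_mon n) d -> k) :
  \sum_a c a *: clb a = 0 -> forall b, c b = 0.
Proof.
move=> c0 a0; have := congr1 (fun x => cl_val x (modd (tw_val a0))) c0.
rewrite clb_sum [in RHS]ffunE => /eqP; rewrite tofrac_eq0 => /eqP.
move/(congr1 (mcoeff (mhalf (tw_val a0)))); rewrite mcoeff0 raddf_sum /=.
rewrite (bigD1 a0) //= mcoeffZ mcoeffX eqxx mulr1 big1 ?addr0 // => a /andP [/eqP aJ aa].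
rewrite mcoeffZ mcoeffX; case: eqP => [ah|_]; rewrite ?mulr0 //.
by case/eqP: aa; apply: tw_val_inj; rewrite -(mjoinK (tw_val a)) aJ ah mjoinK.
Qed.

End CliffordBasis.

Section ExtBasis.
Variables (K : fieldType) (n : nat).
Local Notation ebe := (@ext_basis K n).
Local Notation ext := (ext_type K n).

Definition evec (i : 'I_n) : 'rV[K]_n := delta_mx 0 i.

Lemma ext_mulb_linearP i (a : K) (x y : ext) :
  ext_mulb i (a *: x + y) = a *: ext_mulb i x + ext_mulb i y.
Proof.
apply/ffunP=> J; rewrite !ffunE; case: ifP => _.
  by rewrite mulrDr; congr (_ + _); exact: mulrCA.
by rewrite scaler0 addr0.
Qed.

Lemma ext_mulv_delta i (x : ext) : ext_mulv (evec i) x = ext_mulb i x.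
Proof.
rewrite /ext_mulv (bigD1 i) //= mxE !eqxx scale1r big1 ?addr0 //.
by move=> j /negbTE ji; rewrite mxE ji scale0r.
Qed.

Lemma ext_basis_sum (x : ext) : x = \sum_J (x J : K) *: ebe J.
Proof.
apply/ffunP=> J; rewrite sum_ffunE (bigD1 J) //= !ffunE eqxx.
rewrite big1 ?addr0; first by rewrite /GRing.scale /= mulr1.
by move=> J' /negbTE JJ'; rewrite !ffunE eq_sym JJ' scaler0.
Qed.

Lemma ext_mulb_basis i J : ext_mulb i (ebe J) =
  (if i \in J then 0 else ext_sign K i (i |: J)) *: ebe (i |: J).
Proof.
apply/ffunP=> J'; rewrite !ffunE.
have [->|JJ] := eqVneq J' (i |: J).
  rewrite setU11 /GRing.scale /= mulr1; case: ifP => iJ.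
    rewrite (_ : _ == J = false) ?mulr0 //; apply/negP => /eqP /setP /(_ i).
    by rewrite !inE eqxx iJ.
  by rewrite setU1K ?iJ // eqxx mulr1.
rewrite scaler0; case: ifP => // iJ'; case: eqP => [E|_]; rewrite ?mulr0 //.
by move: JJ; rewrite -E setD1K // eqxx.
Qed.

Lemma wedge_sorted (s : seq 'I_n) : sorted (fun i j : 'I_n => (i < j)%N) s ->
  wedge (map evec s) = ebe [set i in s].
Proof.
elim: s => [_|i s IH ss] /=.
  by apply/ffunP => J; rewrite !ffunE; congr (_ == _)%:R; apply/setP => j; rewrite !inE.
rewrite -/(wedge _) IH ?(path_sorted ss) // ext_mulv_delta ext_mulb_basis.
have mins : forall j, j \in s -> (i < j)%N.
  by apply/allP; apply: (order_path_min _ ss) => a b c; exact: ltn_trans.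
rewrite inE; case: ifP => [/mins|_]; first by rewrite ltnn.
have -> : i |: [set j in s] = [set j in i :: s].
  by apply/setP => j; rewrite !inE.
rewrite /ext_sign big1 ?scale1r // => j; rewrite !inE => /orP [/eqP ->|/mins ij].
  by rewrite ltnn.
by rewrite ltnNge (ltnW ij).
Qed.

Lemma sorted_enum (J : {set 'I_n}) : sorted (fun i j : 'I_n => (i < j)%N) (enum J).
Proof.
rewrite /enum_mem -enumT; apply: sorted_filter; first by move=> a b c; exact: ltn_trans.
have := iota_ltn_sorted 0 n; rewrite -val_enum_ord sorted_map; exact: sub_sorted.
Qed.

Lemma set_enum (J : {set 'I_n}) : [set i in enum J] = J.
Proof. by apply/setP => j; rewrite inE mem_enum. Qed.

Lemma wedge_enum (J : {set 'I_n}) : wedge (map evec (enum J)) = ebe J.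
Proof.
by rewrite wedge_sorted ?set_enum //; exact: sorted_enum.
Qed.

Lemma ext_mulb_foldr (s : seq 'I_n) J : sorted (fun i j : 'I_n => (i < j)%N) s ->
  foldr (@ext_mulb K n) (ebe J) s =
  (if has (mem J) s then 0 else
     \prod_(i <- s) \prod_(j in J) (if (j < i)%N then -1 else 1)) *:
  ebe ([set i in s] :|: J).
Proof.
elim: s => [_|i s IH ss].
  rewrite /= big_nil scale1r; congr ebe; apply/setP => j; by rewrite !inE.
rewrite /= IH ?(path_sorted ss) //.
have mins : forall j, j \in s -> (i < j)%N.
  by apply/allP; apply: (order_path_min _ ss) => a b c; exact: ltn_trans.
set c := (if has _ _ then _ else _).
have -> : ext_mulb i (c *: ebe ([set i0 in s] :|: J)) = c *: ext_mulb i (ebe ([set i0 in s] :|: J)).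
  rewrite -[c *: ebe _]addr0 ext_mulb_linearP.
  rewrite [ext_mulb i 0](_ : _ = 0) ?addr0 //.
  by apply/ffunP => L; rewrite !ffunE mulr0 if_same.
rewrite ext_mulb_basis scalerA !inE.
have -> : i |: ([set i0 in s] :|: J) = [set i0 in i :: s] :|: J.
  by apply/setP => j; rewrite !inE orbA.
congr (_ *: _); rewrite {}/c.
case: (boolP (i \in s)) => [/mins|_] /=; first by rewrite ltnn.
case: (boolP (i \in J)) => iJ /=; first by rewrite mulr0.
case: ifP => _; first by rewrite mul0r.
rewrite big_cons mulrC; congr (_ * _).
rewrite /ext_sign big_mkcond [RHS]big_mkcond; apply: eq_bigr => j _.
rewrite !inE; case: (boolP (j \in J)) => [|_]; first by rewrite orbT.
rewrite orbF; case: ifP => // /orP [/eqP ->|/mins ij]; first by rewrite ltnn.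
by rewrite ltnNge (ltnW ij).
Qed.

End ExtBasis.

Section CliffordSymbol.
Variables (k : fieldType) (V : vectType k) (U : {vspace bilin V}).
Hypothesis symU : symmetric_forms U.
Local Notation n := (\dim {:V}).
Local Notation m := (\dim U).
Local Notation K := (PU_frac U).
Local Notation X := (@mpolyX m k).
Local Notation mul := (cl_mul symU).
Local Notation ev := (@evec K n).
Local Notation ebe := (@ext_basis K n).
Local Notation ebk := (@ext_basis k n).
Local Notation ext := (ext_type K n).
Implicit Types (x y : ext) (z : ext_type k n) (J : {set 'I_n}).

Lemma cl_mulL a x x' y : mul (a *: x + x') y = a *: mul x y + mul x' y.
Proof. by case: (cl_mulP symU) => [[]]. Qed.
Lemma cl_mulR a x y y' : mul x (a *: y + y') = a *: mul x y + mul x y'.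
Proof. by case: (cl_mulP symU) => [[]]. Qed.
Lemma cl_mul0l y : mul 0 y = 0.
Proof. by have := cl_mulL (-1) 0 0 y; rewrite scaler0 addr0 scaleN1r addNr. Qed.
Lemma cl_mul0r x : mul x 0 = 0.
Proof. by have := cl_mulR (-1) x 0 0; rewrite scaler0 addr0 scaleN1r addNr. Qed.
Lemma cl_mulZl a x y : mul (a *: x) y = a *: mul x y.
Proof. by rewrite -[a *: x]addr0 cl_mulL cl_mul0l addr0. Qed.
Lemma cl_mulZr a x y : mul x (a *: y) = a *: mul x y.
Proof. by rewrite -[a *: y]addr0 cl_mulR cl_mul0r addr0. Qed.
Lemma cl_mul_sumr (I : Type) (r : seq I) (c : I -> K) (F : I -> ext) x :
  mul x (\sum_(i <- r) c i *: F i) = \sum_(i <- r) c i *: mul x (F i).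
Proof.
elim: r => [|i r IH]; first by rewrite !big_nil cl_mul0r.
by rewrite !big_cons cl_mulR IH.
Qed.
Lemma cl_mul_suml (I : Type) (r : seq I) (c : I -> K) (F : I -> ext) x :
  mul (\sum_(i <- r) c i *: F i) x = \sum_(i <- r) c i *: mul (F i) x.
Proof.
elim: r => [|i r IH]; first by rewrite !big_nil cl_mul0l.
by rewrite !big_cons cl_mulL IH.
Qed.

(* [z] is the specialization of [x] at the zero form, for which the Clifford
   product is the exterior product. *)
Definition ext_spec x z : Prop :=
  forall J, exists p : mpoly m k, x J = tofrac p /\ mcoeff (@mnm0 m) p = z J.

Lemma ext_spec0 : ext_spec 0 0.
Proof. by move=> J; exists 0; rewrite !ffunE tofrac0 mcoeff0. Qed.

Lemma mcoeff0M (p q : mpoly m k) :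
  mcoeff (@mnm0 m) (p * q) = mcoeff (@mnm0 m) p * mcoeff (@mnm0 m) q.
Proof. exact: (rmorphM (mcoeff (@mnm0 m))). Qed.

Lemma ext_specL p x z x' z' : ext_spec x z -> ext_spec x' z' ->
  ext_spec ((tofrac p : K) *: x + x') (mcoeff (@mnm0 m) p *: z + z').
Proof.
move=> h h' J; have [q [xq qz]] := h J; have [q' [xq' qz']] := h' J.
exists (p * q + q'); rewrite !ffunE xq xq' tofracD tofracM; split=> //.
by rewrite mcoeffD mcoeff0M qz qz'.
Qed.

Lemma ext_specD x z x' z' : ext_spec x z -> ext_spec x' z' -> ext_spec (x + x') (z + z').
Proof.
move=> h h'; have := ext_specL 1 h h'.
by rewrite tofrac1 mcoeff1 eqxx !scale1r.
Qed.

Lemma ext_specZ p x z : ext_spec x z ->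
  ext_spec ((tofrac p : K) *: x) (mcoeff (@mnm0 m) p *: z).
Proof. by move=> h; have := ext_specL p h ext_spec0; rewrite !addr0. Qed.

Lemma ext_spec_sum (I : Type) (r : seq I) (F : I -> ext) (G : I -> ext_type k n) :
  (forall i, ext_spec (F i) (G i)) ->
  ext_spec (\sum_(i <- r) F i) (\sum_(i <- r) G i).
Proof.
move=> h; elim: r => [|i r IH]; first by rewrite !big_nil; exact: ext_spec0.
by rewrite !big_cons; exact: ext_specD.
Qed.

Lemma ext_spec_mulb i x z : ext_spec x z -> ext_spec (ext_mulb i x) (ext_mulb i z).
Proof.
move=> h J; have [q [xq qz]] := h (J :\ i).
exists (if i \in J then (ext_sign k i J)%:A * q else 0).
rewrite !ffunE; case: ifP => _; last by rewrite tofrac0 mcoeff0.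
rewrite xq tofracM -scalerAl mul1r mcoeffZ qz; split=> //; congr (_ * _).
rewrite /ext_sign; elim/big_ind2: _ => [|a b a' b' -> ->|j _].
- by rewrite scale1r tofrac1.
- by rewrite -tofracM -scalerAl mul1r scalerA.
by case: ifP => _; rewrite ?scale1r ?scaleN1r ?tofracN tofrac1.
Qed.

Lemma ext_spec_basis J : ext_spec (ebe J) (ebk J).
Proof.
move=> J'; exists (J' == J)%:R; rewrite !ffunE; case: eqP => _.
  by rewrite tofrac1 mcoeff1 eqxx.
by rewrite tofrac0 mcoeff0.
Qed.

(** The values of the universal form are linear forms on U, which vanish at the zero form:
    contractions disappear under specialization. *)
Lemma universal_form_spec i j : exists p : mpoly m k,
  bilf (universal_form U) (ev i) (ev j) = tofrac p /\
  mcoeff (@mnm0 m) p = 0.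
Proof.
have -> : bilf (universal_form U) (ev i) (ev j) = universal_form U i j.
  by rewrite /bilf /evec -rowE mxE (bigD1 j) //= big1 ?addr0 => [|l /negbTE lj];
    rewrite !mxE ?eqxx ?mulr1 // ?lj ?andbF ?mulr0.
exists (\sum_(l < m) mpolyC m (bilin_eval (vbasis U)`_l (bvec i) (bvec j)) * X (mnm1 l)).
split; first by rewrite mxE rmorph_sum; apply: eq_bigr => l _; rewrite /PU_const /PU_var -tofracM.
rewrite raddf_sum big1 // => l _ /=.
by rewrite mcoeff0M mcoeffX mnm1_eq0 mulr0.
Qed.

Lemma map_drop_nth t (s : seq 'I_n) :
  drop_nth t (map ev s) = map ev (take t s ++ drop t.+1 s).
Proof. by rewrite /drop_nth map_cat map_take map_drop. Qed.

(* The terms of lower exterior degree in a Clifford product have coefficients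
   without constant term. *)
Lemma cl_lower_spec i (s : seq 'I_n) (f : seq 'I_n -> ext) :
  (forall t, (t < size s)%N -> exists z, ext_spec (f (take t s ++ drop t.+1 s)) z) ->
  ext_spec (\sum_(t < size (map ev s))
    ((-1) ^+ t * bilf (universal_form U) (ev i) (nth 0 (map ev s) t)) *:
     f (take t s ++ drop t.+1 s)) 0.
Proof.
move=> fs; have -> : (0 : ext_type k n) = \sum_(t < size (map ev s)) 0.
  by rewrite big1.
apply: ext_spec_sum => t; have ts : (t < size s)%N by rewrite -(size_map ev).
have [z zE] := fs t ts; rewrite (nth_map i) //.
have [p [-> p0]] := universal_form_spec i (nth i s t).
have -> : (-1) ^+ t * tofrac p = tofrac ((-1) ^+ t * p) :> K.
  by rewrite tofracM rmorphXn rmorphN1.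
by have := ext_specZ ((-1) ^+ t * p) zE; rewrite mcoeff0M p0 mulr0 scale0r.
Qed.

Lemma cl_mul_vec_spec i x z : ext_spec x z ->
  ext_spec (mul (wedge [:: ev i]) x) (ext_mulb i z).
Proof.
move=> h; rewrite [x]ext_basis_sum [z]ext_basis_sum cl_mul_sumr.
have -> : ext_mulb i (\sum_J (z J : k) *: ebk J) = \sum_J (z J : k) *: ext_mulb i (ebk J).
  have lin : forall (c : k) a b, ext_mulb i (c *: a + b) = c *: ext_mulb i a + ext_mulb i b.
    exact: ext_mulb_linearP.
  have m0 : ext_mulb i (0 : ext_type k n) = 0.
    by apply/ffunP => L; rewrite !ffunE mulr0 if_same.
  by elim: (index_enum _) => [|J r IH]; rewrite ?big_nil // !big_cons lin IH.
apply: ext_spec_sum => J; have [p [-> <-]] := h J; apply: ext_specZ.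
rewrite -{1}(wedge_enum K J); have [_ _ _ _ ->] := cl_mulP symU.
rewrite /= -/(wedge _) wedge_enum ext_mulv_delta -[ext_mulb i (ebk J)]addr0.
apply: ext_specD; first exact/ext_spec_mulb/ext_spec_basis.
under eq_bigr => t _ do rewrite map_drop_nth.
apply: (@cl_lower_spec i (enum J) (fun s => wedge (map ev s))) => t _.
elim: (_ ++ _) => [|j s [z' IH]] /=.
  exists (ext_one k n) => L; exists (L == set0)%:R; rewrite !ffunE.
  by case: eqP => _; rewrite ?tofrac1 ?mcoeff1 ?eqxx ?tofrac0 ?mcoeff0.
by exists (ext_mulb j z'); rewrite ext_mulv_delta; exact: ext_spec_mulb.
Qed.

(** The wedge of i :: s is the Clifford product of the vector i with the wedge of s, up to
    contractions. These involve shorter words, and their coefficients vanish at the zero form. *)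
Lemma cl_mul_wedge_spec (s : seq 'I_n) x z : ext_spec x z ->
  ext_spec (mul (wedge (map ev s)) x) (foldr (@ext_mulb k n) z s).
Proof.
have [N] := ubnP (size s); elim: N s => // N IH [|i s] sN h.
  by have [_ _ E _ _] := cl_mulP symU; rewrite [mul _ _]E.
rewrite ltnS /= in sN.
have [_ mulA _ _ mulV] := cl_mulP symU.
have := mulV (ev i) (map ev s); rewrite -/(wedge (map ev (i :: s))) => e.
set S := \sum_(t < _) _ in e.
have {e} -> : wedge (map ev (i :: s)) =
    mul (wedge [:: ev i]) (wedge (map ev s)) - S by rewrite e addrK.
rewrite -scaleN1r addrC cl_mulL scaleN1r -mulA addrC -[foldr _ _ _]subr0.
apply: ext_specD.
  by apply: cl_mul_vec_spec; apply: IH.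
rewrite oppr0; suff h0 : ext_spec (mul S x) 0.
  by have := ext_specZ (-1) h0; rewrite scaler0 tofracN tofrac1 scaleN1r.
rewrite /S cl_mul_suml; under eq_bigr => t _ do rewrite map_drop_nth.
apply: (@cl_lower_spec i s (fun s' => mul (wedge (map ev s')) x)) => t ts.
exists (foldr (@ext_mulb k n) z (take t s ++ drop t.+1 s)); apply: IH => //.
rewrite size_cat size_take size_drop ts; lia.
Qed.

End CliffordSymbol.

(** The sign only depends on the parities of the exponents, and is the one of the exterior product
    of the monomials [modd a] and [modd b]. *)
Lemma sign_inversions (R : comNzRingType) n (a b : multinom n) :
  (-1) ^+ inversions a b =
  \prod_(i <- enum (modd a)) \prod_(j in modd b) (if (j < i)%N then -1 else 1) :> R.
Proof.
have expN (I : finType) (P : pred I) (F : I -> nat) :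
    (-1) ^+ (\sum_(i | P i) F i) = \prod_(i | P i) (-1) ^+ F i :> R.
  by apply: (big_morph (fun e => (-1) ^+ e : R)) => // e e'; rewrite exprD.
rewrite big_enum /inversions expN [RHS]big_mkcond; apply: eq_bigr => i _.
rewrite expN [in RHS]inE big_mkcond [in RHS]big_mkcond.
case: ifP => ai; last first.
  by rewrite big1 // => j _; case: ifP => // _; rewrite -signr_odd oddM ai expr0.
apply: eq_bigr => j _; rewrite inE; case: ifP => _; last by rewrite if_same.
by rewrite -signr_odd oddM ai /=; case: odd.
Qed.

Lemma squares_disjoint n (a b : multinom n) :
  has (mem (modd b)) (enum (modd a)) = (squares a b != 0%N).
Proof.
rewrite /squares sum_nat_eq0 negb_forall; apply/hasP/existsP => [[i]|[i]].
  by rewrite mem_enum /= !inE => ai bi; exists i; rewrite /= ai bi.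
rewrite /= eqb0 negbK => /andP [ai bi]; exists i; rewrite ?mem_enum /= inE //.
Qed.

Section CoordinateAlgebra.
Variables (k : fieldType) (V : vectType k) (U : {vspace bilin V}).
Hypothesis symU : symmetric_forms U.
Local Notation n := (\dim {:V}).
Local Notation m := (\dim U).
Hypothesis mn : m = n.
Hypothesis n_gt0 : (0 < n)%N.
Local Notation K := (PU_frac U).
Local Notation X := (@mpolyX m k).
Local Notation ok := (@all_mon n).

Lemma mhalf_add_disjoint (a b : multinom n) : squares a b = 0%N ->
  mhalf mn (mnm_add a b) = mnm_add (mhalf mn a) (mhalf mn b) /\
  modd (mnm_add a b) = modd a :|: modd b.
Proof.
move=> /eqP; rewrite /squares sum_nat_eq0 => /forallP ab.
have {}ab i : ~~ (odd (a i) && odd (b i)) by have := ab i; rewrite /= eqb0.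
split; first by apply/mnmP => i; rewrite !(mnmDE, mnmE) halfD (negbTE (ab _)).
by apply/setP => i; rewrite !inE mnmDE oddD; move: (ab i); do 2!case: odd.
Qed.

Lemma ok_down (a b : multinom n) : ok (mnm_add a b) -> ok a && ok b.
Proof. by []. Qed.

(** The weight is the degree in the coordinates of P(U). A product of basis elements is the product
    of their polynomial parts times the coefficients [C] of a Clifford product of exterior
    monomials; the terms of [C] without gain of weight are its constant terms, which form the
    exterior product. *)
Lemma coordinate_algebra_rees :
  fibers_of_one_family (tw_galg ok_down isT (-1) (0 : k)) (coordinate_algebra symU).
Proof.
have /choice [C CE] (JJ : {set 'I_n} * {set 'I_n}) : exists C : {set 'I_n} -> mpoly m k,
    forall L, cl_mul symU (ext_basis K JJ.1) (ext_basis K JJ.2) L = tofrac (C L) /\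
      mcoeff (@mnm0 m) (C L) =
        foldr (@ext_mulb k n) (ext_basis k JJ.2) (enum JJ.1) L.
  have h := cl_mul_wedge_spec symU (enum JJ.1) (ext_spec_basis U JJ.2).
  rewrite wedge_enum in h; by have [C0 C0E] := choice h; exists C0.
pose P (a b : multinom n) L :=
  X (mnm_add (mhalf mn a) (mhalf mn b)) * C (modd a, modd b) L.
pose gam i j l (a : tw_ix ok i) (b : tw_ix ok j) (x : tw_ix ok l) : k :=
  mcoeff (mhalf mn (tw_val x)) (P (tw_val a) (tw_val b) (modd (tw_val x))).
pose w d (a : tw_ix ok d) := half_deg (tw_val a).
have gamE i j l (a : tw_ix ok i) (b : tw_ix ok j) (x : tw_ix ok l) :
    let h := mnm_add (mhalf mn (tw_val a)) (mhalf mn (tw_val b)) in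
    gam i j l a b x = if lem h (mhalf mn (tw_val x)) then
      mcoeff (mnm_sub (mhalf mn (tw_val x)) h)
        (C (modd (tw_val a), modd (tw_val b)) (modd (tw_val x))) else 0.
  by rewrite /gam /P mcoeffXM.
apply: (@rees_family k _ w gam (@tw_ups n ok k)).
- exists (fun d a => clb mn a : coordinate_algebra symU d); split.
  + move=> d x; have /choice [Q QE] J := cl_poly mn n_gt0 x J.
    exists (fun a => mcoeff (mhalf mn (tw_val a)) (Q (modd (tw_val a)))).
    by apply: clb_expand => // J; case: (QE J).
  + by move=> d c; exact: clb_free.
  + move=> i j l E a b; apply: (clb_expand mn n_gt0 (P := P (tw_val a) (tw_val b))) => J.
    rewrite /= /clb_val cl_mulZl cl_mulZr scalerA ffunE.
    rewrite (CE (_, _) J).1 /P mpolyXD !tofracM.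
    by rewrite /GRing.scale.
  rewrite [LHS](clb_expand mn n_gt0 (P := fun J => (J == set0)%:R)).
    apply: eq_bigr => z _; rewrite tw_ix0; congr (_ *: _).
    have -> : mhalf mn (@mnm0 n) = @mnm0 m by apply/mnmP => i; rewrite !mnmE.
    have -> : modd (@mnm0 n) = set0 by apply/setP => i; rewrite !inE mnm0E.
    by rewrite eqxx mcoeff1 eqxx.
  move=> J; rewrite /= ffunE; by case: eqP; rewrite ?tofrac1 ?tofrac0.
- move=> i j l E a b x; rewrite gamE; case: ifP => [/mnm_lepP h _|]; last by rewrite eqxx.
  rewrite /w -!(mdeg_half mn) -mdegD !mdegE; apply: leq_sum => y _; exact: h.
- by move=> z _; rewrite /w tw_ix0 /half_deg big1 // => i _; rewrite mnm0E.
apply: has_sc_ext (sc_galg_has_sc _) => // i j l E a b x.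
rewrite /tw_gam; set A := tw_val a; set B := tw_val b; set Z := tw_val x.
have sqE := squaresE A B.
(* If some variable has odd exponent in both factors, the exterior product vanishes, in accordance
   with s = 0. *)
have [sq0|sqn0] := eqVneq (squares A B) 0%N; last first.
  rewrite /tw_coef expr0n (negbTE sqn0) mulr0 if_same; case: ifP => // /eqP wx.
  rewrite gamE -/A -/B -/Z; case: ifP => // h.
  have -> : mnm_sub (mhalf mn Z) (mnm_add (mhalf mn A) (mhalf mn B)) = @mnm0 m.
    apply/eqP; rewrite -mdeg_eq0; move: wx; rewrite /w -!(mdeg_half mn) -/A -/B -/Z -mdegD.
    by rewrite -[in LHS](submK h) mdegD; lia.
  rewrite (CE (_, _) _).2 ext_mulb_foldr ?sorted_enum //= squares_disjoint sqn0.
  by rewrite scale0r ffunE.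
have [hAB oAB] := mhalf_add_disjoint sq0.
case: ifP => [/eqP ZE|ZE].
  rewrite /w -/A -/B -/Z ZE -sqE sq0 add0n eqxx gamE -/A -/B -/Z ZE hAB lepm_refl.
  rewrite (_ : mnm_sub _ _ = @mnm0 m); last by apply/mnmP => y; rewrite mnmBE subnn mnm0E.
  rewrite (CE (_, _) _).2 ext_mulb_foldr ?sorted_enum //= squares_disjoint sq0 /=.
  rewrite /tw_coef sq0 expr0 mulr1 sign_inversions !ffunE oAB set_enum eqxx.
  by rewrite /GRing.scale /= mulr1.
(* At equal weight the polynomial parts coincide, so that a different exponent has a different
   exterior part, on which the exterior product has no component. *)
case: ifP => // /eqP wx; rewrite gamE -/A -/B -/Z; case: ifP => // h.
have h0 : mnm_sub (mhalf mn Z) (mnm_add (mhalf mn A) (mhalf mn B)) = @mnm0 m.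
  apply/eqP; rewrite -mdeg_eq0; move: wx; rewrite /w -!(mdeg_half mn) -/A -/B -/Z -mdegD.
  by rewrite -[in LHS](submK h) mdegD; lia.
rewrite h0 (CE (_, _) _).2 ext_mulb_foldr ?sorted_enum //= set_enum !ffunE.
case: eqP => [oZ|_]; last by rewrite scaler0.
case/eqP: ZE; rewrite -(mjoinK mn Z) -(mjoinK mn (mnm_add A B)) oAB oZ hAB.
by congr mjoin; rewrite -(submK h) h0 add0m.
Qed.

End CoordinateAlgebra.

(** * Systems of forms without common zero *)

Section Koszul.
Variables (R : comNzRingType) (I : finType).
Implicit Types (g : I -> R).

Definition in_ideal g (p : R) : Prop := exists a : I -> R, p = \sum_i a i * g i.

(* Exactness of the Koszul complex in degree 1. *)
Definition koszul_exact g : Prop := forall a : I -> R, \sum_i a i * g i = 0 ->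
  exists s : I -> I -> R, [/\ forall i j, s i j = - s j i, forall i, s i i = 0 &
    forall i, a i = \sum_j s i j * g j].

Definition upd g (i0 : I) (c : R) : I -> R := fun j => if j == i0 then c else g j.

Lemma upd_sum g i0 c (a : I -> R) :
  \sum_i a i * upd g i0 c i = a i0 * c + \sum_(i | i != i0) a i * g i.
Proof.
rewrite (bigD1 i0) //= /upd eqxx; congr (_ + _).
by apply: eq_bigr => i /negbTE ->.
Qed.

Section Exchange.
Variables (g : I -> R) (i0 : I).
Hypothesis kg : koszul_exact g.
Local Notation J p := (exists e : I -> R, p = \sum_(i | i != i0) e i * g i).

(** Koszul exactness makes g i0 a nonzerodivisor modulo the other generators: row i0 of the
    alternating matrix expresses the coefficient of g i0 in them. *)
Lemma koszul_nzd M a : J (g i0 ^+ M * a) -> J a.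
Proof.
elim: M a => [|M IH] a; first by rewrite expr0 mul1r.
rewrite exprS -mulrA => -[e E]; apply: IH.
have [|s [_ s0 sE]] := kg (a := fun i => if i == i0 then g i0 ^+ M * a else - e i).
  rewrite (bigD1 i0) //= eqxx mulrC E [X in _ + X](eq_bigr (fun i => - (e i * g i))).
    by rewrite sumrN subrr.
  by move=> i /negbTE ->; rewrite mulNr.
exists (fun j => s i0 j); have := sE i0; rewrite eqxx => ->.
by rewrite (bigD1 i0) //= s0 mul0r add0r.
Qed.

(** The remainder [tau] is itself a relation between the generators other than g i0; Koszul
    exactness applied to it, with coefficient 0 at i0, pulls out one more factor g i0. *)
Lemma koszul_power M (al : I -> R) : \sum_(j | j != i0) al j * g j = 0 ->
  exists (s : I -> I -> R) (tau : I -> R),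
  [/\ forall i j, s i j = - s j i, forall i, s i i = 0,
      forall j, j != i0 ->
        al j = \sum_(l | l != i0) s j l * g l + tau j * g i0 ^+ M &
      \sum_(j | j != i0) tau j * g j = 0].
Proof.
move=> al0; elim: M => [|M [s [tau [sN s0 alE tau0]]]].
  exists (fun _ _ => 0), al; split=> // [i j|j _]; first by rewrite oppr0.
  by rewrite big1 => [|l _]; rewrite ?mul0r // add0r mulr1.
have [|s' [s'N s'0 s'E]] := kg (a := fun i => if i == i0 then 0 else tau i).
  rewrite (bigD1 i0) //= eqxx mul0r add0r -[RHS]tau0.
  by apply: eq_bigr => i /negbTE ->.
exists (fun i j => s i j + g i0 ^+ M * s' i j), (fun j => s' j i0); split.
- by move=> i j; rewrite sN s'N mulrN opprD.
- by move=> i; rewrite s0 s'0 mulr0 addr0.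
- move=> j ji; have tE : tau j = s' j i0 * g i0 + \sum_(l | l != i0) s' j l * g l.
    by have := s'E j; rewrite (negbTE ji) => ->; rewrite (bigD1 i0).
  rewrite alE // tE [X in _ = X + _](eq_bigr (fun l => s j l * g l + g i0 ^+ M * (s' j l * g l))).
    by rewrite big_split /= -mulr_sumr exprS; ring.
  by move=> l _; ring.
have := s'E i0; rewrite eqxx (bigD1 i0) //= s'0 mul0r add0r => /esym e.
apply: oppr_inj; rewrite oppr0 -sumrN -[RHS]e; apply: eq_bigr => j _.
by rewrite (s'N i0 j) mulNr.
Qed.

(** Modulo the other generators, g i0 ^ M = r c. By [koszul_nzd] the coefficient a i0 of c lies in
    their ideal; removing it by Koszul relations with c leaves a relation between the others, to
    which [koszul_power] applies. *)
Lemma koszul_exchange c M : in_ideal (upd g i0 c) (g i0 ^+ M) ->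
  koszul_exact (upd g i0 c).
Proof.
move=> [B]; rewrite upd_sum; set r := B i0 => bE a; rewrite upd_sum => a0.
have [e eE] : J (a i0).
  apply: (@koszul_nzd M); rewrite bE mulrDl.
  exists (fun i => B i * a i0 - r * a i).
  under [RHS]eq_bigr do rewrite mulrBl -2!mulrA.
  rewrite sumrB -mulr_sumr; have -> : \sum_(i | i != i0) a i * g i = - (a i0 * c).
    by apply/eqP; rewrite -addr_eq0 addrC a0.
  rewrite mulrN opprK addrC mulr_suml; congr (_ + _); last by ring.
  by apply: eq_bigr => i _; ring.
have [|s [tau [sN s0 alE tau0]]] := @koszul_power M (fun j => a j + e j * c).
  under eq_bigr do rewrite mulrDl mulrAC.
  by rewrite big_split /= -mulr_suml -eE addrC a0.
(* In the remainder tau j * g i0 ^ M, the power is replaced by r c plus the B l * g l. The terms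
   with tau l * B j restore the antisymmetry and contribute 0, [tau] being a relation. *)
exists (fun j l => if j == i0 then (if l == i0 then 0 else e l - tau l * r)
  else if l == i0 then tau j * r - e j else s j l + tau j * B l - tau l * B j).
split.
- move=> i j; case: (i == i0); case: (j == i0); rewrite ?oppr0 ?opprB //.
  rewrite (sN i j); ring.
- by move=> i; case: (i == i0) => //; rewrite s0 add0r subrr.
move=> j; rewrite upd_sum eqxx; have [->|ji] := eqVneq j i0.
  rewrite mul0r add0r eE.
  rewrite [RHS](eq_bigr (fun l => e l * g l - r * (tau l * g l))); last first.
    by move=> l /negbTE ->; ring.
  by rewrite sumrB -mulr_sumr tau0 mulr0 subr0.
apply: (addIr (e j * c)); rewrite (alE j ji) bE.
rewrite [X in _ = _ + X + _](eq_bigr (fun l => s j l * g l + (tau j * (B l * g l) - B j * (tau l * g l)))).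
  by rewrite big_split sumrB -!mulr_sumr tau0 /=; ring.
by move=> l /negbTE ->; ring.
Qed.

End Exchange.
End Koszul.

Section KoszulVariables.
Variables (F : fieldType) (n : nat).
Hypothesis char0 : [pchar F] =i pred0.
Local Notation S := (mpoly n F).
Local Notation X := (@mpolyX n F).

Lemma natr_neq0 d : (d.+1%:R : F) != 0.
Proof. by move/pcharf0P: char0 => ->. Qed.

(** For a relation of degree e, the derivatives in [koszul_variables] have degree e - 1, and Euler's
    formula requires division by e + 1: hence the shift by 2. *)
Definition deg_div (p : S) : S :=
  \sum_(m <- msupp p) (mcoeff m p / (mdeg m).+2%:R) *: X m.

Lemma mcoeff_deg_div m p : mcoeff m (deg_div p) = mcoeff m p / (mdeg m).+2%:R.
Proof.
rewrite /deg_div (mcoeff_sumX (fun m => mcoeff m p / (mdeg m).+2%:R)) ?msupp_uniq //.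
by rewrite mcoeff_msupp; case: eqP => //= ->; rewrite mul0r.
Qed.

(* The primitive is given by Euler's formula. *)
Lemma koszul_variables : koszul_exact (fun i : 'I_n => X (mnm1 i)).
Proof.
move=> a a0; exists (fun i j => deg_div (mderiv j (a i) - mderiv i (a j))); split.
- move=> i j; apply/mpolyP => m; rewrite mcoeffN !mcoeff_deg_div -mulNr.
  by rewrite -mcoeffN opprB.
- move=> i; apply/mpolyP => m; rewrite mcoeff_deg_div subrr !mcoeff0; exact: mul0r.
move=> i; apply/mpolyP => M; set N := mnm_add M (mnm1 i).
(* [T j] is the coefficient at N of x_j * a j, so that the T j add up to 0. *)
pose T j := if lem (mnm1 j) N then mcoeff (mnm_sub N (mnm1 j)) (a j) else 0.
have T0 : \sum_j T j = 0.
  have := congr1 (mcoeff N) a0; rewrite mcoeff0 raddf_sum /= => e; rewrite -[RHS]e.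
  by apply: eq_bigr => j _; rewrite mulrC mcoeffXM.
have Ti : T i = mcoeff M (a i).
  by rewrite /T /N lem_addl addmK.
have d0 : ((mdeg M).+1%:R : F) != 0 := natr_neq0 _.
apply: (mulIf d0); rewrite raddf_sum mulr_suml /=.
rewrite (eq_bigr (fun j => (M j)%:R * mcoeff M (a i) - (N i)%:R * T j + (j == i)%:R * T j)).
  rewrite big_split sumrB /= -mulr_sumr T0 mulr0 subr0 -mulr_suml -natr_sum -mdegE.
  rewrite (bigD1 i) //= eqxx mul1r Ti big1 ?addr0.
    by rewrite -natr1 mulrDr mulr1 [in RHS]mulrC.
  by move=> j /negbTE ->; rewrite mul0r.
move=> j _; rewrite [deg_div _ * _]mulrC mcoeffXM.
have NE : N i = (M i).+1 by rewrite /N mnmDE mnm1E eqxx addn1.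
case: ifP => [jM|/negbT]; last first.
  rewrite lep1mP negbK mul0r => /eqP Mj; rewrite Mj mul0r sub0r NE.
  have [ji|/negbTE ji] := eqVneq j i; first by rewrite -ji Mj addNr.
  have Nj : N j = 0%N by rewrite /N mnmDE mnm1E Mj eq_sym ji.
  by rewrite /T lep1mP Nj eqxx mulr0 mul0r oppr0 addr0.
have Mj : (0 < M j)%N by rewrite lt0n -lep1mP.
have mE : mdeg M = (mdeg (mnm_sub M (mnm1 j))).+1.
  by rewrite -[in LHS](submK jM) mdegD mdeg1 addn1.
rewrite mcoeff_deg_div -mE divfK // mcoeffB !mcoeff_deriv submK //.
have -> : (mnm_sub M (mnm1 j) j).+1 = M j by rewrite mnmBE mnm1E eqxx subn1 prednK.
have -> : mnm_add (mnm_sub M (mnm1 j)) (mnm1 i) = mnm_sub N (mnm1 j).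
  apply/mnmP => l; rewrite mnmDE mnmBE /N mnmBE mnmDE.
  by move/mnm_lepP/(_ l): jM; lia.
have -> : mcoeff (mnm_sub N (mnm1 j)) (a j) = T j.
  by rewrite /T ifT // /N (lepm_trans jM) // lem_addr.
rewrite -[_ *+ M j]mulr_natl -[T j *+ _]mulr_natl -[RHS]addrA; congr (_ + _).
rewrite -!mulNr -mulrDl; congr (_ * _); rewrite mnmBE mnm1E NE.
have [ji|ji] := eqVneq j i.
  by rewrite /= -ji subn1 prednK // -[in RHS]natr1 opprD addrNK.
by rewrite subn0 addr0.
Qed.

End KoszulVariables.

(** * Proper ideals, their zeros, and homogeneous parts *)

Section Ideals.
Variables (F : fieldType) (n : nat).
Local Notation S := (mpoly n F).
Local Notation X := (@mpolyX n F).
Local Notation x_ l := (X (mnm1 l)).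

Definition is_ideal (I : S -> Prop) : Prop :=
  [/\ I 0, forall p q, I p -> I q -> I (p + q) & forall a p, I p -> I (a * p)].

Lemma is_ideal_in_ideal (T : finType) (g : T -> S) : is_ideal (in_ideal g).
Proof.
split.
- by exists (fun=> 0); rewrite big1 // => i _; rewrite mul0r.
- move=> _ _ [a ->] [b ->]; exists (fun i => a i + b i); rewrite -big_split.
  by apply: eq_bigr => i _; rewrite mulrDl.
move=> c _ [a ->]; exists (fun i => c * a i); rewrite mulr_sumr.
by apply: eq_bigr => i _; rewrite mulrA.
Qed.

Lemma in_ideal_gen (T : finType) (g : T -> S) i : in_ideal g (g i).
Proof.
exists (fun j => (j == i)%:R); rewrite (bigD1 i) //= eqxx mul1r big1 ?addr0 //.
by move=> j /negbTE ->; rewrite mul0r.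
Qed.

Definition add_point (I : S -> Prop) (a : 'I_n -> F) r (p : S) : Prop :=
  exists b : 'I_n -> S, I (p - \sum_(l < n | (l < r)%N) b l * (x_ l - mpolyC n (a l))).

Lemma is_ideal_add_point I a r : is_ideal I -> is_ideal (add_point I a r).
Proof.
move=> [I0 ID IM]; split.
- by exists (fun=> 0); rewrite big1 ?subr0 // => l _; rewrite mul0r.
- move=> p q [b Ib] [c Ic]; exists (fun l => b l + c l).
  have := ID _ _ Ib Ic; rewrite addrACA -opprD -big_split /=.
  by under eq_bigr do rewrite -mulrDl.
move=> c p [b Ib]; exists (fun l => c * b l).
have := IM c _ Ib; rewrite mulrBr mulr_sumr.
by under eq_bigr do rewrite mulrA.
Qed.

Lemma meval_taylor (p : S) (a : 'I_n -> F) : exists b : 'I_n -> S,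
  p - mpolyC n (meval a p) = \sum_l b l * (x_ l - mpolyC n (a l)).
Proof.
pose T (p : S) := exists b : 'I_n -> S,
  p - mpolyC n (meval a p) = \sum_l b l * (x_ l - mpolyC n (a l)).
have TC c : T (mpolyC n c).
  by exists (fun=> 0); rewrite mevalC subrr big1 // => l _; rewrite mul0r.
have TX l : T (x_ l).
  exists (fun j => (j == l)%:R); rewrite mevalXU (bigD1 l) //= eqxx mul1r big1 ?addr0 //.
  by move=> j /negbTE ->; rewrite mul0r.
have TD p1 p2 : T p1 -> T p2 -> T (p1 + p2).
  move=> [b1 e1] [b2 e2]; exists (fun l => b1 l + b2 l).
  under eq_bigr do rewrite mulrDl.
  by rewrite big_split /= -e1 -e2 mevalD mpolyCD opprD addrACA.
have TM p1 p2 : T p1 -> T p2 -> T (p1 * p2).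
  move=> [b1 e1] [b2 e2]; exists (fun l => p1 * b2 l + mpolyC n (meval a p2) * b1 l).
  under eq_bigr do rewrite mulrDl -!mulrA.
  by rewrite big_split /= -!mulr_sumr -e1 -e2 mevalM mpolyCM; ring.
have T1 : T 1 by rewrite -mpolyC1; exact: TC.
rewrite [p]mpolyE; elim/big_ind: _ => [||m _]; first by rewrite -mpolyC0; exact: TC.
  exact: TD.
rewrite -mul_mpolyC; apply: (TM); first exact: TC.
rewrite mpolyXE_id; elim/big_ind: _ => // i _.
by elim: (m i) => [|d IH]; rewrite ?expr0 // exprS; exact: TM.
Qed.

End Ideals.

Section Zero.
Variables (F : closedFieldType) (n : nat).
Local Notation S := (mpoly n F).
Local Notation X := (@mpolyX n F).
Local Notation x_ l := (X (mnm1 l)).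

(* One coordinate after the other is specialized to a root of the univariate
   polynomial that it satisfies, keeping the ideal proper. *)
Lemma ideal_zero (I : S -> Prop) : is_ideal I -> ~ I 1 ->
  (forall l, exists P : {poly F}, P != 0 /\ I (horner_alg (x_ l) P)) ->
  exists a : 'I_n -> F, forall p, I p -> meval a p = 0.
Proof.
move=> idI I1 IP.
suff [a na] : exists a, ~ add_point I a n 1.
  exists a => p Ip; apply/eqP; apply: contraPT na => pa; apply.
  have [A0 AD AM] := is_ideal_add_point a n idI.
  have -> : 1 = mpolyC n (meval a p)^-1 * mpolyC n (meval a p) :> S.
    by rewrite -mpolyCM mulVf // mpolyC1.
  apply: (AM); have [b bE] := meval_taylor p a.
  exists (fun l => - b l); rewrite (eq_bigl xpredT); last by move=> l /=; rewrite ltn_ord.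
  under eq_bigr do rewrite mulNr.
  by rewrite sumrN opprK -bE addrC subrK.
suff H r : (r <= n)%N -> exists a, ~ add_point I a r 1 by exact: H (leqnn n).
elim: r => [_|r IH rn].
  by exists (fun=> 0) => -[b]; rewrite big_pred0 // subr0.
have [a na] := IH (ltnW rn); pose l0 := Ordinal rn.
pose upa z l := if l == l0 then z else a l.
(* If every value z of the coordinate made the ideal improper, x - z would be invertible modulo the
   previous ideal for all z. So would be the product over the roots of P, although P at x lies in
   I. *)
apply: contrapT => nex.
have allz z : add_point I (upa z) r.+1 1.
  by apply: contrapT => h; apply: nex; exists (upa z).
have [A0 AD AM] := is_ideal_add_point a r idI.
have stepz z : exists b, add_point I a r (1 - b * (x_ l0 - mpolyC n z)).
  have [b Ib] := allz z; exists (b l0); exists b; move: Ib.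
  rewrite (bigD1 l0) ?ltnSn //= /upa eqxx opprD addrA.
  congr (I (_ - _)); apply: eq_big => [l|l /andP [_ /negbTE ->]] //.
  by rewrite ltnS andbC ltn_neqAle.
have prodz (s : seq F) : exists b,
    add_point I a r (1 - b * \prod_(z <- s) (x_ l0 - mpolyC n z)).
  elim: s => [|z s [b Ib]]; first by exists 1; rewrite big_nil mulr1 subrr.
  have [c Ic] := stepz z; exists (b * c); rewrite big_cons.
  have := AD _ _ Ib (AM (b * \prod_(z <- s) (x_ l0 - mpolyC n z)) _ Ic).
  by congr (add_point I a r _); ring.
have [P [P0 IPl]] := IP l0; have [s Ps] := closed_field_poly_normal P.
have [b Ib] := prodz s; apply: na.
have -> : 1 = (1 - b * \prod_(z <- s) (x_ l0 - mpolyC n z)) +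
    (b * mpolyC n (lead_coef P)^-1) * horner_alg (x_ l0) P.
  have prodE : \prod_(z <- s) horner_alg (x_ l0) ('X - z%:P) =
      \prod_(z <- s) (x_ l0 - mpolyC n z).
    apply: eq_bigr => z _.
    by rewrite rmorphB /= horner_algX horner_algC alg_mpolyC.
  have -> : horner_alg (x_ l0) P =
      mpolyC n (lead_coef P) * \prod_(z <- s) (x_ l0 - mpolyC n z).
    by rewrite {1}Ps linearZ /= rmorph_prod /= prodE alg_mpolyC.
  have cc : mpolyC n (lead_coef P)^-1 * mpolyC n (lead_coef P) = 1.
    by rewrite -mpolyCM mulVf ?lead_coef_eq0 // mpolyC1.
  by rewrite mulrA -(mulrA b) cc mulr1 subrK.
apply: (AD) => //; apply: (AM); exists (fun=> 0).
by rewrite big1 ?subr0 // => l _; rewrite mul0r.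
Qed.

End Zero.

Section Homogeneous.
Variables (R : comNzRingType) (n : nat).
Local Notation S := (mpoly n R).
Local Notation X := (@mpolyX n R).

Definition hom d (p : S) : Prop := forall m, mcoeff m p != 0 -> mdeg m = d.

Definition hpart d (p : S) : S :=
  \sum_(m <- msupp p) (if mdeg m == d then mcoeff m p else 0) *: X m.

Lemma mcoeff_hpart d p m : mcoeff m (hpart d p) = if mdeg m == d then mcoeff m p else 0.
Proof.
rewrite /hpart (mcoeff_sumX (fun m => if mdeg m == d then mcoeff m p else 0)) ?msupp_uniq //.
by rewrite mcoeff_msupp; case: eqP => //= ->; rewrite if_same.
Qed.

Lemma hom_hpart d p : hom d (hpart d p).
Proof. by move=> m; rewrite mcoeff_hpart; case: (mdeg m =P d) => // _; rewrite eqxx. Qed.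

Lemma hpart_linear d c p q : hpart d (c *: p + q) = c *: hpart d p + hpart d q.
Proof.
apply/mpolyP => m; rewrite mcoeff_hpart !mcoeffD !mcoeffZ !mcoeff_hpart.
by case: (mdeg m =P d) => // _; rewrite mulr0 addr0.
Qed.
Lemma hpart0 d : hpart d 0 = 0.
Proof. by apply/mpolyP => m; rewrite mcoeff_hpart mcoeff0 if_same. Qed.
Lemma hpartD d p q : hpart d (p + q) = hpart d p + hpart d q.
Proof. by rewrite -[p]scale1r hpart_linear !scale1r. Qed.
Lemma hpartN d p : hpart d (- p) = - hpart d p.
Proof. by rewrite -scaleN1r -[_ *: p]addr0 hpart_linear hpart0 addr0 scaleN1r. Qed.
Lemma hpart_sum d (I : Type) (r : seq I) (P : pred I) (F : I -> S) :
  hpart d (\sum_(i <- r | P i) F i) = \sum_(i <- r | P i) hpart d (F i).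
Proof. by apply: (big_morph (hpart d)) => [p q|]; [exact: hpartD|exact: hpart0]. Qed.

Lemma hom_hpart_id d p : hom d p -> hpart d p = p.
Proof.
move=> hp; apply/mpolyP => m; rewrite mcoeff_hpart.
have [->|/hp ->] := eqVneq (mcoeff m p) 0; first by rewrite if_same.
by rewrite eqxx.
Qed.

Lemma hom_hpart0 d e p : hom e p -> e != d -> hpart d p = 0.
Proof.
move=> hp ed; apply/mpolyP => m; rewrite mcoeff_hpart mcoeff0.
have [->|/hp ->] := eqVneq (mcoeff m p) 0; first by rewrite if_same.
by rewrite (negbTE ed).
Qed.

Lemma hpart_big d p : (msize p <= d)%N -> hpart d p = 0.
Proof.
move=> pd; apply/mpolyP => m; rewrite mcoeff_hpart mcoeff0; case: eqP => // md.
by apply: memN_msupp_eq0; apply: msize_mdeg_ge; rewrite md.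
Qed.

Lemma hpart_decomp p N : (msize p <= N)%N -> p = \sum_(d < N) hpart d p.
Proof.
move=> pN; apply/mpolyP => m; rewrite raddf_sum /=.
have [mN|mN] := ltnP (mdeg m) N.
  rewrite (bigD1 (Ordinal mN)) //= mcoeff_hpart eqxx big1 ?addr0 // => d dm.
  by rewrite mcoeff_hpart; case: eqP => // e; case/eqP: dm; apply: val_inj.
rewrite big1 => [|d _].
  by apply: memN_msupp_eq0; apply: msize_mdeg_ge; exact: leq_trans pN mN.
rewrite mcoeff_hpart; case: eqP => // e.
by move: mN; rewrite e leqNgt ltn_ord.
Qed.

Lemma hom0 d : hom d 0.
Proof. by move=> m; rewrite mcoeff0 eqxx. Qed.
Lemma homD d p q : hom d p -> hom d q -> hom d (p + q).
Proof.
move=> hp hq m; rewrite mcoeffD.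
by have [->|/hp //] := eqVneq (mcoeff m p) 0; rewrite add0r => /hq.
Qed.
Lemma homZ d c p : hom d p -> hom d (c *: p).
Proof.
by move=> hp m; rewrite mcoeffZ => h; apply: hp; apply: contraNneq h => ->; rewrite mulr0.
Qed.
Lemma hom_sum d (I : Type) (r : seq I) (F : I -> S) :
  (forall i, hom d (F i)) -> hom d (\sum_(i <- r) F i).
Proof. by move=> h; elim/big_ind: _ => //; [exact: hom0|exact: homD]. Qed.
Lemma homX m : hom (mdeg m) (X m).
Proof. by move=> m'; rewrite mcoeffX; case: (m =P m') => [->|_] //=; rewrite eqxx. Qed.
Lemma homM d e p q : hom d p -> hom e q -> hom (d + e)%N (p * q).
Proof.
move=> hp hq; rewrite [p]mpolyE [q]mpolyE mulr_suml big_seq; elim/big_ind: _ => [||m].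
- exact: hom0.
- exact: homD.
rewrite mcoeff_msupp => /hp <-; rewrite mulr_sumr big_seq; elim/big_ind: _ => [||m'].
- exact: hom0.
- exact: homD.
rewrite mcoeff_msupp => /hq <-; rewrite -scalerAl -scalerAr -mpolyXD -mdegD.
by do 2!apply: homZ; exact: homX.
Qed.

Lemma hpartM d e p g : hom e g ->
  hpart d (p * g) = if (e <= d)%N then hpart (d - e)%N p * g else 0.
Proof.
move=> hg; rewrite {1}(hpart_decomp (leqnn (msize p))) mulr_suml hpart_sum.
have h j : hom (j + e)%N (hpart j p * g) by apply: homM => //; exact: hom_hpart.
case: leqP => ed; last first.
  rewrite big1 // => j _; apply: hom_hpart0 (h j) _; apply: contraTneq ed => <-.
  by rewrite -leqNgt leq_addl.
have [dN|dN] := ltnP (d - e) (msize p).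
  rewrite (bigD1 (Ordinal dN)) //= hom_hpart_id; last first.
    by rewrite -{1}(subnK ed); exact: h.
  rewrite big1 ?addr0 // => j jd; apply: hom_hpart0 (h j) _.
  by apply: contraNneq jd => e'; apply/eqP/val_inj; rewrite /= -e' addnK.
rewrite hpart_big // mul0r big1 // => j _; apply: hom_hpart0 (h j) _.
by apply: contraTneq dN => <-; rewrite addnK -ltnNge.
Qed.

Variables (I : finType) (g : I -> S) (e : I -> nat).
Hypothesis hg : forall i, hom (e i) (g i).

Lemma in_ideal_hpart d p : in_ideal g p -> in_ideal g (hpart d p).
Proof.
move=> [a ->]; exists (fun i => if (e i <= d)%N then hpart (d - e i)%N (a i) else 0).
rewrite hpart_sum; apply: eq_bigr => i _; rewrite (hpartM _ _ (@hg i)).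
by case: ifP; rewrite ?mul0r.
Qed.

Lemma in_ideal_hom d p : hom d p -> in_ideal g p -> exists a : I -> S,
  p = \sum_i a i * g i /\ forall i, (if (e i <= d)%N then hom (d - e i)%N (a i) else a i = 0).
Proof.
move=> hp [a pE]; exists (fun i => if (e i <= d)%N then hpart (d - e i)%N (a i) else 0).
split; last by move=> i; case: (e i <= d)%N => //; exact: hom_hpart.
rewrite -(hom_hpart_id hp) pE hpart_sum; apply: eq_bigr => i _; rewrite (hpartM _ _ (@hg i)).
by case: ifP; rewrite ?mul0r.
Qed.

End Homogeneous.

Section Congruence.
Variables (F : fieldType) (n : nat) (I : mpoly n F -> Prop).
Hypothesis idI : is_ideal I.

Lemma ideal_sum (T : Type) (r : seq T) (G : T -> mpoly n F) :
  (forall i, I (G i)) -> I (\sum_(i <- r) G i).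
Proof. by case: idI => I0 ID _ IG; elim/big_ind: _ => // i _; exact: IG. Qed.

Lemma idealMr p q : I p -> I (p * q).
Proof. by case: idI => _ _ IM Ip; rewrite mulrC; exact: (IM). Qed.

Lemma ideal_subX p q d : I (p - q) -> I (p ^+ d - q ^+ d).
Proof. by move=> Ipq; rewrite subrXX; exact: idealMr. Qed.
End Congruence.

Section Algebraic.
Variables (F : fieldType) (n : nat) (I : mpoly n F -> Prop) (B : finType).
Variable bx : B -> mpoly n F.
Hypothesis idI : is_ideal I.
Local Notation S := (mpoly n F).

(** The quotient is spanned by D elements, so that the powers of p of exponents 0 to D are linearly
    dependent in it. *)
Lemma quotient_algebraic :
  (forall p, exists c : B -> F, I (p - \sum_b c b *: bx b)) ->
  forall p, exists P : {poly F}, P != 0 /\ I (horner_alg p P).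
Proof.
move=> red p; have [C CE] : exists C : nat -> B -> F,
    forall j, I (p ^+ j - \sum_b C j b *: bx b).
  by have [C CE] := choice (fun j => red (p ^+ j)); exists C.
pose D := #|B|; pose M := \matrix_(j < D.+1, b < D) C j (enum_val b).
have /matrix0Pn [i [j vij]] : kermx M != 0.
  rewrite -mxrank_eq0 mxrank_ker subn_eq0 -ltnNge ltnS; exact: rank_leq_col.
pose v := row i (kermx M); have vM : v *m M = 0.
  by apply/sub_kermxP; exact: row_sub.
have [I0 ID IM] := idI.
exists (\poly_(j < D.+1) v 0 (inord j)); split.
  apply/eqP => /(congr1 (fun q : {poly F} => q`_j)); rewrite coef_poly ltn_ord coef0.
  by rewrite inord_val mxE => /eqP; rewrite (negbTE vij).
have -> : horner_alg p (\poly_(j < D.+1) v 0 (inord j)) =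
    \sum_(j < D.+1) v 0 j *: (p ^+ j - \sum_b C j b *: bx b).
  rewrite poly_def linear_sum /=.
  rewrite [RHS](eq_bigr (fun j => v 0 j *: p ^+ j - \sum_b (v 0 j * C j b) *: bx b)); last first.
    move=> l _; rewrite scalerBr scaler_sumr; congr (_ - _).
    by apply: eq_bigr => b _; rewrite scalerA.
  rewrite sumrB exchange_big /= [X in _ - X]big1 => [|b _].
    rewrite subr0; apply: eq_bigr => l _.
    rewrite inord_val -mul_polyC rmorphM /= horner_algC alg_mpolyC mul_mpolyC.
    by rewrite (rmorphXn (horner_alg p)) /= horner_algX.
  rewrite -scaler_suml; have := congr1 (fun A : 'rV_D => A 0 (enum_rank b)) vM.
  rewrite !mxE => e; rewrite (_ : \sum_i0 _ = 0) ?scale0r // -[RHS]e.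
  by apply: eq_bigr => l _; rewrite !mxE enum_rankK.
apply: ideal_sum => // l; rewrite -mul_mpolyC; exact: (IM).
Qed.
End Algebraic.

Section Box.
Variables (F : fieldType) (n : nat) (T : finType).
Local Notation S := (mpoly n F).
Local Notation X := (@mpolyX n F).
Local Notation x_ l := (X (mnm1 l)).
Variables (g : T -> S) (e : T -> nat) (t0 : T) (i0 : 'I_n).
Hypothesis hg : forall t, hom (e t) (g t).
Hypothesis g0 : g t0 = x_ i0.
Hypothesis gN : forall l, exists N, in_ideal g (x_ l ^+ N).

Local Notation I := (in_ideal (upd g t0 (x_ i0 - 1))).

Lemma box_exponent : exists N, forall l, in_ideal g (x_ l ^+ N).
Proof.
have [N NE] := choice gN; exists (\max_l N l) => l.
have [_ _ IM] := is_ideal_in_ideal g.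
by rewrite -(subnK (leq_bigmax l)) exprD; exact: IM.
Qed.

Lemma degree_one_of_var : e t0 = 1%N.
Proof. by have := @hg t0 (mnm1 i0); rewrite g0 mcoeffX eqxx oner_eq0 mdeg1 => /(_ isT). Qed.

(* Modulo I, the generator [x_ i0] is 1, so that a relation [x_ l ^+ N = \sum_t a t * g t]
   rewrites [x_ l ^+ N] as a polynomial of smaller degree. *)
Lemma box_reduction : exists N, forall p, exists c : {ffun 'I_n -> 'I_N} -> F,
  I (p - \sum_b c b *: X (Multinom [tuple (b l : nat) | l < n])).
Proof.
have [N NE] := box_exponent; exists N.
have idI := is_ideal_in_ideal (upd g t0 (x_ i0 - 1)).
have [I0 ID IM] := idI.
pose red p := exists c : {ffun 'I_n -> 'I_N} -> F,
  I (p - \sum_b c b *: X (Multinom [tuple (b l : nat) | l < n])).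
have redI p : I p -> red p.
  move=> Ip; exists (fun=> 0); rewrite big1 ?subr0 // => b _; exact: scale0r.
have redD p q : red p -> red q -> red (p + q).
  move=> [c Ic] [d Id]; exists (fun b => c b + d b).
  under eq_bigr do rewrite scalerDl.
  by rewrite big_split /= opprD addrACA; exact: (ID).
have redZ c p : red p -> red (c *: p).
  move=> [d Id]; exists (fun b => c * d b).
  under eq_bigr do rewrite -scalerA.
  by rewrite -scaler_sumr -scalerBr -mul_mpolyC; exact: (IM).
suff redX m : red (X m).
  move=> p; rewrite [p]mpolyE; elim/big_ind: _ => [|p1 p2|m _]; first exact: redI.
    exact: redD.
  by apply: redZ.
have [d] := ubnP (mdeg m); elim: d m => // d IH m; rewrite ltnS => md.
have [/forallP mN|/forallPn [l]] := boolP [forall l, (m l < N)%N].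
  exists (fun b => (b == [ffun l => Ordinal (mN l)])%:R).
  rewrite (bigD1 [ffun l => Ordinal (mN l)]) //= eqxx scale1r big1 => [|b /negbTE ->].
    rewrite addr0 (_ : Multinom _ = m) ?subrr //.
    by apply/mnmP => l; rewrite mnmE ffunE.
  by rewrite scale0r.
rewrite -leqNgt => Nm; have lm : lem (mnm_muln (mnm1 l) N) m.
  apply/mnm_lepP => j; rewrite mulmnE mnm1E.
  by have [<-|_] := eqVneq l j; rewrite ?mul1n ?mul0n // (leq_trans _ Nm).
have XlN : x_ l ^+ N = X (mnm_muln (mnm1 l) N) by rewrite mpolyXn.
have hXl : hom N (x_ l ^+ N).
  by rewrite XlN; have := @homX F n (mnm_muln (mnm1 l) N); rewrite mdegMn mdeg1 mul1n.
have [a [aE ah]] := in_ideal_hom hg hXl (NE l).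
set m' := mnm_sub m (mnm_muln (mnm1 l) N).
have -> : X m = X m' * x_ l ^+ N by rewrite XlN -mpolyXD submK.
rewrite aE (bigD1 t0) //= g0.
have -> : X m' * (a t0 * x_ i0 + \sum_(i | i != t0) a i * g i) =
    X m' * a t0 + X m' * (a t0 * (x_ i0 - 1) + \sum_(i | i != t0) a i * g i) by ring.
apply: (redD); last by apply/redI/(IM); exists a; rewrite upd_sum.
have := ah t0; rewrite degree_one_of_var; case: ltnP => [N0 ha|_ ->]; last first.
  by rewrite mulr0; exact: redI.
have : hom (mdeg m' + (N - 1))%N (X m' * a t0) by apply: homM => //; exact: homX.
set q := X m' * a t0 => hq.
rewrite [q]mpolyE big_seq; elim/big_ind: _ => [||j]; first exact: redI.
  exact: redD.
rewrite mcoeff_msupp => /hq jd; apply/redZ/(IH).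
rewrite jd; have := md; rewrite -(submK lm) mdegD mdegMn mdeg1 mul1n -/m'.
by move: N0; lia.
Qed.

(** By [gN] the generators have no common projective zero. The zeros of those other than x_i0 thus
    have x_i0 nonzero, and after the normalization x_i0 = 1 each coordinate takes finitely many
    values on them. *)
Lemma box_algebraic p : exists P : {poly F}, P != 0 /\ I (horner_alg p P).
Proof.
have [N red] := box_reduction.
exact: quotient_algebraic (is_ideal_in_ideal _) red p.
Qed.

(* Homogenization: the parts of a relation [1 = p + b * (x_ i0 - 1)] give
   [b_d = - x_ i0 ^+ d] modulo the homogeneous ideal containing p. *)
Lemma dehomogenized_unit c dc b : hom dc c ->
  in_ideal (upd g t0 c) (1 - b * (x_ i0 - 1)) ->
  exists M, in_ideal (upd g t0 c) (x_ i0 ^+ M).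
Proof.
move=> hc; set K := in_ideal _ => K1.
have hK : forall t, hom (if t == t0 then dc else e t) (upd g t0 c t).
  by move=> t; rewrite /upd; case: ifP.
have idK : is_ideal K by exact: is_ideal_in_ideal.
have [K0 KD KM] := idK.
have hx : hom 1 (x_ i0) by have := @homX F n (mnm1 i0); rewrite mdeg1.
have h1 : hom 0 (1 : S).
  by move=> m; rewrite mcoeff1; case: (m =P _) => [-> _|_]; rewrite ?mdeg0 ?eqxx.
have Kb d : K (x_ i0 ^+ d + hpart d b).
  elim: d => [|d IH].
    have := in_ideal_hpart hK 0 K1.
    rewrite hpartD (hom_hpart_id h1) hpartN mulrBr hpartD (hpartM _ _ hx) /=.
    by rewrite mulr1 hpartN add0r opprK expr0.
  have := in_ideal_hpart hK d.+1 K1; rewrite hpartD (hom_hpart0 h1) // add0r.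
  rewrite hpartN mulrBr hpartD (hpartM _ _ hx) /= subn1 mulr1 hpartN opprD opprK -/K.
  move=> h; have := KD _ _ h (KM (x_ i0) _ IH).
  by congr K; rewrite exprS mulrDr [hpart d b * _]mulrC /=; ring.
by exists (msize b); have := Kb (msize b); rewrite hpart_big // addr0.
Qed.

(** Modulo the generators other than x_i0, some power x_l ^ N is a multiple of x_i0; it remains to
    raise it to the power M. *)
Lemma powers_exchange c M : in_ideal (upd g t0 c) (x_ i0 ^+ M) ->
  forall l, exists N, in_ideal (upd g t0 c) (x_ l ^+ N).
Proof.
set K := in_ideal _ => KM l; have idK : is_ideal K by exact: is_ideal_in_ideal.
have [K0 KD KMl] := idK.
have [N [a aE]] := gN l; exists (N * M)%N; rewrite exprM.
have h : K (x_ l ^+ N - a t0 * x_ i0).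
  exists (fun t => if t == t0 then 0 else a t); rewrite upd_sum eqxx mul0r add0r aE.
  rewrite (bigD1 t0) //= g0 addrAC subrr add0r.
  by apply: eq_bigr => t /negbTE ->.
have := KD _ _ (ideal_subX idK M h) (KMl (a t0 ^+ M) _ KM).
by rewrite exprMn addrNK.
Qed.
End Box.

Lemma meval_horner_alg (R : comNzRingType) n (a : 'I_n -> R) (p : mpoly n R) (P : {poly R}) :
  meval a (horner_alg p P) = P.[meval a p].
Proof.
elim/poly_ind: P => [|P c IH]; first by rewrite rmorph0 meval0 horner0.
rewrite rmorphD rmorphM /= horner_algX horner_algC alg_mpolyC mevalD mevalM mevalC IH.
by rewrite hornerMXaddC.
Qed.

(** * Exchange of variables for generic combinations of forms *)

Section GenericCombination.
Variables (F : closedFieldType).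

(** The coefficients are the powers of one scalar z outside the roots of finitely many nonzero
    polynomials, which exists as an algebraically closed field is infinite. *)
Lemma generic_nonzero (n r : nat) (C : finType) (v : C -> 'I_n -> F) :
  exists c : 'I_n -> F, forall x : C, (exists l, v x l != 0) -> \sum_l c l * v x l != 0.
Proof.
pose Q x := \poly_(l < n) (if insub l is Some l' then v x l' else 0).
have Qn0 x : (exists l, v x l != 0) -> Q x != 0.
  move=> [l]; apply: contraNneq => Q0.
  have := congr1 (fun q : {poly F} => q`_l) Q0.
  by rewrite coef_poly ltn_ord coef0 valK => ->.
have : \prod_(x | [exists l, v x l != 0]) Q x != 0.
  by apply/prodf_neq0 => x /existsP /Qn0.
move/closed_nonrootP => [z]; rewrite /root horner_prod => /prodf_neq0 zQ.
exists (fun l => z ^+ l) => x /existsP /zQ; rewrite horner_poly.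
by under [X in X != 0 -> _]eq_bigr do rewrite valK mulrC.
Qed.

Variable n : nat.
Local Notation S := (mpoly n F).
Local Notation X := (@mpolyX n F).
Local Notation x_ l := (X (mnm1 l)).
Variables (f : 'I_n -> S) (d : nat).
Hypothesis hf : forall l, hom d (f l).
Hypothesis f0 : forall a : 'I_n -> F, (forall l, meval a (f l) = 0) -> forall l, a l = 0.

(** The remaining generators have finitely many zeros with x_i0 = 1, and at each some form f l is
    nonzero. A generic combination vanishes at none of them, so that adding it and x_i0 - 1 gives
    the unit ideal, which [dehomogenized_unit] turns into a power of x_i0. *)
Lemma exchange_candidate (T : finType) (g : T -> S) (e : T -> nat) (t0 : T) (i0 : 'I_n) :
  (forall t, hom (e t) (g t)) -> g t0 = x_ i0 ->
  (forall l, exists N, in_ideal g (x_ l ^+ N)) ->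
  exists (c : 'I_n -> F) (M : nat),
    in_ideal (upd g t0 (\sum_l c l *: f l)) (x_ i0 ^+ M).
Proof.
move=> hg g0 gN; pose I := in_ideal (upd g t0 (x_ i0 - 1)).
have idI : is_ideal I by exact: is_ideal_in_ideal.
have [P PE] : exists P : 'I_n -> {poly F}, forall l, P l != 0 /\ I (horner_alg (x_ l) (P l)).
  by have [P PE] := choice (fun l => box_algebraic hg g0 gN (x_ l)); exists P.
have [s sE] : exists s : 'I_n -> seq F, forall l,
    P l = lead_coef (P l) *: \prod_(z <- s l) ('X - z%:P).
  have h l : exists s, P l = lead_coef (P l) *: \prod_(z <- s) ('X - z%:P).
    by have [s sE] := closed_field_poly_normal (P l); exists s.
  by have [s sE] := choice h; exists s.
(* The points [pt x] are all the tuples of roots of the P l; they include the zeros to be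
   avoided. *)
pose N := \max_l size (s l); pose pt (x : {ffun 'I_n -> 'I_N}) l := (s l)`_(x l).
have [c cE] := @generic_nonzero n N _ (fun x l => meval (pt x) (f l)).
exists c; set cc := \sum_l _; pose K := in_ideal (upd g t0 cc).
have idK : is_ideal K by exact: is_ideal_in_ideal.
have hc : hom d cc by apply: hom_sum => l; exact: homZ.
suff [b Kb] : exists b, K (1 - b * (x_ i0 - 1)).
  by have := dehomogenized_unit hg hc Kb.
have [K0 KD KM] := idK.
(* The ideal J is generated by K and x_i0 - 1. *)
pose J p := exists b, K (p - b * (x_ i0 - 1)).
have idJ : is_ideal J.
  split; first by exists 0; rewrite mul0r subr0.
    move=> p q [b Kb] [b' Kb']; exists (b + b').
    by have := KD _ _ Kb Kb'; rewrite mulrDl opprD addrACA.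
  by move=> p q [b Kb]; exists (p * b); have := KM p _ Kb; rewrite mulrBr mulrA.
have KJ p : K p -> J p by exists 0; rewrite mul0r subr0.
have IJ p : I p -> J p.
  move=> [a aE]; exists (a t0); exists (fun t => if t == t0 then 0 else a t).
  rewrite aE !upd_sum eqxx mul0r add0r addrAC subrr add0r.
  by apply: eq_bigr => t /negbTE ->.
apply: contrapT => J1; have [] := @ideal_zero F n J idJ J1.
  by move=> l; have [P0 PI] := PE l; exists (P l); split => //; exact: IJ.
move=> a aJ.
have ax : a i0 = 1.
  have : J (x_ i0 - 1) by exists 1; rewrite mul1r subrr.
  by move/aJ; rewrite mevalB mevalXU meval1 => /eqP; rewrite subr_eq0 => /eqP.
have as_ l : a l \in s l.
  have [P0 /IJ /aJ] := PE l; rewrite meval_horner_alg mevalXU => /eqP.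
  by rewrite -/(root _ _) sE rootZ ?lead_coef_eq0 // root_prod_XsubC.
have iN l : (index (a l) (s l) < N)%N.
  apply: leq_trans (leq_bigmax l); rewrite index_mem; exact: as_.
have ptE : pt [ffun l => Ordinal (iN l)] = a.
  by apply/funext => l; rewrite /pt ffunE /= nth_index.
have /cE : exists l, meval (pt [ffun l => Ordinal (iN l)]) (f l) != 0.
  rewrite ptE; apply: contrapT => h.
  have : a i0 = 0.
    by apply: f0 => l; apply/eqP; apply: contrapT => /negP fl; apply: h; exists l.
  by rewrite ax => /eqP; rewrite oner_eq0.
rewrite ptE; have : J cc by apply: KJ; have := in_ideal_gen (upd g t0 cc) t0; rewrite /upd eqxx.
move/aJ; rewrite raddf_sum /= => cc0.
by rewrite (eq_bigr (fun l => meval a (c l *: f l))) ?cc0 ?eqxx // => l _; rewrite mevalZ.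
Qed.

End GenericCombination.

Lemma mulmx_scale_sum (R : nzRingType) n (A B : 'M[R]_n) (W : lmodType R) (v : 'I_n -> W) l :
  A *m B = 1%:M -> \sum_j A l j *: (\sum_m B j m *: v m) = v l.
Proof.
move=> AB; transitivity (\sum_m (A *m B) l m *: v m).
  under eq_bigr do rewrite scaler_sumr.
  rewrite exchange_big; apply: eq_bigr => m _; rewrite mxE scaler_suml.
  by apply: eq_bigr => j _; rewrite scalerA.
rewrite AB (bigD1 l) //= big1 => [|m /negbTE lm]; first by rewrite mxE eqxx scale1r addr0.
by rewrite mxE eq_sym lm scale0r.
Qed.

Section Regular.
Variables (F : closedFieldType) (n : nat).
Hypothesis char0 : [pchar F] =i pred0.
Local Notation S := (mpoly n F).
Local Notation X := (@mpolyX n F).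
Local Notation x_ l := (X (mnm1 l)).
Variables (f : 'I_n -> S) (d : nat).
Hypothesis d0 : (0 < d)%N.
Hypothesis hf : forall l, hom d (f l).
Hypothesis f0 : forall a : 'I_n -> F, (forall l, meval a (f l) = 0) -> forall l, a l = 0.

Definition stage (C : 'I_n -> 'I_n -> F) r (j : 'I_n) : S :=
  if (j < r)%N then \sum_l C j l *: f l else x_ j.

Definition stage_degree r (j : 'I_n) : nat := if (j < r)%N then d else 1%N.

Lemma stage_hom C r j : hom (stage_degree r j) (stage C r j).
Proof.
rewrite /stage /stage_degree; case: ifP => _; last by have := @homX F n (mnm1 j); rewrite mdeg1.
by apply: hom_sum => l; exact: homZ.
Qed.

Lemma stage_exact r : (r <= n)%N -> exists C, koszul_exact (stage C r) /\
  forall l, exists N, in_ideal (stage C r) (x_ l ^+ N).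
Proof.
elim: r => [_|r IH rn].
  exists (fun _ _ => 0); split; first exact: koszul_variables.
  by move=> l; exists 1%N; rewrite expr1; have := in_ideal_gen (fun i => x_ i) l.
have [C [kC CN]] := IH (ltnW rn); pose i0 := Ordinal rn.
have g0 : stage C r i0 = x_ i0 by rewrite /stage ltnn.
have [c [M cM]] := exchange_candidate hf f0 (@stage_hom C r) g0 CN.
exists (fun j => if j == i0 then c else C j).
have -> : stage (fun j => if j == i0 then c else C j) r.+1 =
    upd (stage C r) i0 (\sum_l c l *: f l).
  apply/funext => j; rewrite /stage /upd; have [->|ji] := eqVneq j i0.
    by rewrite /= ltnSn.
  by rewrite ltnS leq_eqVlt (_ : (_ == _ :> nat) = false) //; exact: negbTE.
split; last exact: powers_exchange g0 CN _ _ cM.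
by apply: (koszul_exchange kC (M := M)); rewrite g0.
Qed.

(** A vector of the kernel of C would be a constant relation between the combinations; by exactness
    its entries lie in their ideal, which has no constant terms. So C is invertible, and relations
    and Koszul matrices are transported along it. *)
Lemma koszul_exact_comb (C : 'M[F]_n) :
  koszul_exact (fun j => \sum_l C j l *: f l) -> koszul_exact f.
Proof.
move=> kg; pose g (j : 'I_n) := \sum_l C j l *: f l.
have g0 p l : mcoeff (@mnm0 n) (p * g l) = 0.
  have hg : hom d (g l) by apply: hom_sum => i; exact: homZ.
  have := mcoeff_hpart 0 (p * g l) (@mnm0 n).
  by rewrite mdeg0 eqxx (hpartM _ _ hg) leqNgt d0 mcoeff0.
have Cu : C \in unitmx.
  rewrite -row_free_unit -kermx_eq0; apply: contraT => /matrix0Pn [i [j vij]].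
  have vC : row i (kermx C) *m C = 0 by apply/sub_kermxP; exact: row_sub.
  have [|s [_ _ sE]] := kg (fun j => mpolyC n (kermx C i j)).
    under eq_bigr do rewrite mul_mpolyC scaler_sumr.
    rewrite exchange_big big1 // => l _.
    under eq_bigr do rewrite scalerA.
    rewrite -scaler_suml; have := congr1 (fun A : 'rV_n => A 0 l) vC; rewrite !mxE => e.
    rewrite (_ : \sum_i0 _ = 0) ?scale0r // -[RHS]e.
    by apply: eq_bigr => i1 _; rewrite [in RHS]mxE.
  have := congr1 (mcoeff (@mnm0 n)) (sE j); rewrite mcoeffC eqxx mulr1 raddf_sum /= big1.
    by move/eqP; rewrite (negbTE vij).
  by move=> l _; exact: g0.
pose D := invmx C.
have fE l : f l = \sum_j D l j *: g j by rewrite mulmx_scale_sum ?mulVmx.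
move=> a a0.
have [|s [sN _ sE]] := kg (fun j => \sum_l D l j *: a l).
  rewrite -[RHS]a0; under [RHS]eq_bigr do rewrite fE mulr_sumr.
  rewrite exchange_big; apply: eq_bigr => j _; rewrite mulr_suml.
  by apply: eq_bigr => l _; rewrite -scalerAl scalerAr.
have aE l : a l = \sum_j C j l *: \sum_l' D l' j *: a l'.
  rewrite -[LHS](@mulmx_scale_sum _ _ C^T D^T _ a); last by rewrite -trmx_mul mulVmx ?trmx1.
  apply: eq_bigr => j _; rewrite mxE; congr (_ *: _).
  by apply: eq_bigr => i _; rewrite [in LHS]mxE.
(* The change of basis of an alternating matrix, C^T s C. *)
pose s' l p := \sum_j \sum_m (C j l * C m p) *: s j m.
have s'N l p : s' l p = - s' p l.
  rewrite /s' exchange_big -sumrN; apply: eq_bigr => m _; rewrite -sumrN.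
  by apply: eq_bigr => j _; rewrite sN scalerN mulrC.
exists s'; split => // [i|l].
  have : s' i i *+ 2 = 0 by rewrite mulr2n {2}s'N subrr.
  move/eqP; rewrite -scaler_nat scaler_eq0 => /orP [h|/eqP //].
  by have := natr_neq0 char0 1; rewrite h.
rewrite aE /s'; under [RHS]eq_bigr do rewrite mulr_suml.
rewrite exchange_big; apply: eq_bigr => j _ /=.
under [RHS]eq_bigr do rewrite mulr_suml.
rewrite exchange_big sE scaler_sumr; apply: eq_bigr => m _ /=.
rewrite /g mulr_sumr scaler_sumr; apply: eq_bigr => p _.
by rewrite -scalerAl -scalerA -!scalerAr.
Qed.

(* A system of n forms without common zero is a regular sequence: starting from
   the variables, they are exchanged one by one for generic combinations of the forms. *)
Theorem koszul_exact_forms : koszul_exact f.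
Proof.
have [C [kC _]] := stage_exact (leqnn n).
apply: (@koszul_exact_comb (\matrix_(j, l) C j l)).
have -> // : (fun j => \sum_l (\matrix_(j, l) C j l) j l *: f l) = stage C n.
by apply/funext => j; rewrite /stage ltn_ord; apply: eq_bigr => l _; rewrite mxE.
Qed.

End Regular.

(** * Descent of Koszul exactness to the base field *)

Section Retraction.
Variables (k : fieldType) (K : fieldType) (iota : {rmorphism k -> K}).

Let lin (A : set K) := forall x y c, A x -> A y -> A (x + iota c * y).

(* A maximal k-subspace of K avoiding 1 is a complement of the image of k. *)
Lemma field_retraction : exists lam : K -> k,
  [/\ forall x y, lam (x + y) = lam x + lam y,
      forall c x, lam (iota c * x) = c * lam x & forall c, lam (iota c) = c].
Proof.
have [C Ctot|A [[Alin A1] Amax]] := @Zorn_bigcup K (fun A => lin A /\ ~ A 1).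
  move=> tot; split; last by move=> [X /Ctot [_ X1]].
  move=> x y c [X CX Xx] [Y CY Yy]; have [XY|YX] := tot _ _ CX CY.
    by exists Y => //; have [Yl _] := Ctot _ CY; apply: Yl => //; exact: XY.
  by exists X => //; have [Xl _] := Ctot _ CX; apply: Xl => //; exact: YX.
have A0 : A 0.
  have [[x Ax]|/forallNP h] := pselect (exists x, A x).
    by have := Alin x x (- 1) Ax Ax; rewrite rmorphN1 mulN1r subrr.
  (* The empty set satisfies the closure condition as well; comparison with {0} shows that it is not
     maximal. *)
  exfalso; apply: (Amax [set 0]%classic).
    split; first by move=> x /h.
    by move=> /(_ 0 erefl) /h.
  split; last by move=> /= /eqP; rewrite oner_eq0.
  by move=> x y c /= -> ->; rewrite mulr0 addr0.
have AD x y : A x -> A y -> A (x + y).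
  by move=> Ax Ay; have := Alin x y 1 Ax Ay; rewrite rmorph1 mul1r.
have AZ c x : A x -> A (iota c * x).
  by move=> Ax; have := Alin 0 x c A0 Ax; rewrite add0r.
have AB x y : A x -> A y -> A (x - y).
  by move=> Ax Ay; have := Alin x y (- 1) Ax Ay; rewrite rmorphN1 mulN1r.
have uniqc x c d : A (x - iota c) -> A (x - iota d) -> c = d.
  move=> Ac Ad; apply/eqP; rewrite -subr_eq0; apply: contraT => cd; exfalso; apply: A1.
  have := AZ (c - d)^-1 _ (AB _ _ Ad Ac).
  have -> : x - iota d - (x - iota c) = iota (c - d) by rewrite rmorphB; ring.
  by rewrite -rmorphM mulVf // rmorph1.
have exc x : exists c, A (x - iota c).
  have [Ax|Ax] := pselect (A x); first by exists 0; rewrite rmorph0 subr0.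
  (* B is the subspace spanned by A and x; by maximality of A it contains 1, and solving for x gives
     its component in k. *)
  pose B : set K := fun z => exists c, A (z - iota c * x).
  have : B 1.
    apply: contrapT => B1; apply: (Amax B); last first.
      split=> // z y c [d Ad] [d' Ad']; exists (d + c * d').
      have -> : z + iota c * y - iota (d + c * d') * x =
          (z - iota d * x) + iota c * (y - iota d' * x).
        by rewrite rmorphD rmorphM; ring.
      exact: Alin.
    split; first by move=> z Az; exists 0; rewrite rmorph0 mul0r subr0.
    by move=> /(_ x) AB'; apply/Ax/AB'; exists 1; rewrite rmorph1 mul1r subrr.
  move=> [c Ac]; have c0 : c != 0.
    by apply: contra_notN A1 => /eqP c0; move: Ac; rewrite c0 rmorph0 mul0r subr0.
  exists c^-1; have := AZ (- c^-1) _ Ac; congr A.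
  rewrite mulrBr mulrA -rmorphM mulNr mulVf // rmorphN rmorphN1 mulr1; ring.
have [lam lamE] : exists lam, forall x, A (x - iota (lam x)).
  by have [lam lamE] := choice exc; exists lam.
exists lam; split.
- move=> x y; apply: (uniqc (x + y)) => //.
  by have := AD _ _ (lamE x) (lamE y); rewrite rmorphD; congr A; ring.
- move=> c x; apply: (uniqc (iota c * x)) => //.
  by have := AZ c _ (lamE x); rewrite rmorphM mulrBr.
by move=> c; apply: (uniqc (iota c)) => //; rewrite subrr.
Qed.

Variables (n : nat) (I : finType) (f : I -> mpoly n k).

(** Applied to coefficients, the retraction is linear over the polynomials with coefficients in k,
    so that it sends a Koszul matrix over K to one over k. *)
Lemma koszul_exact_descent :
  koszul_exact (fun i => map_mpoly iota (f i)) -> koszul_exact f.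
Proof.
have [lam [lamD lamZ lamC]] := field_retraction.
have lam0 : lam 0 = 0 by rewrite -(rmorph0 iota) lamC.
have lamN x : lam (- x) = - lam x.
  by have := lamZ (- 1) x; rewrite rmorphN1 !mulN1r.
pose L (p : mpoly n K) : mpoly n k := \sum_(m <- msupp p) lam (mcoeff m p) *: mpolyX k m.
have LE m p : mcoeff m (L p) = lam (mcoeff m p).
  rewrite /L (mcoeff_sumX (fun m => lam (mcoeff m p))) ?msupp_uniq //.
  by rewrite mcoeff_msupp; case: (mcoeff m p =P 0) => //= ->.
have LN p : L (- p) = - L p by apply/mpolyP => m; rewrite LE !mcoeffN LE lamN.
have LM p q : L (p * map_mpoly iota q) = L p * q.
  apply/mpolyP => m; rewrite LE !mcoeffM (big_morph lam lamD lam0).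
  by apply: eq_bigr => b _; rewrite mcoeff_map_mpoly LE mulrC lamZ mulrC.
have LC p : L (map_mpoly iota p) = p.
  by apply/mpolyP => m; rewrite LE mcoeff_map_mpoly lamC.
have LD p q : L (p + q) = L p + L q.
  by apply/mpolyP => m; rewrite LE !mcoeffD !LE lamD.
have L0 : L 0 = 0 by apply/mpolyP => m; rewrite LE !mcoeff0.
move=> kf a a0; have [|s [sN s0 sE]] := kf (fun i => map_mpoly iota (a i)).
  rewrite -[RHS](rmorph0 (map_mpoly iota)) -a0 rmorph_sum.
  by apply: eq_bigr => i _; rewrite rmorphM.
exists (fun i j => L (s i j)); split => [i j|i|i]; first by rewrite sN LN.
  by rewrite s0 L0.
by rewrite -[LHS]LC sE (big_morph L LD L0); apply: eq_bigr => j _; rewrite LM.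
Qed.
End Retraction.

Section RegularOverField.
Variables (k : fieldType) (K : closedFieldType) (iota : {rmorphism k -> K}) (n : nat).
Hypothesis char0 : [pchar k] =i pred0.
Variables (f : 'I_n -> mpoly n k) (d : nat).
Hypothesis d0 : (0 < d)%N.
Hypothesis hf : forall l, hom d (f l).

Theorem koszul_exact_bpf :
  (forall a : 'I_n -> K, (forall l, meval a (map_mpoly iota (f l)) = 0) -> forall l, a l = 0) ->
  koszul_exact f.
Proof.
move=> f0; apply: (@koszul_exact_descent _ _ iota); apply: koszul_exact_forms d0 _ f0.
  by move=> p; rewrite (fmorph_pchar iota) char0.
by move=> l m; rewrite mcoeff_map_mpoly fmorph_eq0; exact: hf.
Qed.
End RegularOverField.

Section Monomials.
Variables (R : comNzRingType) (N : nat).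
Local Notation X := (@mpolyX N R).
Local Notation ix := (tw_ix (@all_mon N)).

Lemma tw_coef11 (a b : multinom N) : tw_coef (1 : R) 1 a b = 1.
Proof. by rewrite /tw_coef !expr1n mulr1. Qed.

Lemma homX_val d (i : ix d) : hom d (X (tw_val i)).
Proof.
move=> m; rewrite mcoeffX; have [di _] := tw_valP i.
by case: (tw_val i =P m) => [<-|_] //; rewrite eqxx.
Qed.

Definition ix_poly d (c : ix d -> R) : mpoly N R := \sum_i c i *: X (tw_val i).

Lemma hom_ix_poly d (c : ix d -> R) : hom d (ix_poly c).
Proof. by apply: hom_sum => i; apply: homZ; exact: homX_val. Qed.

Lemma mcoeff_ix_poly d (c : ix d -> R) i : mcoeff (tw_val i) (ix_poly c) = c i.
Proof.
rewrite raddf_sum (bigD1 i) //= mcoeffZ mcoeffX eqxx mulr1 big1 ?addr0 // => j ji.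
by rewrite mcoeffZ mcoeffX (inj_eq (@tw_val_inj _ _ _)) (negbTE ji) mulr0.
Qed.

Lemma hom_sum_ix d (p : mpoly N R) : hom d p -> p = ix_poly (fun i : ix d => mcoeff (tw_val i) p).
Proof.
move=> hp; apply/mpolyP => m.
have [h|h] := eqVneq (mcoeff m p) 0; last first.
  by have [i <-] := tw_val_ex (ok := @all_mon N) (hp _ h) isT; rewrite mcoeff_ix_poly.
rewrite h raddf_sum big1 //= => i _; rewrite mcoeffZ mcoeffX.
by case: (_ =P m) => [->|_]; rewrite ?h ?mul0r ?mulr0.
Qed.
End Monomials.

(** * Deformation of complete intersections of quadrics *)

Section MonomialSystem.
Variables (F : fieldType) (N : nat).
Local Notation S := (mpoly N F).
Local Notation X := (@mpolyX N F).
Local Notation ix := (tw_ix (@all_mon N)).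

(* The elements of A in the image of the monomials under a surjection from the
   polynomial algebra. *)
Definition monomial_system (A : galg F) (al : forall d, ix d -> A d) : Prop :=
  [/\ forall d (x : A d), exists c : ix d -> F, x = \sum_i c i *: al d i,
      forall i j l (E : (i + j)%N = l) a b,
        gmul E (al i a) (al j b) =
        \sum_x @tw_gam N (@all_mon N) F 1 1 i j l a b x *: al l x &
      gone A = \sum_z @tw_ups N (@all_mon N) F z *: al 0 z].

(** Coefficients outside degree d are ignored; the value is meant for p homogeneous of degree d. *)
Definition polA (A : galg F) (al : forall d, ix d -> A d) d (p : S) : A d :=
  \sum_(i : ix d) mcoeff (tw_val i) p *: al d i.

(** Degree by degree, A is the polynomial algebra modulo the ideal of the f. *)
Definition presented (T : finType) (A : galg F) (al : forall d, ix d -> A d) (f : T -> S) :=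
  monomial_system al /\
  forall d p, hom d p -> (polA al d p = 0 <-> in_ideal f p).

Variables (A : galg F) (al : forall d, ix d -> A d).
Arguments al : clear implicits.

Lemma polAL d c p q : polA al d (c *: p + q) = c *: polA al d p + polA al d q.
Proof.
rewrite /polA scaler_sumr -big_split; apply: eq_bigr => i _ /=.
by rewrite mcoeffD mcoeffZ scalerDl scalerA.
Qed.
Lemma polA0 d : polA al d 0 = 0.
Proof. by rewrite /polA big1 // => i _; rewrite mcoeff0 scale0r. Qed.
Lemma polAD d p q : polA al d (p + q) = polA al d p + polA al d q.
Proof. by rewrite -[p]scale1r polAL !scale1r. Qed.
Lemma polAZ d c p : polA al d (c *: p) = c *: polA al d p.
Proof. by rewrite -[c *: p]addr0 polAL polA0 addr0. Qed.
Lemma polA_sum d (I : Type) (r : seq I) (G : I -> S) :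
  polA al d (\sum_(i <- r) G i) = \sum_(i <- r) polA al d (G i).
Proof. by apply: (big_morph (polA al d)) => [p q|]; [exact: polAD|exact: polA0]. Qed.
Lemma polAX d m : polA al d (X m) = tw_el al d m.
Proof.
rewrite /polA /tw_el [RHS]big_mkcond; apply: eq_bigr => i _.
by rewrite mcoeffX eq_sym; case: eqP => _; rewrite ?scale1r ?scale0r.
Qed.

Hypothesis al_sys : monomial_system al.

Lemma polA_span d (x : A d) : exists2 p, hom d p & x = polA al d p.
Proof.
have [span _ _] := al_sys; have [c ->] := span d x.
exists (ix_poly c); first exact: hom_ix_poly.
by apply: eq_bigr => i _; rewrite mcoeff_ix_poly.
Qed.

Lemma polAM i j l (E : (i + j)%N = l) p q : hom i p -> hom j q ->
  gmul E (polA al i p) (polA al j q) = polA al l (p * q).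
Proof.
have [_ mul _] := al_sys.
move=> hp hq; rewrite (hom_sum_ix hp) (hom_sum_ix hq) mulr_suml !polA_sum gmul_suml.
apply: eq_bigr => a _; rewrite gmul_sumr mulr_sumr polA_sum; apply: eq_bigr => b _.
rewrite -scalerAl -scalerAr !polAZ gmulZl gmulZr -mpolyXD !polAX.
have [da _] := tw_valP a; have [db _] := tw_valP b.
by rewrite (tw_elM mul) // tw_coef11 scale1r.
Qed.

Lemma polA_ideal (T : finType) (f : T -> S) d p : (forall t, hom 2 (f t)) ->
  (forall t, polA al 2 (f t) = 0) -> hom d p -> in_ideal f p -> polA al d p = 0.
Proof.
move=> hf f0 hp fp; have [a [-> ah]] := in_ideal_hom hf hp fp.
rewrite polA_sum big1 // => t _; have := ah t; case: ifP => [d2 hat|_ ->].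
  have E : (d - 2 + 2)%N = d by rewrite subnK.
  by rewrite -(polAM E hat (hf t)) f0 gmul0r.
by rewrite mul0r polA0.
Qed.

End MonomialSystem.

Section Existence.
Variables (F : fieldType) (N : nat) (T : finType) (f : T -> mpoly N F).
Local Notation S := (mpoly N F).
Local Notation X := (@mpolyX N F).
Local Notation ix := (tw_ix (@all_mon N)).
Hypothesis hf : forall t, hom 2 (f t).

Lemma all_mon_down (a b : multinom N) : all_mon (mnm_add a b) -> all_mon a && all_mon b.
Proof. by []. Qed.

(** The model of the polynomial algebra modulo the f. Its monomials being free, an element of the
    two-sided ideal comes from a unique homogeneous polynomial, and induction on the ideal places it
    in [in_ideal f]. *)
Lemma presented_ex : exists (A : galg F) (al : forall d, ix d -> A d), presented al f.
Proof.
have [al0 [span0 free0 mul0 one0]] :=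
  sc_galg_has_sc (tw_axioms all_mon_down (erefl : all_mon (@mnm0 N)) (1 : F) 1).
set A := sc_galg _ in al0 span0 free0 mul0 one0.
have sys0 : monomial_system al0 by split.
pose R (r : A 2) := exists t, r = polA al0 2 (f t).
have polA_inj d p : hom d p -> polA al0 d p = 0 -> p = 0.
  move=> hp p0; rewrite (hom_sum_ix hp) /ix_poly big1 // => i _.
  by rewrite (free0 d _ p0) scale0r.
pose al d (a : ix d) : gquot R d := gquot_pi R (al0 d a).
have piL d c (x y : A d) : gquot_pi R (c *: x + y) = c *: gquot_pi R x + gquot_pi R y.
  exact: lquot_pi_linear.
have pi0 d : gquot_pi R (0 : A d) = 0.
  by have := piL d (-1) 0 0; rewrite scaler0 addr0 scaleN1r addNr.
have pi_sum d (I : Type) (r : seq I) (c : I -> F) (x : I -> A d) :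
    gquot_pi R (\sum_(i <- r) c i *: x i) = \sum_(i <- r) c i *: gquot_pi R (x i).
  by elim: r => [|i r IH]; rewrite ?big_nil ?pi0 // !big_cons piL IH.
have sys : monomial_system al.
  split.
  - move=> d x; have [c xE] := span0 d (repr x); exists c.
    by rewrite -[LHS]gquot_reprK xE pi_sum.
  - by move=> i j l E a b; rewrite -pi_sum -mul0; exact: gquot_pi_mul.
  by rewrite -pi_sum -one0.
exists (gquot R), al; split=> // d p hp; split=> [|fp]; last first.
  apply: (polA_ideal sys hf _ hp fp) => t.
  rewrite /polA -pi_sum -(pi0 2); apply/gquot_piP; rewrite subr0.
  by apply: gideal_incl; exists t.
rewrite /polA -pi_sum -(pi0 d) => /gquot_piP; rewrite subr0 -/(polA al0 d p) => I.
have [I0 ID IM] := is_ideal_in_ideal f.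
have key d' (x : A d') : gideal R x -> forall q, hom d' q -> x = polA al0 d' q -> in_ideal f q.
  elim=> {d' x I}.
  - move=> i j l d' e e' a r b [t ->] q hq qE.
    have [u hu aE] := polA_span sys0 a; have [v hv bE] := polA_span sys0 b.
    move: qE; rewrite aE bE (polAM sys0 e hu (@hf t)).
    have huf : hom j (u * f t) by rewrite -e; exact: homM.
    rewrite (polAM sys0 e' huf hv) => qE.
    have -> : q = v * u * f t.
      apply/eqP; rewrite -subr_eq0; apply/eqP; apply: (polA_inj d').
        rewrite -scaleN1r; apply: homD => //; apply: homZ; rewrite -e' -e addnC.
        by rewrite -mulrA; apply: homM => //; exact: homM.
      by rewrite -scaleN1r addrC polAL -qE -mulrA [v * _]mulrC scaleN1r addNr.
    by apply: (IM); exact: in_ideal_gen.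
  - by move=> d' q hq /esym /(polA_inj _ _ hq) ->.
  move=> d' c x y _ IHx _ IHy q hq qE.
  have [u hu xE] := polA_span sys0 x; have [v hv yE] := polA_span sys0 y.
  have -> : q = c *: u + v.
    apply/eqP; rewrite -subr_eq0; apply/eqP; apply: (polA_inj d').
      by rewrite -scaleN1r; apply: homD => //; apply/homZ/homD => //; exact: homZ.
    by rewrite -scaleN1r addrC polAL -qE polAL -xE -yE scaleN1r addNr.
  by apply: (ID); [rewrite -mul_mpolyC; apply: (IM); exact: IHx|exact: IHy].
exact: (key d _ I).
Qed.

End Existence.

Section SquareFree.
Variables (F : fieldType) (N : nat) (A : galg F).
Local Notation S := (mpoly N F).
Local Notation X := (@mpolyX N F).
Local Notation ix := (tw_ix (@all_mon N)).

(** [tw_el] sends to 0 the monomials that are not squarefree, which are the multiples of squares of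
    variables. *)
Lemma sqfree_presented :
  has_sc A (fun i j l => @tw_gam N (@sqfree N) F 1 1 i j l) (@tw_ups N (@sqfree N) F) ->
  exists al : forall d, ix d -> A d, presented al (fun i : 'I_N => X (mnm1 i) ^+ 2).
Proof.
move=> [e [espan efree emul eone]].
pose al d (a : ix d) : A d := tw_el e d (tw_val a).
have elE d (p : S) : polA al d p = \sum_(i : tw_ix (@sqfree N) d) mcoeff (tw_val i) p *: e d i.
  rewrite /polA; have h d' (i : ix d') : al d' i = tw_el e d' (tw_val i) by [].
  under eq_bigr do rewrite h /tw_el scaler_sumr.
  rewrite (exchange_big_dep xpredT) //=; apply: eq_bigr => j _.
  have [dj _] := tw_valP j; have [i iE] := tw_val_ex (ok := @all_mon N) dj isT.
  by rewrite (big_pred1 i) ?iE // => i' /=; rewrite -iE (inj_eq (@tw_val_inj _ _ _)) eq_sym.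
have span d (x : A d) : exists c : ix d -> F, x = \sum_i c i *: al d i.
  have [c ->] := espan d x.
  exists (fun i => mcoeff (tw_val i) (\sum_i c i *: X (tw_val i))).
  rewrite -/(polA al d _) elE; apply: eq_bigr => i _; congr (_ *: _).
  rewrite raddf_sum (bigD1 i) //= mcoeffZ mcoeffX eqxx mulr1 big1 ?addr0 // => j ji.
  by rewrite mcoeffZ mcoeffX (inj_eq (@tw_val_inj _ _ _)) (negbTE ji) mulr0.
have sys : monomial_system al.
  split=> //.
  - move=> i j l E a b; have [da _] := tw_valP a; have [db _] := tw_valP b.
    have -> : \sum_x tw_gam 1 1 a b x *: al l x = tw_el e l (mnm_add (tw_val a) (tw_val b)).
      have dab : mdeg (mnm_add (tw_val a) (tw_val b)) = l by rewrite mdegD da db.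
      have [x xE] := tw_val_ex (ok := @all_mon N) dab isT.
      rewrite (bigD1 x) //= /tw_gam xE eqxx tw_coef11 scale1r big1 ?addr0.
        by rewrite /al xE.
      by move=> y yx; rewrite -xE (inj_eq (@tw_val_inj _ _ _)) (negbTE yx) scale0r.
    rewrite /al; have [oka|noka] := boolP (sqfree (tw_val a)); last first.
      rewrite !(tw_el0 _ _ noka) gmul0l tw_el0 //.
      by apply: contra noka => /sqfree_down /andP [].
    have [okb|nokb] := boolP (sqfree (tw_val b)); last first.
      rewrite !(tw_el0 _ _ nokb) gmul0r tw_el0 //.
      by apply: contra nokb => /sqfree_down /andP [].
    by rewrite (tw_elM emul) // tw_coef11 scale1r.
  rewrite (tw_el_one eone); apply/esym.
  apply: (tw_sum0 (ok := @all_mon N)) => // z z0; by rewrite scale1r /al z0.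
exists al; split=> // d p hp; rewrite elE; split=> [/efree p0|[a pE]]; last first.
  rewrite big1 // => i _; rewrite pE raddf_sum big1 ?scale0r //= => j _.
  have [_ /forallP /(_ j) ij] := tw_valP i.
  rewrite expr2 mulrA mulrC mcoeffXM; case: ifP => // jm.
  rewrite mulrC mcoeffXM lep1mP mnmBE mnm1E eqxx.
  by move: ij; case: (tw_val i j) => [|[|]].
rewrite [p]mpolyE; have [I0 ID IM] := is_ideal_in_ideal (fun i : 'I_N => X (mnm1 i) ^+ 2).
rewrite big_seq; elim/big_ind: _ => // m; rewrite mcoeff_msupp => pm.
have [okm|/sqfreePn [i [m' ->]]] := boolP (sqfree m).
  have [i iE] := tw_val_ex (hp _ pm) okm.
  by move: pm; rewrite -iE p0 eqxx.
rewrite -mul_mpolyC !mpolyXD; apply: (IM); rewrite mulrA mulrC -expr2; apply: (IM).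
exact: (in_ideal_gen (fun i : 'I_N => X (mnm1 i) ^+ 2)).
Qed.
End SquareFree.

Lemma sum_alternating (V : zmodType) (I : finType) (G : I -> I -> V) :
  (forall i j, G i j = - G j i) -> (forall i, G i i = 0) -> \sum_i \sum_j G i j = 0.
Proof.
move=> GN G0; elim: (index_enum I) => [|i r IH]; first by rewrite big_nil.
rewrite big_cons big_cons G0 add0r.
under [X in _ + X]eq_bigr do rewrite big_cons.
rewrite big_split /= IH addr0 -big_split big1 // => j _ /=.
by rewrite GN addNr.
Qed.

Lemma sum_sub_koszul (R : comNzRingType) (I : finType) (a g : I -> R) (s : I -> I -> R) :
  (forall i j, s i j = - s j i) -> (forall i, s i i = 0) ->
  \sum_i (a i - \sum_j s i j * g j) * g i = \sum_i a i * g i.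
Proof.
move=> sN s0; under eq_bigr do rewrite mulrBl mulr_suml.
rewrite sumrB sum_alternating ?subr0 // => [i j|i]; last by rewrite s0 !mul0r.
by rewrite sN mulNr mulNr mulrAC.
Qed.

Section CompleteIntersections.
Variables (k : fieldType) (N : nat) (T : finType).
Variable f : bool -> T -> mpoly N k.
Hypothesis hf : forall b t, hom 2 (f b t).
Hypothesis kf : forall b, koszul_exact (f b).
Local Notation P := {poly k}.
Local Notation K := {fraction P}.
Local Notation X := (@mpolyX N _).
Local Notation ix := (tw_ix (@all_mon N)).
Local Notation tau b := ('X - (b%:R)%:P : P).
Local Notation ev b := (map_mpoly (horner_eval (b%:R : k))).
Local Notation cst := (map_mpoly (polyC : k -> P)).
Local Notation gen := (map_mpoly (@tofrac P)).

Let ft t : mpoly N P := (1 - 'X) *: cst (f false t) + 'X *: cst (f true t).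
Let fK t : mpoly N K := gen (ft t).

Lemma map_mpoly_scale (R S : comNzRingType) (g : {rmorphism R -> S}) c (p : mpoly N R) :
  map_mpoly g (c *: p) = g c *: map_mpoly g p.
Proof. by apply/mpolyP => m; rewrite mcoeffZ !mcoeff_map_mpoly mcoeffZ /= rmorphM. Qed.

Lemma map_mpoly_inj (R S : comNzRingType) (g : {rmorphism R -> S}) :
  injective g -> injective (@map_mpoly N R S g).
Proof.
move=> gI p q e; apply/mpolyP => m; apply: (gI).
by have := congr1 (mcoeff m) e; rewrite !mcoeff_map_mpoly.
Qed.

Lemma map_mpoly_hom (R S : comNzRingType) (g : {rmorphism R -> S}) d (p : mpoly N R) :
  hom d p -> hom d (map_mpoly g p).
Proof.
move=> hp m; rewrite mcoeff_map_mpoly => h; apply: hp.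
by apply: contraNneq h => -> /=; rewrite rmorph0.
Qed.

Let hft t : hom 2 (ft t).
Proof. by apply: homD; apply/homZ/map_mpoly_hom; exact: hf. Qed.

Let ev_cst (b : bool) (p : mpoly N k) : ev b (cst p) = p.
Proof. by apply/mpolyP => m; rewrite !mcoeff_map_mpoly /= /horner_eval hornerC. Qed.

Let ev_ft (b : bool) t : ev b (ft t) = f b t.
Proof.
have scal (c : P) (p : mpoly N k) : ev b (c *: cst p) = c.[b%:R] *: p.
  by transitivity (c.[b%:R] *: ev b (cst p)); [exact: map_mpoly_scale|rewrite ev_cst].
apply: etrans (_ : ev b ((1 - 'X) *: cst (f false t)) + ev b ('X *: cst (f true t)) = _).
  exact: rmorphD.
apply: etrans (congr2 +%R (scal _ _) (scal _ _)) _.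
rewrite hornerX; have -> : (1 - 'X : P).[b%:R] = 1 - b%:R by rewrite !hornerE.
by case: b {scal}; rewrite ?subrr ?subr0 ?scale0r ?scale1r ?add0r ?addr0.
Qed.

Lemma factor_tau_mpoly (b : bool) (p : mpoly N P) : ev b p = 0 -> exists q, p = tau b *: q.
Proof.
move=> p0; have /choice [c cE] m : exists c, mcoeff m p = tau b * c.
  apply: factor_tau; have := congr1 (mcoeff m) p0.
  by rewrite mcoeff_map_mpoly mcoeff0.
exists (\sum_(m <- msupp p) c m *: X m); rewrite {1}[p]mpolyE scaler_sumr.
by apply: eq_bigr => m _; rewrite cE scalerA.
Qed.

Lemma mpoly_scaleI (R : idomainType) (c : R) (p q : mpoly N R) :
  c != 0 -> c *: p = c *: q -> p = q.
Proof.
move=> c0 e; apply/mpolyP => m; apply: (mulfI c0).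
by rewrite -!mcoeffZ e.
Qed.

(* Relations between the members of the special fiber are Koszul relations, which lift. *)
Lemma family_torsion_free (b : bool) (Q : mpoly N P) :
  in_ideal ft (tau b *: Q) -> in_ideal ft Q.
Proof.
move=> [a aE]; have [|s [sN s0 sE]] := kf (b := b) (a := fun t => ev b (a t)).
  have tau0 : horner_eval (b%:R : k) (tau b) = 0 by rewrite /horner_eval !hornerE subrr.
  have := congr1 (ev b) aE; rewrite map_mpoly_scale /= tau0 scale0r.
  rewrite rmorph_sum => e; rewrite [RHS]e; apply: eq_bigr => t _.
  by rewrite rmorphM /= ev_ft.
(* Subtracting the lifted Koszul relation leaves the sum unchanged and makes every coefficient
   divisible by t - b. *)
have /choice [c cE] t : exists c, a t - \sum_j cst (s t j) * ft j = tau b *: c.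
  apply: factor_tau_mpoly; rewrite rmorphB /= rmorph_sum sE.
  apply/eqP; rewrite subr_eq0; apply/eqP; apply: eq_bigr => j _.
  by rewrite rmorphM /= ev_cst ev_ft.
exists c; apply: (@mpoly_scaleI _ (tau b)); first exact: tau_neq0.
rewrite aE scaler_sumr; have <- := @sum_sub_koszul _ _ a ft (fun t j => cst (s t j)).
- by apply: eq_bigr => t _; rewrite cE -scalerAl.
- by move=> i j; rewrite sN; exact: rmorphN.
by move=> i; rewrite s0; exact: rmorph0.
Qed.

Let gen_scale c (p : mpoly N P) : gen (c *: p) = tofrac c *: gen p.
Proof. exact: map_mpoly_scale. Qed.

Let gen_inj (p q : mpoly N P) : gen p = gen q -> p = q.
Proof.
by apply: map_mpoly_inj => x y /eqP; rewrite tofrac_eq => /eqP.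
Qed.

Lemma clear_denominators (p : mpoly N K) :
  exists (u : P) (q : mpoly N P), u != 0 /\ tofrac u *: p = gen q.
Proof.
rewrite [p]mpolyE; elim/big_ind: _ => [|p1 p2 [u1 [q1 [n1 e1]]] [u2 [q2 [n2 e2]]]|m _].
- exists 1, 0; split; first exact: oner_neq0.
  by rewrite scaler0 rmorph0.
- exists (u1 * u2), (u2 *: q1 + u1 *: q2); split; first exact: mulf_neq0.
  have -> : gen (u2 *: q1 + u1 *: q2) = gen (u2 *: q1) + gen (u1 *: q2) by exact: rmorphD.
  rewrite !gen_scale -e1 -e2 !scalerA scalerDr tofracM.
  by rewrite [tofrac u2 * _]mulrC.
have [u [q [u0 e]]] := fraction_ex (mcoeff m p); exists u, (q *: X m); split; first exact: u0.
by rewrite gen_scale map_mpolyX scalerA e.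
Qed.

Lemma in_ideal_descend (Q : mpoly N P) : in_ideal fK (gen Q) ->
  exists2 u : P, u != 0 & in_ideal ft (u *: Q).
Proof.
move=> [a aE]; have /choice [u /choice [q uq]] t := clear_denominators (a t).
pose w t := \prod_(s | s != t) u s.
exists (\prod_t u t); first by apply/prodf_neq0 => t _; case: (uq t).
exists (fun t => w t *: q t); apply: gen_inj.
rewrite gen_scale aE scaler_sumr rmorph_sum; apply: eq_bigr => t _ /=.
rewrite rmorphM /= gen_scale -(uq t).2 -!scalerAl scalerA -tofracM.
by rewrite [in LHS](bigD1 t) //= mulrC.
Qed.

Let hfK t : hom 2 (fK t). Proof. by apply: map_mpoly_hom; exact: hft. Qed.

Let ev_scale (b : bool) (c : P) (p : mpoly N P) : ev b (c *: p) = c.[b%:R] *: ev b p.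
Proof. exact: map_mpoly_scale. Qed.

Let ev_ideal (b : bool) (p : mpoly N P) : in_ideal ft p -> in_ideal (f b) (ev b p).
Proof.
move=> [a ->]; exists (fun t => ev b (a t)).
apply: etrans (_ : \sum_t ev b (a t * ft t) = _); first exact: rmorph_sum.
by apply: eq_bigr => t _; rewrite -(ev_ft b); exact: rmorphM.
Qed.

(** Clearing denominators puts u Q in the ideal over k[t]. The factors t - b of u are removed by
    [family_torsion_free], and the rest of u is nonzero at b. *)
Lemma family_specialize (b : bool) (Q : mpoly N P) :
  in_ideal fK (gen Q) -> in_ideal (f b) (ev b Q).
Proof.
move=> /in_ideal_descend [u u0].
have [r [v [v0 ->]]] : exists r v, v.[b%:R] != 0 /\ u = tau b ^+ r * v.
  have [r [v]] := multiplicity_XsubC u (b%:R); rewrite u0 => vr ->.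
  by exists r, v; split=> //; exact: mulrC.
elim: r => [|r IH]; last by rewrite exprS -mulrA -scalerA => /family_torsion_free.
rewrite expr0 mul1r => /(@ev_ideal b); rewrite ev_scale => h.
have [_ _ IM] := is_ideal_in_ideal (f b).
have -> : ev b Q = mpolyC N v.[b%:R]^-1 * (v.[b%:R] *: ev b Q).
  by rewrite mul_mpolyC scalerA mulVf // scale1r.
exact: IM.
Qed.

(** An expression in the generators at b is lifted with constant coefficients; the error is
    divisible by t - b, with quotient Q'. *)
Lemma family_lift (b : bool) d (Q : mpoly N P) : hom d Q -> in_ideal (f b) (ev b Q) ->
  exists Q', hom d Q' /\ in_ideal fK (gen Q - tofrac (tau b) *: gen Q').
Proof.
move=> hQ fQ; have [a [aE ah]] := in_ideal_hom (@hf b) (map_mpoly_hom hQ) fQ.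
pose D := \sum_t cst (a t) * ft t.
have hD : hom d D.
  apply: hom_sum => t; have := ah t; case: ifP => [d2 hat|_ ->].
    by rewrite -(subnK d2); apply: homM => //; exact: map_mpoly_hom.
  by rewrite rmorph0 mul0r; exact: hom0.
have [|Q' Q'E] := @factor_tau_mpoly b (Q - D).
  apply: etrans (_ : ev b Q - ev b D = _); first exact: rmorphB.
  rewrite aE; apply/eqP; rewrite subr_eq0; apply/eqP.
  apply: etrans (_ : \sum_t ev b (cst (a t) * ft t) = _); last exact/esym/rmorph_sum.
  apply: eq_bigr => t _; rewrite -[in LHS](ev_cst b (a t)) -[in LHS](ev_ft b).
  exact/esym/rmorphM.
exists Q'; split.
  move=> m Qm; have : hom d (Q - D) by rewrite -scaleN1r; apply: homD => //; exact: homZ.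
  by apply; rewrite Q'E mcoeffZ mulf_neq0 ?tau_neq0.
exists (fun t => gen (cst (a t))).
apply: etrans (_ : gen (Q - tau b *: Q') = _).
  by rewrite -gen_scale; exact/esym/rmorphB.
rewrite -Q'E opprB addrC subrK.
apply: etrans (_ : \sum_t gen (cst (a t) * ft t) = _); first exact: rmorph_sum.
by apply: eq_bigr => t _; exact: rmorphM.
Qed.

(** The generic algebra is the quotient over k(t) by the pencil of forms; [family_specialize] and
    [family_lift] are the two conditions of [span_family] on specialization. *)
Theorem complete_intersection_family (A : bool -> galg k)
    (al : forall b d, ix d -> A b d) :
  (forall b, presented (al b) (f b)) -> fibers_of_one_family (A false) (A true).
Proof.
move=> pres; have [AK [e [[esp emul eone] eP]]] := presented_ex hfK.
have eE d (p : ix d -> P) : ecomb e p = polA e d (gen (ix_poly p)).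
  by apply: eq_bigr => i _; rewrite mcoeff_map_mpoly mcoeff_ix_poly.
have aE b d (p : ix d -> P) : acomb al b p = polA (al b) d (ev b (ix_poly p)).
  by apply: eq_bigr => i _; rewrite mcoeff_map_mpoly mcoeff_ix_poly.
apply: (@span_family k AK A ix e al).
- exact: esp.
- by move=> b d x; have [[sp _ _] _] := pres b; exact: sp.
- move=> i j l E a c; exists (tw_gam 1 1 a c); split.
    rewrite emul; apply: eq_bigr => x _; rewrite /tw_gam; case: ifP => _.
      by rewrite !tw_coef11 tofrac1.
    by rewrite tofrac0.
  move=> b; have [[_ mul _] _] := pres b; rewrite mul; apply: eq_bigr => x _.
  rewrite /tw_gam; case: ifP => _; last by rewrite horner0.
  by rewrite !tw_coef11 hornerC.
- exists (fun=> 1); split; first by rewrite eone; apply: eq_bigr => z _; rewrite tofrac1.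
  by move=> b; have [[_ _ ->] _] := pres b; apply: eq_bigr => z _; rewrite hornerC.
- move=> b d p; rewrite eE aE => /eP h; have [_ aP] := pres b.
  apply/aP; first by apply/map_mpoly_hom; exact: hom_ix_poly.
  by apply/family_specialize/h/map_mpoly_hom; exact: hom_ix_poly.
move=> b d p; rewrite aE; have [_ aP] := pres b.
move/aP => /(_ (map_mpoly_hom (@hom_ix_poly _ _ _ _))).
move=> /(family_lift (@hom_ix_poly _ _ _ _)) [Q' [hQ' h]].
exists (fun i => mcoeff (tw_val i) Q'); rewrite !eE -(hom_sum_ix hQ') -polAZ.
apply/eqP; rewrite -subr_eq0 -scaleN1r addrC -polAL scaleN1r addrC; apply/eqP.
apply/eP => //; rewrite -scaleN1r; apply: homD; last do 2 apply: homZ.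
  by apply/map_mpoly_hom; exact: hom_ix_poly.
exact: map_mpoly_hom.
Qed.

End CompleteIntersections.

Lemma gword_polA (F : fieldType) N (A : galg F)
    (al : forall d, tw_ix (@all_mon N) d -> A d) w d :
  monomial_system al -> size w = d ->
  gword (tw_letter al) w d = polA al d (mpolyX F (mcontent w)).
Proof.
move=> [_ mul one] wd; have S2 (a b : F) : 1 = a -> 1 = b -> 1 = a * b.
  by move=> <- <-; rewrite mul1r.
have swap (i j : 'I_N) : (j < i)%N -> exists c, 1 = c /\
    gmul (erefl : (1 + 1)%N = 2) (tw_letter al i) (tw_letter al j) =
    c *: gmul (erefl : (1 + 1)%N = 2) (tw_letter al j) (tw_letter al i).
  by move=> _; exists 1; rewrite !(tw_letterM _ mul) // !expr1n !scale1r addmC.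
have [_ [<- ->]] := gword_nf erefl S2 swap w d.
by rewrite scale1r polAX (tw_gword_mword _ _ mul one) // mdeg_content.
Qed.

(** * Quotients of the tensor algebra with commuting letters *)

Section CommutativePresentation.
Variables (F : fieldType) (W : vectType F).
Local Notation N := (\dim {:W}).
Local Notation S := (mpoly N F).
Local Notation X := (@mpolyX N F).
Local Notation ix := (tw_ix (@all_mon N)).

Definition sym2 (r : tensor_algebra W 2) : S :=
  \sum_(t : 2.-tuple 'I_N) ((r : tpow W 2) t : F) *: X (mcontent t).

Variables (R : tensor_algebra W 2 -> Prop) (T : finType) (f : T -> S).
Hypothesis R_comm : forall i j, R (tvec2 (bvec i) (bvec j) - tvec2 (bvec j) (bvec i)).
Hypothesis R_f : forall t, exists2 r, R r & sym2 r = f t.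
Hypothesis f_R : forall r, R r -> in_ideal f (sym2 r).

Lemma hom_sym2 r : hom 2 (sym2 r).
Proof.
apply: hom_sum => t; apply: homZ.
by have := @homX F N (mcontent t); rewrite mdeg_content size_tuple.
Qed.

(** Commuting letters make the monomials span, and the relations symmetrize into the ideal of the f.
    That no further relation holds is seen on the morphism to the algebra of [presented_ex]. *)
Lemma commutative_presented : exists al : forall d, ix d -> gquot R d, presented al f.
Proof.
have hf t : hom 2 (f t) by have [r _ <-] := R_f t; exact: hom_sym2.
pose x_ := qletter R.
have swap (i j : 'I_N) : (j < i)%N -> exists c, 1 = c /\
    gmul (erefl : (1 + 1)%N = 2) (x_ i) (x_ j) =
    c *: gmul (erefl : (1 + 1)%N = 2) (x_ j) (x_ i).
  move=> _; exists 1; split=> //; rewrite scale1r !qletterM.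
  by apply/gquot_piP/gideal_incl.
have nf w d : gword x_ w d = gword x_ (mword (mcontent w)) d.
  have S2 (a b : F) : 1 = a -> 1 = b -> 1 = a * b by move=> <- <-; rewrite mul1r.
  by have [_ [<- ->]] := gword_nf erefl S2 swap w d; rewrite scale1r.
pose al d (a : ix d) : gquot R d := gword x_ (mword (tw_val a)) d.
have alE d m : mdeg m = d -> tw_el al d m = gword x_ (mword m) d.
  by move=> md; have [a <-] := tw_val_ex (ok := @all_mon N) md isT; rewrite tw_elE.
have wordE w d : size w = d -> gword x_ w d = polA al d (X (mcontent w)).
  by move=> wd; rewrite polAX alE ?mdeg_content // nf.
have sys : monomial_system al.
  split.
  - move=> d x; have [c ->] := gquot_span x.
    exists (fun i => mcoeff (tw_val i) (\sum_t c t *: X (mcontent t))).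
    rewrite -/(polA al d _) polA_sum; apply: eq_bigr => t _.
    by rewrite polAZ -wordE // size_tuple.
  - move=> i j l E a b; have [da _] := tw_valP a; have [db _] := tw_valP b.
    rewrite gword_cat ?size_mword // nf mcontent_cat !mwordK.
    have dab : mdeg (mnm_add (tw_val a) (tw_val b)) = l by rewrite mdegD da db.
    rewrite -alE // /tw_el [LHS]big_mkcond; apply: eq_bigr => x _.
    by rewrite /tw_gam; case: ifP => _; rewrite ?tw_coef11 ?scale1r ?scale0r.
  rewrite -[LHS]/(gword x_ [::] 0) wordE // polAX /tw_el [LHS]big_mkcond.
  apply: eq_bigr => z _; rewrite tw_ix0 scale1r ifT //.
have piE r : gquot_pi R r = polA al 2 (sym2 r).
  rewrite {1}(tensor_sum r) gquot_pi_sum polA_sum; apply: eq_bigr => t _.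
  by rewrite polAZ -wordE ?size_tuple // gquot_gword.
have f0 t : polA al 2 (f t) = 0.
  have [r Rr <-] := R_f t; rewrite -piE -(gquot_pi0 R 2); apply/gquot_piP.
  by rewrite subr0; exact: gideal_incl.
exists al; split=> // d p hp; split=> [p0|]; last exact: polA_ideal.
have [B [be [sysB fB]]] := presented_ex hf; pose Y := tw_letter be.
have RY r : R r -> tmor Y r = 0.
  move=> Rr; rewrite -[RHS]((fB 2 _ (@hom_sym2 r)).2 (f_R Rr)) polA_sum.
  apply: eq_bigr => t _; rewrite polAZ; congr (_ *: _).
  by rewrite gword_polA ?size_tuple.
apply/(fB d p hp).
transitivity (qmor Y (polA al d p)); last by rewrite p0 qmor0.
rewrite (qmor_sum RY); apply: eq_bigr => i _; congr (_ *: _).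
rewrite (qmor_gword RY); have [di _] := tw_valP i.
by rewrite gword_polA ?size_mword // mwordK polAX tw_elE.
Qed.
End CommutativePresentation.

Lemma sum_tuple2 (V : nmodType) (I : finType) (G : 2.-tuple I -> V) :
  \sum_t G t = \sum_i \sum_j G [tuple i; j].
Proof.
rewrite pair_big (reindex (fun p : I * I => [tuple p.1; p.2])) //=.
exists (fun t : 2.-tuple I => (tnth t ord0, tnth t ord_max)) => [[i j]|t] _ //.
by apply: val_inj; case: t => [[|a [|b []]]].
Qed.

Lemma sum_pair_support (V : nmodType) (I : finType) (a b : I) (G : I -> I -> V) : a != b ->
  (forall i j, (i, j) != (a, b) -> (i, j) != (b, a) -> G i j = 0) ->
  \sum_i \sum_j G i j = G a b + G b a.
Proof.
move=> ab G0; rewrite pair_big (bigD1 (a, b)) //= (bigD1 (b, a)) /=; last first.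
  by apply: contra ab => /eqP [->].
by rewrite big1 ?addr0 // => -[i j] /andP [h1 h2]; exact: G0.
Qed.

(** * The quadratic dual *)

Section CliffordProductOfVectors.
Variables (F : fieldType) (n : nat).
Local Notation ev := (@evec F n).
Local Notation ebe := (@ext_basis F n).

Definition skew_sign (i j : 'I_n) : F := if i == j then 0 else if (j < i)%N then -1 else 1.

Lemma skew_signN i j : skew_sign i j = - skew_sign j i.
Proof.
rewrite /skew_sign eq_sym; case: eqP => [_|/eqP ij]; first by rewrite oppr0.
have : (i : nat) != j by rewrite eq_sym.
by case: ltngtP; rewrite ?opprK.
Qed.

Lemma wedge2 i j : wedge [:: ev i; ev j] = skew_sign i j *: ebe [set i; j].
Proof.
have e1 : ext_mulv (ev j) (ext_one F n) = ebe [set j].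
  have := @wedge_sorted F n [:: j] isT.
  by rewrite /= => ->; congr ebe; apply/setP => l; rewrite !inE.
rewrite /= e1 ext_mulv_delta ext_mulb_basis inE /skew_sign; case: eqP => // /eqP ij.
rewrite /ext_sign big_setU1 ?inE // big_set1 ltnn /= mul1r.
by congr (_ *: _).
Qed.

Lemma bilf_evec (q : 'M[F]_n) i j : bilf q (ev i) (ev j) = q i j.
Proof.
by rewrite /bilf /evec -rowE mxE (bigD1 j) //= big1 ?addr0 => [|l /negbTE lj];
  rewrite !mxE ?eqxx ?mulr1 // ?lj ?andbF ?mulr0.
Qed.

Lemma clifford_mul2 (q : 'M[F]_n) mul i j : is_clifford_product q mul ->
  mul (wedge [:: ev i]) (wedge [:: ev j]) =
  skew_sign i j *: ebe [set i; j] + q i j *: ext_one F n.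
Proof.
move=> [_ _ _ _ mulV]; rewrite mulV wedge2 big_ord1 expr0 mul1r /=.
by rewrite bilf_evec.
Qed.

(** Up to sign, the coefficient at a pair {a, b} is M a b - M b a; the coefficient at the empty set
    is the pairing of M with q. *)
Lemma clifford_relation (q : 'M[F]_n) (M : 'I_n -> 'I_n -> F) :
  \sum_i \sum_j M i j *: (skew_sign i j *: ebe [set i; j] + q i j *: ext_one F n) = 0 <->
  (forall i j, M i j = M j i) /\ \sum_i \sum_j M i j * q i j = 0.
Proof.
set Z := \sum_i _; have ZE J : Z J = \sum_i \sum_j M i j * (skew_sign i j * (J == [set i; j])%:R
    + q i j * (J == set0)%:R).
  rewrite sum_ffunE; apply: eq_bigr => i _; rewrite sum_ffunE; apply: eq_bigr => j _.
  by rewrite !ffunE.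
have n0 (i j : 'I_n) : (set0 == [set i; j]) = false.
  by apply/negbTE; rewrite eq_sym; apply/set0Pn; exists i; rewrite !inE eqxx.
split=> [Z0|[Msym Mq]].
  split; last first.
    have := ZE set0; rewrite Z0 ffunE => /esym e; rewrite -[RHS]e.
    apply: eq_bigr => i _; apply: eq_bigr => j _.
    by rewrite n0 eqxx mulr0 add0r mulr1.
  move=> a b; have [->//|ab] := eqVneq a b.
  have := ZE [set a; b]; rewrite Z0 ffunE (@sum_pair_support _ _ a b) // => [|i j h1 h2].
    rewrite (setUC [set b] [set a]) !eqxx ![_ == set0]eq_sym n0 !mulr0 !addr0 !mulr1 (skew_signN b a) mulrN -mulrBl.
    move/esym/eqP; rewrite mulf_eq0 subr_eq0 => /orP [/eqP //|].
    by rewrite /skew_sign (negbTE ab); case: ifP => _; rewrite ?oppr_eq0 oner_eq0.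
  rewrite eq_sym [_ == set0]eq_sym n0 mulr0 addr0.
  case: eqP => [e|_]; last by rewrite !mulr0.
  have [ij|ij] := eqVneq i j; first by rewrite /skew_sign ij eqxx mul0r mulr0.
  have : i \in [set a; b] by rewrite -e !inE eqxx.
  have : j \in [set a; b] by rewrite -e !inE eqxx orbT.
  rewrite !inE => /orP [] /eqP jE /orP [] /eqP iE; subst i j.
  - by rewrite eqxx in ij.
  - by rewrite eqxx in h2.
  - by rewrite eqxx in h1.
  by rewrite eqxx in ij.
apply/ffunP => J; rewrite ZE ffunE.
under eq_bigr do under eq_bigr do rewrite mulrDr.
under eq_bigr do rewrite big_split.
rewrite big_split /= [X in _ + X](_ : _ = (J == set0)%:R * \sum_i \sum_j M i j * q i j).
  rewrite Mq mulr0 addr0; apply: sum_alternating => [i j|i].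
    by rewrite Msym skew_signN mulNr mulrN setUC.
  by rewrite /skew_sign eqxx mul0r mulr0.
rewrite mulr_sumr; apply: eq_bigr => i _; rewrite mulr_sumr; apply: eq_bigr => j _.
by rewrite mulrA mulrC.
Qed.

End CliffordProductOfVectors.

Section QuadraticRelations.
Variables (k : fieldType) (V : vectType k) (U : {vspace bilin V}).
Hypothesis symU : symmetric_forms U.
Local Notation n := (\dim {:V}).
Local Notation m := (\dim U).
Local Notation K := (PU_frac U).
Local Notation mul := (cl_mul symU).
Local Notation ev := (@evec K n).
Local Notation ebe := (@ext_basis K n).
Local Notation cst := (@PU_const k V U).

Lemma PU_const0 : cst 0 = 0.
Proof. by rewrite /PU_const mpolyC0 tofrac0. Qed.
Lemma PU_const_eq0 c : (cst c == 0) = (c == 0).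
Proof. by rewrite /PU_const tofrac_eq0 mpolyC_eq0. Qed.

Lemma cl_val_vec i : cl_val (coordinate_vec symU (bvec i)) = wedge [:: ev i].
Proof.
rewrite /=; congr ext_mulv; apply/rowP => a; rewrite !mxE /bcoord /bvec coord_free.
  by rewrite eqxx /= eq_sym; case: eqP => _; rewrite ?PU_const0 ?PU_const1.
exact: basis_free (vbasisP _).
Qed.

Lemma PU_constB a b : cst (a - b) = cst a - cst b.
Proof. by rewrite /PU_const mpolyCB tofracB. Qed.

Lemma PU_const_sum (I : finType) (F : I -> k) : cst (\sum_i F i) = \sum_i cst (F i).
Proof. by apply: (big_morph cst) => [a b|]; [exact: PU_constD|exact: PU_const0]. Qed.

Lemma universal_sum (M : 'I_n -> 'I_n -> k) :
  \sum_i \sum_j cst (M i j) * universal_form U i j =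
  \sum_(l < m) cst (\sum_i \sum_j M i j * bilin_eval (vbasis U)`_l (bvec i) (bvec j)) *
    PU_var l.
Proof.
transitivity (\sum_i \sum_j \sum_(l < m)
    cst (M i j * bilin_eval (vbasis U)`_l (bvec i) (bvec j)) * PU_var l).
  apply: eq_bigr => i _; apply: eq_bigr => j _; rewrite mxE mulr_sumr.
  by apply: eq_bigr => l _; rewrite PU_constM mulrA.
transitivity (\sum_i \sum_(l < m) \sum_j
    cst (M i j * bilin_eval (vbasis U)`_l (bvec i) (bvec j)) * PU_var l).
  by apply: eq_bigr => i _; exact: exchange_big.
rewrite exchange_big; apply: eq_bigr => l _; rewrite PU_const_sum mulr_suml.
by apply: eq_bigr => i _; rewrite PU_const_sum mulr_suml.
Qed.

Lemma linear_form_eq0 (c : 'I_m -> k) :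
  \sum_l cst (c l) * PU_var l = 0 <-> forall l, c l = 0.
Proof.
have -> : \sum_l cst (c l) * PU_var l = tofrac (\sum_l mpolyC m (c l) * mpolyX k (mnm1 l)).
  rewrite rmorph_sum; apply: eq_bigr => l _; rewrite /PU_const /PU_var.
  exact/esym/tofracM.
split=> [/eqP|c0]; last first.
  by rewrite big1 ?tofrac0 // => l _; rewrite c0 mpolyC0 mul0r.
rewrite tofrac_eq0 => /eqP e l; have := congr1 (mcoeff (mnm1 l)) e.
rewrite mcoeff0 raddf_sum (bigD1 l) //= mul_mpolyC mcoeffZ mcoeffX eqxx mulr1.
rewrite big1 ?addr0 // => j jl; rewrite mul_mpolyC mcoeffZ mcoeffX.
by rewrite eq_mnm1 (negbTE jl) mulr0.
Qed.

(** The relations are the symmetric tensors annihilated by U. The scalar part of a Clifford product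
    is a linear form on U, and it vanishes when its coefficients in the independent variables do. *)
Lemma quadratic_relationsP (r : tensor_algebra V 2) :
  quadratic_relations (coordinate_vec symU) r <->
  (forall i j, (r : tpow V 2) [tuple i; j] = (r : tpow V 2) [tuple j; i]) /\
  forall l, (l < m)%N -> \sum_i \sum_j ((r : tpow V 2) [tuple i; j] : k) *
    bilin_eval (vbasis U)`_l (bvec i) (bvec j) = 0.
Proof.
pose M i j : k := (r : tpow V 2) [tuple i; j].
pose Z := \sum_i \sum_j cst (M i j) *: mul (wedge [:: ev i]) (wedge [:: ev j]).
have -> : quadratic_relations (coordinate_vec symU) r <-> Z = 0.
  rewrite /quadratic_relations sum_tuple2.
  set Y := \sum_i _; suff YE : cl_val Y = Z.
    by split=> [Y0|Z0]; [rewrite -YE Y0|apply: val_inj; rewrite /= YE Z0].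
  rewrite cl_val_sum; apply: eq_bigr => i _; rewrite cl_val_sum; apply: eq_bigr => j _.
  by rewrite -!cl_val_vec.
have -> : Z = \sum_i \sum_j cst (M i j) *:
    (skew_sign K i j *: ebe [set i; j] + universal_form U i j *: ext_one K n).
  apply: eq_bigr => i _; apply: eq_bigr => j _; congr (_ *: _).
  exact: clifford_mul2 (cl_mulP symU).
rewrite clifford_relation.
pose c (l : 'I_m) := \sum_i \sum_j M i j * bilin_eval (vbasis U)`_l (bvec i) (bvec j).
rewrite universal_sum linear_form_eq0 -/M.
split=> -[Msym c0]; split=> [i j|]; rewrite -/M.
- by apply/eqP; rewrite -subr_eq0 -PU_const_eq0 PU_constB Msym subrr.
- by move=> l lm; rewrite -[RHS](c0 (Ordinal lm)).
- by rewrite /M Msym.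
by move=> l; exact: c0.
Qed.
End QuadraticRelations.

Section DualForms.
Variables (k : fieldType) (V : vectType k).
Local Notation n := (\dim {:V}).
Local Notation W := (dual V).
Local Notation N := (\dim {:W}).
Local Notation S := (mpoly N k).
Local Notation x_ a := (mpolyX k (mnm1 a) : S).

Definition coordinate_form (i : 'I_n) : W := linfun (coord (vbasis {:V}) i : V -> k^o).

(** The basis chosen for [dual V] need not be dual to the one of V; this matrix compares them. *)
Definition dual_matrix (a : 'I_N) (i : 'I_n) : k := (bvec a : W) (bvec i).

Lemma coordinate_form_bvec i j : coordinate_form i (bvec j) = (i == j)%:R.
Proof.
by rewrite lfunE /= /bvec coord_free 1?eq_sym //; exact: basis_free (vbasisP _).
Qed.

Lemma bvec_expand (F : fieldType) (E : vectType F) (v : E) : v = \sum_a bcoord a v *: bvec a.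
Proof. exact: coord_vbasis (memvf v). Qed.

Lemma dual_expand (p : W) : p = \sum_i p (bvec i) *: coordinate_form i.
Proof.
apply/lfunP => v; rewrite sum_lfunE {1}(bvec_expand v) linear_sum; apply: eq_bigr => i _.
rewrite linearZ scale_lfunE lfunE; exact: mulrC.
Qed.

(** An element of [dual V] as a polynomial of degree 1 in the variables given by the chosen basis of
    [dual V]. *)
Definition linear_form (p : W) : S := \sum_a bcoord a p *: x_ a.

Lemma linear_form_sum (I : finType) (c : I -> k) (p : I -> W) :
  linear_form (\sum_i c i *: p i) = \sum_i c i *: linear_form (p i).
Proof.
rewrite /linear_form; under [RHS]eq_bigr do rewrite scaler_sumr.
rewrite exchange_big; apply: eq_bigr => a _; rewrite /bcoord linear_sum scaler_suml.
by apply: eq_bigr => i _; rewrite linearZ scalerA.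
Qed.

Lemma linear_form_bvec a : linear_form (bvec a) = x_ a.
Proof.
rewrite /linear_form (bigD1 a) //= big1 => [|b ba].
  by rewrite /bcoord /bvec coord_free ?eqxx ?scale1r ?addr0 //; exact: basis_free (vbasisP _).
rewrite /bcoord /bvec coord_free; last exact: basis_free (vbasisP _).
by rewrite eq_sym (negbTE ba) scale0r.
Qed.

Local Notation z_ i := (linear_form (coordinate_form i)).

Lemma var_expand a : x_ a = \sum_i dual_matrix a i *: z_ i.
Proof. by rewrite -linear_form_sum -dual_expand linear_form_bvec. Qed.

(** The bilinear form on V given by the tensor f, on the basis of V. *)
Definition tform (f : tensor_algebra W 2) (i j : 'I_n) : k :=
  \sum_a \sum_b ((f : tpow W 2) [tuple a; b] : k) * (dual_matrix a i * dual_matrix b j).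

Lemma tform_linear c f g i j : tform (c *: f + g) i j = c * tform f i j + tform g i j.
Proof.
rewrite /tform mulr_sumr -big_split; apply: eq_bigr => a _ /=.
rewrite mulr_sumr -big_split; apply: eq_bigr => b _ /=.
by rewrite !ffunE mulrDl -mulrA.
Qed.

Lemma tform_sum (I : finType) (c : I -> k) (f : I -> tensor_algebra W 2) i j :
  tform (\sum_l c l *: f l) i j = \sum_l c l * tform (f l) i j.
Proof.
elim: (index_enum I) => [|l r IH]; last by rewrite !big_cons tform_linear IH.
rewrite !big_nil /tform big1 // => a _; rewrite big1 // => b _.
by rewrite ffunE mul0r.
Qed.

Lemma tvec2E (p q : W) a b : (tvec2 p q : tpow W 2) [tuple a; b] = bcoord a p * bcoord b q.
Proof. by rewrite !ffunE !tnth_mktuple /=; congr (bcoord _ p * bcoord _ q). Qed.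

Lemma dual_evalE (p : W) i : p (bvec i) = \sum_a bcoord a p * dual_matrix a i.
Proof.
rewrite {1}(bvec_expand p) sum_lfunE; apply: eq_bigr => a _.
by rewrite scale_lfunE.
Qed.

Lemma tform_tvec2 p q i j : tform (tvec2 p q) i j = p (bvec i) * q (bvec j).
Proof.
rewrite !dual_evalE mulr_suml; apply: eq_bigr => a _.
rewrite mulr_sumr; apply: eq_bigr => b _; rewrite tvec2E; ring.
Qed.

Lemma pairing2E f r : pairing2 f r =
  \sum_i \sum_j ((r : tpow V 2) [tuple i; j] : k) * tform f i j.
Proof.
rewrite /pairing2 exchange_big sum_tuple2; apply: eq_bigr => i _; apply: eq_bigr => j _.
rewrite sum_tuple2 mulr_sumr; apply: eq_bigr => a _; rewrite mulr_sumr; apply: eq_bigr => b _.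
rewrite [f _ * _]mulrC -mulrA; congr (_ * (_ * _)).
Qed.

Lemma sym2E f : sym2 f = \sum_i \sum_j tform f i j *: (z_ i * z_ j).
Proof.
rewrite /sym2 sum_tuple2.
transitivity (\sum_a \sum_b \sum_i \sum_j
    (((f : tpow W 2) [tuple a; b] : k) * (dual_matrix a i * dual_matrix b j)) *: (z_ i * z_ j)).
  apply: eq_bigr => a _; apply: eq_bigr => b _.
  have -> : mcontent [tuple a; b] = mnm_add (mnm1 a) (mnm1 b).
    by apply/mnmP => l; rewrite mcontentE mnmDE !mnm1E /= addn0.
  rewrite mpolyXD !var_expand mulr_suml scaler_sumr; apply: eq_bigr => i _.
  rewrite mulr_sumr scaler_sumr; apply: eq_bigr => j _.
  by rewrite -scalerAl -scalerAr !scalerA mulrA.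
rewrite -sum4C exchange_big; apply: eq_bigr => i _; apply: eq_bigr => j _.
by rewrite scaler_suml; apply: eq_bigr => a _; rewrite scaler_suml.
Qed.
End DualForms.

Section QuadraticDual.
Variables (k : fieldType) (V : vectType k) (U : {vspace bilin V}).
Hypothesis symU : symmetric_forms U.
Hypothesis two : (2%:R : k) != 0.
Local Notation n := (\dim {:V}).
Local Notation W := (dual V).
Local Notation N := (\dim {:W}).
Local Notation xi := (@coordinate_form k V).
Hypothesis mN : \dim U = N.

Definition basis_form (l : nat) (i j : 'I_n) : k :=
  bilin_eval (vbasis U)`_l (bvec i) (bvec j).

Lemma basis_form_sym l i j : (l < N)%N -> basis_form l i j = basis_form l j i.
Proof. by rewrite -mN => lm; apply: symU; rewrite vbasis_mem // mem_nth // size_tuple. Qed.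

Definition form_tensor (l : nat) : tensor_algebra W 2 :=
  \sum_(p : 'I_n * 'I_n) basis_form l p.1 p.2 *: tvec2 (xi p.1) (xi p.2).

Lemma tform_form_tensor l i j : tform (form_tensor l) i j = basis_form l i j.
Proof.
rewrite tform_sum (bigD1 (i, j)) //= tform_tvec2 !coordinate_form_bvec !eqxx !mulr1.
rewrite big1 ?addr0 // => -[i' j']; rewrite xpair_eqE negb_and tform_tvec2 !coordinate_form_bvec /=.
by case/orP => /negbTE ->; rewrite ?mul0r !mulr0.
Qed.

Definition form_poly (l : 'I_N) : mpoly N k := sym2 (form_tensor l).

Local Notation Rd f := (forall r, quadratic_relations (coordinate_vec symU) r ->
  pairing2 f r = 0).

Lemma dual_relation_comm a b :
  Rd (tvec2 (bvec a) (bvec b) - tvec2 (bvec b) (bvec a) : tensor_algebra W 2).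
Proof.
move=> r /quadratic_relationsP [rsym _]; rewrite pairing2E.
pose G i j : k := (r : tpow V 2) [tuple i; j] * ((bvec a : W) (bvec i) * (bvec b : W) (bvec j)).
transitivity (\sum_i \sum_j G i j - \sum_i \sum_j G j i).
  rewrite -sumrB; apply: eq_bigr => i _; rewrite -sumrB; apply: eq_bigr => j _.
  rewrite addrC -scaleN1r tform_linear !tform_tvec2 /G [(r : tpow V 2) [tuple j; i]]rsym.
  ring.
by rewrite [X in _ - X]exchange_big subrr.
Qed.

Lemma dual_relation_form (l : 'I_N) : Rd (form_tensor l).
Proof.
move=> r /quadratic_relationsP [_ rU]; rewrite pairing2E -[RHS](rU l) ?mN //.
by apply: eq_bigr => i _; apply: eq_bigr => j _; rewrite tform_form_tensor.
Qed.

(** A subspace of a finite-dimensional space is its own double annihilator; the bilinear forms are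
    flattened to row vectors to use the cokernel of a matrix. *)
Lemma form_double_annihilator (F : 'I_n -> 'I_n -> k) :
  (forall r : 'I_n -> 'I_n -> k,
    (forall l : 'I_N, \sum_i \sum_j r i j * basis_form l i j = 0) ->
    \sum_i \sum_j r i j * F i j = 0) ->
  exists c : 'I_N -> k, forall i j, F i j = \sum_l c l * basis_form l i j.
Proof.
move=> Fr; pose d := #|{: 'I_n * 'I_n}|.
pose A : 'M[k]_(N, d) := \matrix_(l, p) basis_form l (enum_val p).1 (enum_val p).2.
pose v : 'rV[k]_d := \row_p F (enum_val p).1 (enum_val p).2.
have sumE (r G : 'I_n -> 'I_n -> k) : \sum_i \sum_j r i j * G i j =
    \sum_(p < d) G (enum_val p).1 (enum_val p).2 * r (enum_val p).1 (enum_val p).2.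
  rewrite pair_big (reindex (@enum_val _ {: 'I_n * 'I_n})) /=; last exact: onW_bij (enum_val_bij _).
  by apply: eq_bigr => p _; rewrite mulrC.
have : (v <= A)%MS.
  rewrite submxE; apply/eqP/rowP => q; rewrite mxE [RHS]mxE.
  pose r i j := cokermx A (enum_rank (i, j)) q.
  have rE p : r (enum_val p).1 (enum_val p).2 = cokermx A p q.
    by rewrite /r -surjective_pairing enum_valK.
  rewrite -[RHS](Fr r) => [|l].
    rewrite sumE; apply: eq_bigr => p _; by rewrite rE mxE.
  rewrite sumE; have := congr1 (fun M : 'M_(N, d) => M l q) (mulmx_coker A).
  rewrite !mxE => e; rewrite -[RHS]e; apply: eq_bigr => p _.
  by rewrite rE; congr (_ * _); rewrite [RHS]mxE.
case/submxP => D vD; exists (fun l => D 0 l) => i j.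
have := congr1 (fun M : 'rV_d => M 0 (enum_rank (i, j))) vD.
rewrite !mxE enum_rankK /= => ->; apply: eq_bigr => l _.
by rewrite mxE enum_rankK.
Qed.

(** Only the symmetrization F of f counts in [sym2]. Symmetrizing a test tensor r orthogonal to U
    yields a relation, so that F is orthogonal to the annihilator of U and lies in the span of the
    basis forms. The factor 2 gained by symmetrizing is inverted. *)
Lemma dual_relation_ideal f : Rd f -> in_ideal form_poly (sym2 f).
Proof.
move=> Rf; pose F i j := tform f i j + tform f j i.
have [r rU|c cE] := @form_double_annihilator F.
  pose r' : tensor_algebra V 2 :=
    [ffun t : 2.-tuple 'I_n => r (tnth t ord0) (tnth t ord_max) + r (tnth t ord_max) (tnth t ord0)].
  have r'E i j : (r' : tpow V 2) [tuple i; j] = r i j + r j i.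
    by rewrite ffunE.
  have tr (G : 'I_n -> 'I_n -> k) : \sum_i \sum_j (r i j + r j i) * G i j =
      \sum_i \sum_j r i j * (G i j + G j i).
    transitivity (\sum_i \sum_j r i j * G i j + \sum_i \sum_j r j i * G i j).
      rewrite -big_split; apply: eq_bigr => i _; rewrite -big_split; apply: eq_bigr => j _ /=.
      by rewrite mulrDl.
    rewrite [X in _ + X]exchange_big -big_split; apply: eq_bigr => i _ /=.
    by rewrite -big_split; apply: eq_bigr => j _ /=; rewrite mulrDr.
  rewrite -tr -[RHS](Rf r').
    rewrite pairing2E; apply: eq_bigr => i _; apply: eq_bigr => j _.
    by rewrite r'E.
  apply/quadratic_relationsP; split=> [i j|l lm]; first by rewrite !r'E addrC.
  have lN : (l < N)%N by rewrite -mN.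
  under eq_bigr do under eq_bigr do rewrite r'E.
  rewrite tr; transitivity (2%:R * \sum_i \sum_j r i j * basis_form (Ordinal lN) i j).
    rewrite mulr_sumr; apply: eq_bigr => i _; rewrite mulr_sumr; apply: eq_bigr => j _.
    by rewrite -/(basis_form l i j) -/(basis_form l j i) (basis_form_sym j i lN) /=; ring.
  by rewrite rU mulr0.
exists (fun l => mpolyC N (2%:R^-1 * c l)).
have e : sym2 f *+ 2 = \sum_l c l *: form_poly l.
  rewrite mulr2n {2}sym2E exchange_big /= {1}sym2E -big_split /=.
  under [RHS]eq_bigr do rewrite /form_poly sym2E scaler_sumr.
  rewrite exchange_big; apply: eq_bigr => i _ /=.
  under [RHS]eq_bigr do rewrite scaler_sumr.
  rewrite exchange_big -big_split; apply: eq_bigr => j _ /=.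
  rewrite [X in _ + _ *: X]mulrC -scalerDl -/(F i j) cE scaler_suml.
  by apply: eq_bigr => l _; rewrite tform_form_tensor scalerA.
have -> : sym2 f = 2%:R^-1 *: (sym2 f *+ 2).
  by rewrite -scaler_nat scalerA mulVf // scale1r.
rewrite e scaler_sumr; apply: eq_bigr => l _.
by rewrite scalerA mul_mpolyC.
Qed.

Theorem quadratic_dual_presented :
  exists al : forall d, tw_ix (@all_mon N) d -> quadratic_dual (coordinate_vec symU) d,
    presented al form_poly.
Proof.
apply: commutative_presented => [i j|l|r].
- exact: dual_relation_comm.
- by exists (form_tensor l); first exact: dual_relation_form.
exact: dual_relation_ideal.
Qed.

Variables (K : closedFieldType) (iota : {rmorphism k -> K}).

(** A common zero y, given in the basis of [dual V], is converted to coordinates x in the basis of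
    V, where [base_point_free] applies; [var_expand] recovers y from x. *)
Lemma form_poly_bpf : base_point_free U iota -> forall y : 'I_N -> K,
  (forall l, meval y (map_mpoly iota (form_poly l)) = 0) -> forall a, y a = 0.
Proof.
move=> bpf y y0; have psi_sum (I : finType) (F : I -> mpoly N k) :
    meval y (map_mpoly iota (\sum_i F i)) = \sum_i meval y (map_mpoly iota (F i)).
  apply: (big_morph (fun p => meval y (map_mpoly iota p))) => [p q|].
    by rewrite raddfD mevalD.
  by rewrite raddf0 meval0.
pose x i := meval y (map_mpoly iota (linear_form (xi i))).
have x0 i : x i = 0.
  apply: (bpf) => u uU.
  have uE i' j : bilin_eval u (bvec i') (bvec j) =
      \sum_(l < \dim U) coord (vbasis U) l u * basis_form l i' j.
    rewrite /basis_form /bilin_eval {1}(coord_vbasis uU) sum_lfunE sum_lfunE.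
    by apply: eq_bigr => l _; rewrite !scale_lfunE.
  transitivity (\sum_(l < \dim U) iota (coord (vbasis U) l u) *
      \sum_i \sum_j iota (basis_form l i j) * (x i * x j)).
    under [RHS]eq_bigr do rewrite mulr_sumr.
    rewrite [RHS]exchange_big; apply: eq_bigr => i' _ /=.
    under [RHS]eq_bigr do rewrite mulr_sumr.
    rewrite [RHS]exchange_big; apply: eq_bigr => j _ /=.
    rewrite uE rmorph_sum mulr_suml; apply: eq_bigr => l _.
    by rewrite rmorphM -mulrA.
  rewrite big1 // => l _; have lN : (l < N)%N by rewrite -mN.
  have := y0 (Ordinal lN); rewrite /form_poly sym2E => e.
  rewrite (_ : \sum_i1 _ = 0) ?mulr0 // -[RHS]e psi_sum.
  apply: eq_bigr => i' _; rewrite psi_sum; apply: eq_bigr => j _.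
  by rewrite tform_form_tensor /= map_mpoly_scale mevalZ rmorphM mevalM.
move=> a; have := congr1 (fun p => meval y (map_mpoly iota p)) (var_expand a).
rewrite map_mpolyX mevalXU => ->; rewrite psi_sum big1 // => i _ /=.
by rewrite map_mpoly_scale mevalZ -/(x i) x0 mulr0.
Qed.

End QuadraticDual.

(** * The two chains of families *)

Lemma fibers_of_one_family_sym (k : fieldType) (A A' : galg k) :
  fibers_of_one_family A A' -> fibers_of_one_family A' A.
Proof. by move=> [S [F [x [x' [cS xA xA']]]]]; exists S, F, x', x. Qed.

Lemma dim_dual (k : fieldType) (V : vectType k) : \dim {:dual V} = \dim {:V}.
Proof. by rewrite !dimvf /dim /= muln1. Qed.

Lemma squares_koszul_exact (k : fieldType) (K : closedFieldType) (iota : {rmorphism k -> K}) n :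
  [pchar k] =i pred0 -> koszul_exact (fun i : 'I_n => mpolyX k (mnm1 i) ^+ 2).
Proof.
move=> char0; apply: (koszul_exact_bpf (iota := iota) char0 (d := 2)) => // [l|y y0 l].
  rewrite expr2 -mpolyXD; have := @homX k n (mnm_add (mnm1 l) (mnm1 l)).
  by rewrite mdegD mdeg1.
have := y0 l; rewrite rmorphXn /= map_mpolyX (rmorphXn (meval y)) /= mevalXU => /eqP.
by rewrite sqrf_eq0 => /eqP.
Qed.

Unset Implicit Arguments.

Theorem corollary4p8 (k : fieldType) (k_char0 : [pchar k] =i pred0)
    (kbar : closedFieldType) (iota : {rmorphism k -> kbar})
    (iota_algebraic : forall z : kbar, algebraicOver iota z)
    (n : nat) (n_ge1 : (1 <= n)%N)
    (V : vectType k) (dimV : \dim {:V} = n)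
    (U : {vspace bilin V}) (symU : symmetric_forms U) (dimU : \dim U = n)
    (bpfU : base_point_free U iota) :
  flat_deformation (coordinate_algebra symU) (symmetric_algebra V) /\
  flat_deformation (quadratic_dual (coordinate_vec symU))
                   (exterior_algebra (dual V)).
Proof.
have two : (2%:R : k) != 0 := natr_neq0 k_char0 1.
split.
  have V0 : (0 < \dim {:V})%N by rewrite dimV.
  have mn : \dim U = \dim {:V} by rewrite dimU.
  apply: t_trans (t_step _ _ _ _ (fibers_of_one_family_sym (coordinate_algebra_rees symU mn V0))) _.
  apply: t_step; apply: twist_family (symmetric_has_sc erefl); last exact: sc_galg_has_sc.
    by [].
  by [].
have mN : \dim U = \dim {:dual V} by rewrite dim_dual dimU.
set N := \dim {:dual V} in mN.
pose A1 := tw_galg (@sqfree_down N) (sqfree0 N) (1 : k) 1.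
have A1sc : has_sc A1 (fun i j l => @tw_gam N (@sqfree N) k 1 1 i j l) (@tw_ups N (@sqfree N) k).
  exact: sc_galg_has_sc.
apply: (t_trans _ _ _ A1); last first.
  by apply/t_step/(twist_family _ _ A1sc (exterior_has_sc two erefl));
    [exact: sqfree_down|exact: sqfree0].
apply: t_step.
have [al0 P0] := quadratic_dual_presented symU two mN.
have [al1 P1] := sqfree_presented A1sc.
pose f (b : bool) : 'I_N -> mpoly N k :=
  if b then fun i => mpolyX k (mnm1 i) ^+ 2 else form_poly U.
pose A (b : bool) := if b then A1 else quadratic_dual (coordinate_vec symU).
pose al (b : bool) : forall d, tw_ix (@all_mon N) d -> A b d :=
  if b as b' return forall d, tw_ix (@all_mon N) d -> A b' d then al1 else al0.
have hf b t : hom 2 (f b t).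
  case: b; last exact: hom_sym2.
  rewrite /f expr2 -mpolyXD; have := @homX k N (mnm_add (mnm1 t) (mnm1 t)).
  by rewrite mdegD mdeg1.
have kf b : koszul_exact (f b).
  case: b; first exact: squares_koszul_exact iota _ k_char0.
  apply: (koszul_exact_bpf (iota := iota) k_char0 (d := 2)) => //.
  exact: form_poly_bpf.
by apply: (complete_intersection_family hf kf (A := A) (al := al)); case.
Qed.
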